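(* Let $(P_t)_{t\ge0}$ be the transition semigroup on $L^2(\mu)$ of a Markov process with invariant probability measure $\mu$ and generator $\mathcal L$. Suppose that $k\in L^2(\mu\otimes\mu)$ is a symmetric, non-negative definite kernel, and let $K$ be the corresponding integral operator $(Kg)(x)=\int_Sk(x,y)g(y)\,\mu(\mathrm dy)$ on $L^2(\mu)$. Then for all $\varepsilon>0$, $$t^K_{\mathrm{rel}}(P,\varepsilon)\ \le\ \tfrac12\,\overline t_{\mathrm{rel}}(P^{(2)})\cdot\bigl\lceil\log(C\|k\|_{L^2(\mu\otimes\mu)}\varepsilon^{-2})\bigr\rceil\ \le\ \frac{e}{\mathrm s(\mathcal L^{(2)})}\cdot\bigl\lceil\log(C\|k\|_{L^2(\mu\otimes\mu)}\varepsilon^{-2})\bigr\rceil,$$ where $C\in(0,\infty)$ is a universal constant.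
   Context: $S$ is a Polish space with its Borel $\sigma$-algebra, $(p_t)_{t\ge0}$ is the transition function of a time-homogeneous Markov process on $S$ with invariant probability measure $\mu$, and $(P_tf)(x)=\int f(y)\,p_t(x,\mathrm dy)$. Then $(P_t)_{t\ge 0}$ is a strongly continuous contraction semigroup on $L^2(\mu)$ preserving $L^2_0(\mu)=\{f\in L^2(\mu):\int f\,\mathrm d\mu=0\}$; $(\mathcal L,\mathrm{Dom}(\mathcal L))$ is its generator. $K$-relaxation time: $t^K_{\mathrm{rel}}(P,\varepsilon)=\inf\{t\ge0:\|K^{1/2}P_t\|_{L_0^2(\mu)\to L_0^2(\mu)}\le\varepsilon\}$, i.e. the first $t$ with $\|K^{1/2}P_tf\|\le\varepsilon\|f\|$ for all $f\in L_0^2(\mu)$, where $K^{1/2}$ is the non-negative self-adjoint square root of the Hilbert–Schmidt operator $K$. Two-point motion: $(P_t^{(2)})_{t\ge0}=(P_t\otimes P_t)_{t\ge0}$ on $L^2(S\times S,\mu\otimes\mu)$, $P^{(2)}_t(g\otimes h)=(P_tg)\otimes(P_th)$, with generator $\mathcal L^{(2)}$. Its time averages are $\overline P^{(2)}_tf=\frac1t\int_0^tP^{(2)}_sf\,\mathrm ds$, and $\overline t_{\mathrm{rel}}(P^{(2)})=\inf\{t\ge0:\|\overline P^{(2)}_s\|_{L_0^2(\mu\otimes\mu)\to L_0^2(\mu\otimes\mu)}\le1/e\text{ for all }s\ge t\}$. The singular value gap is $\mathrm s(\mathcal L^{(2)})=\inf\{\|\mathcal L^{(2)}f\|/\|f\|:f\in\mathrm{Dom}(\mathcal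 L^{(2)})\cap L_0^2(\mu\otimes\mu),f\neq0\}$. Here $L_0^2(\mu\otimes\mu)$ denotes the mean-zero functions in $L^2(\mu\otimes\mu)$.
   Formalization: The ceiling is replaced by its positive part, max(0, ⌈log(C‖k‖ε⁻²)⌉), because for large ε the ceiling is negative while the relaxation time on the left is non-negative; for k = 0, where the log is undefined, this factor is taken to be 0. *)

(* Defs.v *)
(* MathComp-Analysis *)
From HB Require Import structures.
From mathcomp Require Import all_boot all_order all_algebra.
From mathcomp Require Import all_classical all_reals all_analysis.

Set Implicit Arguments.
Unset Strict Implicit.
Unset Printing Implicit Defensive.

Import Order.TTheory GRing.Theory Num.Theory.
Import numFieldNormedType.Exports.

Local Open Scope classical_set_scope.
Local Open Scope ring_scope.

(* Separable, with the topology induced by some complete metric. *)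
Definition polish (R : realType) (S : topologicalType) : Prop :=
  (exists2 D : set S, countable D & dense D) /\
  exists dist : S -> S -> R,
    [/\ (forall x y, 0 <= dist x y) /\ (forall x y, dist x y = 0 <-> x = y),
        (forall x y, dist x y = dist y x),
        (forall x y z, dist x z <= dist x y + dist y z),
        (forall (x : S) (A : set S), nbhs x A <->
           exists2 e, 0 < e & [set y | dist x y < e] `<=` A) &
        (forall u : nat -> S,
           (forall e, 0 < e -> exists N, forall m n,
              (N <= m)%N -> (N <= n)%N -> dist (u m) (u n) < e) ->
           exists l : S, u @ \oo --> l)].

Notation borel S := (g_sigma_algebraType (@open S)).

(* Elements of the real space L^2(mu) are represented by square-integrable
   functions, and operators on L^2(mu) by maps between functions; everything
   below depends on these only up to almost everywhere equality. *)
Section L2.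
Context d (T : measurableType d) (R : realType).
Variable mu : {measure set T -> \bar R}.

Definition L2 : set (T -> R) := [set f | f \in Lfun mu 2%:E].

Definition L20 : set (T -> R) := [set f | L2 f /\ \int[mu]_x f x = 0].

Definition L2norm (f : T -> R) : \bar R := ('N[mu]_2%:E[EFin \o f])%E.

Definition inner (f g : T -> R) : R := \int[mu]_x (f x * g x).

Definition opnorm0 (A : (T -> R) -> (T -> R)) : \bar R :=
  ereal_sup [set L2norm (A f) | f in [set f | L20 f /\ (L2norm f <= 1)%E]].

Definition bounded_op (A : (T -> R) -> (T -> R)) : Prop :=
  [/\ (forall f, L2 f -> L2 (A f)),
      (forall (a : R) f g, L2 f -> L2 g ->
         A (fun x => a * f x + g x) = (fun x => a * A f x + A g x) %[ae mu]) &
      exists M : R, forall f, L2 f -> (L2norm (A f) <= M%:E * L2norm f)%E].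

(* The square root is unique up to a.e. equality. *)
Definition nonneg_sqrt (K Q : (T -> R) -> (T -> R)) : Prop :=
  [/\ bounded_op Q,
      (forall f g, L2 f -> L2 g -> inner (Q f) g = inner f (Q g)),
      (forall f, L2 f -> 0 <= inner (Q f) f) &
      (forall f, L2 f -> Q (Q f) = K f %[ae mu])].

Definition strongly_continuous (P : R -> (T -> R) -> (T -> R)) : Prop :=
  forall f, L2 f ->
    (fun h : R => L2norm (fun x => P h f x - f x)) @ 0^'+ --> 0%E.

(* generator P f g: f is in the domain of the generator, which maps f to g. *)
Definition generator (P : R -> (T -> R) -> (T -> R)) (f g : T -> R) : Prop :=
  [/\ L2 f, L2 g &
      (fun h : R => L2norm (fun x => h^-1 * (P h f x - f x) - g x))
        @ 0^'+ --> 0%E].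

(* ereal_inf set0 = +oo is only reached when L^2_0(mu) = {0}. *)
Definition sing_gap (P : R -> (T -> R) -> (T -> R)) : \bar R :=
  ereal_inf [set r | exists f g,
    [/\ generator P f g, L20 f, L2norm f != 0%E &
        r = (L2norm g / L2norm f)%E]].

(* (1/t) \int_0^t P_s f ds as the integral of an L^2(mu)-valued map, i.e. the
   a.e. unique g in L^2(mu) such that <g, h> = (1/t) \int_0^t <P_s f, h> ds
   for all h. For a strongly continuous semigroup P it exists and is the
   Bochner integral as well as the L^2-limit of Riemann sums. At t = 0 it is 0
   since 0^-1 = 0; this does not affect the infimum in t_rel_avg. *)
Definition time_avg (P : R -> (T -> R) -> (T -> R)) (t : R) (f : T -> R)
    : T -> R :=
  xget (cst 0) [set g | L2 g /\ forall h, L2 h ->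
    inner g h = t^-1 * \int[lebesgue_measure]_(s in `[0, t]) inner (P s f) h].

Definition t_rel_avg (P : R -> (T -> R) -> (T -> R)) : \bar R :=
  ereal_inf [set t%:E | t in [set t : R | 0 <= t /\ forall s, t <= s ->
    (opnorm0 (time_avg P s) <= (expR 1)^-1%:E)%E]].

(* Q is the square root of K. *)
Definition t_rel_K (Q : (T -> R) -> (T -> R))
    (P : R -> (T -> R) -> (T -> R)) (eps : R) : \bar R :=
  ereal_inf [set t%:E | t in [set t : R | 0 <= t /\
    (opnorm0 (fun f => Q (P t f)) <= eps%:E)%E]].

End L2.

Section markov.
Context d (T : measurableType d) (R : realType).

Definition transition_function (p : R -> R.-pker T ~> T) : Prop :=
  (forall x A, measurable A -> p 0 x A = (\d_x A)%E) /\
  (forall s t x A, 0 <= s -> 0 <= t -> measurable A ->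
     p (s + t) x A = (\int[p s x]_y p t y A)%E).

Definition invariant_measure (p : R -> R.-pker T ~> T)
    (mu : probability T R) : Prop :=
  forall t A, 0 <= t -> measurable A -> (\int[mu]_x p t x A = mu A)%E.

Definition transition_semigroup (p : R -> R.-pker T ~> T) (t : R)
    (f : T -> R) : T -> R :=
  fun x => \int[p t x]_y f y.

Definition tensor (g h : T -> R) : T * T -> R := fun z => g z.1 * h z.2.

Variable mu : probability T R.

(* A2 = A (x) A: the unique bounded operator on L^2(mu (x) mu) acting on
   elementary tensors as g (x) h |-> (A g) (x) (A h). *)
Definition tensor_square (A : (T -> R) -> (T -> R))
    (A2 : (T * T -> R) -> (T * T -> R)) : Prop :=
  bounded_op (mu \x mu)%E A2 /\
  forall g h, L2 mu g -> L2 mu h ->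
    A2 (tensor g h) = tensor (A g) (A h) %[ae (mu \x mu)%E].

Definition symmetric_kernel (k : T * T -> R) : Prop :=
  \forall z \ae (mu \x mu)%E, k (z.2, z.1) = k z.

Definition nonneg_definite (k : T * T -> R) : Prop :=
  forall f, L2 mu f ->
    0 <= \int[(mu \x mu)%E]_z (k z * (f z.1 * f z.2)).

Definition integral_operator (k : T * T -> R) (g : T -> R) : T -> R :=
  fun x => \int[mu]_y (k (x, y) * g y).

End markov.

(* Main.v *)
(* Let s be such that the time average of P2 over [0, s] has norm at most 1/e on L20, and let
   f be mean-zero. For F = U + i W a complex combination of vectors P_r f, the bound applied to
   F (x) conj F says that the average of |<P_t F, F>|^2 over 0 <= t <= s is at most |F|^4 / e.
   Take F_z = \sum_j (e^{b/m} z)^j P_{j s/m} f over j < T m, with 0 <= b <= 1 and z a root of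
   unity. Up to terms at both ends and a rotation, P_t F_z is e^{-b t/s} F_z, and the average of
   e^{-2t/s} over [0, s] exceeds 1/e, so the end terms must dominate. Summing over z by
   Plancherel and letting m grow gives, for x_k = |P_{k s} f|^2 and 1 <= beta <= e^2,
     \sum_{k<T} beta^k x_k <= M (x_0 + beta^T x_T),
   and increasing beta step by step from 1 to e^2 turns this into x_k <= M e^{-2k} x_0. Applied
   also to half steps, this is |P_{n s/2} f|^2 <= C e^{-n} |f|^2, and the first inequality
   follows from |K^{1/2} g|^2 = <k, g (x) g> <= |k| |g|^2.
   For the second inequality, the time average g of a unit vector f over [0, s] is in the domain
   of the generator of P2, which maps it to (P2_s f - f) / s, of norm at most 2 / s; hence
   |g| is at most 2 / s divided by the singular value gap.
   That P2 is a strongly continuous contraction semigroup follows from the density of the finite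
   sums of elementary tensors, the contraction property from a Gram matrix argument. *)

Require Import Defs.
From HB Require Import structures.
From mathcomp Require Import all_boot all_order all_algebra.
From mathcomp Require Import all_classical all_reals all_analysis measurable_realfun.
From mathcomp Require Import ring lra.

Set Implicit Arguments.
Unset Strict Implicit.
Unset Printing Implicit Defensive.

Import Order.TTheory GRing.Theory Num.Theory.
Import numFieldNormedType.Exports.

Local Open Scope classical_set_scope.
Local Open Scope ring_scope.

(** * Decay from weighted sums *)

(** The process need not be reversible, so [P_t] may oscillate at unknown frequencies, and time
    averages of <P_t F, F> itself can be small through cancellation. Tensoring with the conjugate
    removes the phase: <P2_t (F (x) conj F), F (x) conj F> = |<P_t F, F>|^2 is non-negative and
    insensitive to rotations of P_t F. Taking all roots of unity z at once tests every frequency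
    without selecting one. The room in the argument is the strict inequality (1 - e^{-2}) / 2 > 1 /
    e, about 0.432 against 0.368; it permits weights up to e^{t/s}, hence the decay of |P_t f|^2
    like e^{-2t/s}, which is the origin of the factor 1/2 in the theorem. For beta > 1 the end term
    beta^T x_T cannot be discarded at once, because no decay of x_T is known a priori; at beta = 1
    contraction bounds it. Since M depends neither on T nor on beta, a bounded end term at one beta
    gives geometric decay of the weighted terms at a rate fixed by M, and this pays for a slightly
    larger beta. *)

(* The tails S_k satisfy S_k <= M (S_k - S_k.+1). *)
Lemma tail_sum_decay (R : realFieldType) (M : R) (y : nat -> R) (l : nat) :
  1 < M -> (forall k, 0 <= y k) ->
  (forall k, (k <= l)%N -> \sum_(k <= j < l.+1) y j <= M * y k) ->
  y l <= (1 - M^-1) ^+ l * (M * y 0%N).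
Proof.
move=> M1 y0 H.
have M0 : 0 < M by apply: lt_trans M1.
have q0 : 0 <= 1 - M^-1 by rewrite subr_ge0 invf_le1 // ltW.
have step k : (k <= l)%N ->
    \sum_(k <= j < l.+1) y j <= (1 - M^-1) ^+ k * (M * y 0%N).
  elim: k => [_|k IH kl]; first by rewrite expr0 mul1r; exact: H.
  rewrite exprS -mulrA; apply: le_trans (ler_wpM2l q0 (IH (ltnW kl))).
  have := H k (ltnW kl); rewrite big_ltn; last by rewrite ltnS ltnW.
  set S := \sum_(_ <= _ < _) _ => h.
  have : (y k + S) / M <= y k by rewrite ler_pdivrMr // mulrC.
  lra.
by have := step l (leqnn l); rewrite big_nat1.
Qed.

(** Otherwise all terms from [n0] on exceed [e] and the partial sums are unbounded. It provides
    arbitrarily late indices at which the end term of a weighted sum is negligible. *)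
Lemma bounded_sum_small_term (R : archiRealFieldType) (u : nat -> R) (C e : R)
    (n0 : nat) :
  (forall j, 0 <= u j) -> (forall n, \sum_(j < n) u j <= C) -> 0 < e ->
  exists2 n, (n0 <= n)%N & u n <= e.
Proof.
move=> u0 uC e0; apply: contrapT => h.
have ue n : (n0 <= n)%N -> e < u n.
  by move=> nn; rewrite ltNge; apply/negP => ?; apply: h; exists n.
have low n : e *+ n <= \sum_(j < n0 + n) u j.
  elim: n => [|n IH]; first by rewrite mulr0n sumr_ge0.
  by rewrite addnS big_ord_recr /= mulrSr lerD // ltW // ue // leq_addr.
have := archi_boundP (_ : 0 <= `|C| / e); rewrite divr_ge0 ?(ltW e0)// => /(_ erefl).
set n := Num.bound _; rewrite ltr_pdivrMr // mulr_natl => hn.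
have := le_trans (low n) (uC _); rewrite leNgt => /negP; apply.
exact: le_lt_trans (ler_norm C) hn.
Qed.

(* If b ^+ k * x k is bounded then the hypothesis at b makes its tails decay geometrically,
   so the boundedness survives a slight increase of b; finitely many steps reach B. *)
Lemma geometric_sum_bootstrap (R : archiRealFieldType) (M B K : R) (x : nat -> R) :
  1 < M -> 1 <= B -> (forall k, 0 <= x k <= K) ->
  (forall b k n, 1 <= b <= B ->
     \sum_(j < n) b ^+ j * x (k + j)%N <= M * (x k + b ^+ n * x (k + n)%N)) ->
  forall k, B ^+ k * x k <= M * x 0%N.
Proof.
move=> M1 B1 xK H.
have M0 : 0 < M by apply: lt_trans M1.
pose q := 1 - M^-1.
have q0 : 0 < q by rewrite subr_gt0 invf_lt1.
have q1 : q < 1 by rewrite ltrBlDr ltrDl invr_gt0.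
have step b K' : 1 <= b <= B -> (forall k, b ^+ k * x k <= K') ->
    forall k, b ^+ k * x k <= q ^+ k * (M * x 0%N).
  move=> bB bK.
  have b1 : 1 <= b by case/andP: bB.
  have b0 : 0 <= b by apply: le_trans b1.
  have t0 k j : 0 <= b ^+ j * x (k + j)%N.
    by rewrite mulr_ge0 ?exprn_ge0 //; case/andP: (xK (k + j)%N).
  have tK k j : b ^+ j * x (k + j)%N <= K'.
    apply: le_trans (bK (k + j)%N); rewrite ler_wpM2r //.
      by case/andP: (xK (k + j)%N).
    by rewrite ler_weXn2l // leq_addl.
  (* The partial sums are bounded by M (x_k + K'), so some later n' has its end term below e / M;
     the hypothesis at n' then holds without the end term, up to [e]. *)
  have tail k n : \sum_(j < n) b ^+ j * x (k + j)%N <= M * x k.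
    apply/ler_addgt0Pr => e e0.
    have [n' nn' sm] := @bounded_sum_small_term R (fun j => b ^+ j * x (k + j)%N)
      (M * (x k + K')) (e / M) n (t0 k)
      (fun n => le_trans (H b k n bB) (ler_wpM2l (ltW M0) (lerD (lexx _) (tK k n))))
      (divr_gt0 e0 M0).
    apply: (@le_trans _ _ (\sum_(j < n') b ^+ j * x (k + j)%N)).
      rewrite -(big_mkord xpredT (fun j => b ^+ j * x (k + j)%N)).
      rewrite -(big_mkord xpredT (fun j => b ^+ j * x (k + j)%N)).
      by rewrite (@big_cat_nat _ _ _ n 0 n') //= lerDl sumr_ge0.
    apply: (le_trans (H b k n' bB)); rewrite mulrDr lerD2l.
    by rewrite mulrC -ler_pdivlMr.
  move=> k.
  have := @tail_sum_decay R M (fun j => b ^+ j * x j) k M1.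
  rewrite expr0 mul1r; apply; first by move=> j; have := t0 0%N j.
  move=> i ik; rewrite -{1}[i]add0n big_addn big_mkord.
  under eq_bigr => j _ do rewrite addnC exprD -mulrA.
  rewrite -mulr_sumr mulrCA ler_wpM2l ?exprn_ge0 //; exact: tail.
(* Each round multiplies [b] by q^-1, capped at [B]; the factor q^k gained in [step] is exactly what
   keeps (b / q)^k x_k bounded. *)
have bnd n : exists2 b, 1 <= b <= B & (B <= b \/ q ^- n <= b) /\
    exists K', forall k, b ^+ k * x k <= K'.
  elim: n => [|n [b bB [hb [K' bK]]]].
    exists 1; first by rewrite lexx.
    split; first by right; rewrite expr0 invr1.
    by exists K => k; rewrite expr1n mul1r; case/andP: (xK k).
  have bk := step b K' bB bK.
  have b1 : 1 <= b by case/andP: bB.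
  have bq1 : 1 <= b / q by rewrite ler_pdivlMr // mul1r (le_trans (ltW q1)).
  exists (Num.min B (b / q)); first by rewrite le_min B1 bq1 ge_min lexx.
  split.
    case: hb => hb.
      left; rewrite le_min lexx /= ler_pdivlMr // (le_trans _ hb) //.
      by rewrite ler_piMr ?ltW // (lt_le_trans ltr01).
    case: (leP B (b / q)) => h; first by left.
    by right; rewrite exprSr invfM ler_wpM2r // invr_ge0 ltW.
  exists (M * x 0%N) => k.
  have xk : 0 <= x k by case/andP: (xK k).
  apply: (@le_trans _ _ ((b / q) ^+ k * x k)).
    rewrite ler_wpM2r // lerXn2r ?nnegrE ?ge_min ?lexx ?orbT //.
      by rewrite le_min !(le_trans ler01).
    exact: le_trans bq1.
  rewrite exprMn exprVn mulrAC ler_pdivrMr ?exprn_gt0 //.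
  by rewrite [X in _ <= X]mulrC; exact: bk.
have [n nB] : exists n, B <= q ^- n.
  have : (fun n => q ^+ n) @ \oo --> 0 by apply: cvg_expr; rewrite gtr0_norm.
  have B0 : 0 < B by apply: lt_le_trans B1.
  move/cvgrPdist_le => /(_ B^-1); rewrite invr_gt0 => /(_ B0) [n _ hn].
  exists n; have := hn n (leqnn n); rewrite /= sub0r normrN gtr0_norm ?exprn_gt0 //.
  by rewrite -{2}[B]invrK lef_pV2 ?posrE ?invr_gt0 ?exprn_gt0.
have [b bB [hb [K' bK]]] := bnd n.
have -> : B = b.
  apply/le_anti; rewrite (proj2 (andP bB)) andbT.
  by case: hb => // hb; apply: (le_trans nB).
move=> k; apply: (le_trans (step b K' bB bK k)).
rewrite ler_piMl // ?mulr_ge0 ?(ltW M0) //; first by case/andP: (xK 0%N).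
by rewrite exprn_ile1 // ltW.
Qed.

(** Definiteness is left out because the vectors will be functions: two functions that agree almost
    everywhere are distinct vectors at distance 0. Identities between L2 classes accordingly become
    statements that a norm vanishes. *)
Definition semi_inner (R : realType) (V : lmodType R) (ip : V -> V -> R) : Prop :=
  [/\ forall u v, ip u v = ip v u,
      forall a u v w, ip (a *: u + v) w = a * ip u w + ip v w &
      forall u, 0 <= ip u u].

(** * Semi-inner products and the discrete Fourier transform *)

Section semi_inner_theory.
Context (R : realType) (V : lmodType R) (ip : V -> V -> R).
Hypothesis ipP : semi_inner ip.
Implicit Types (u v w : V).

Lemma ipC u v : ip u v = ip v u. Proof. by case: ipP. Qed.

Lemma ip_ge0 u : 0 <= ip u u. Proof. by case: ipP. Qed.

Lemma ip0l w : ip 0 w = 0.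
Proof.
case: ipP => _ l _; have := l 1 0 0 w; rewrite scale1r addr0 mul1r; lra.
Qed.

Lemma ipDl u v w : ip (u + v) w = ip u w + ip v w.
Proof. by case: ipP => _ l _; rewrite -[u in LHS]scale1r l mul1r. Qed.

Lemma ipZl a u w : ip (a *: u) w = a * ip u w.
Proof. by case: ipP => _ l _; rewrite -[X in ip X w]addr0 l ip0l addr0. Qed.

Lemma ipNl u w : ip (- u) w = - ip u w.
Proof. by rewrite -scaleN1r ipZl mulN1r. Qed.

Lemma ipBl u v w : ip (u - v) w = ip u w - ip v w.
Proof. by rewrite ipDl ipNl. Qed.

Lemma ipDr u v w : ip w (u + v) = ip w u + ip w v.
Proof. by rewrite ipC ipDl !(ipC w). Qed.

Lemma ipZr a u w : ip w (a *: u) = a * ip w u.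
Proof. by rewrite ipC ipZl (ipC w). Qed.

Lemma ipNr u w : ip w (- u) = - ip w u.
Proof. by rewrite ipC ipNl (ipC w). Qed.

Lemma ip_suml I (r : seq I) (P : pred I) (F : I -> V) w :
  ip (\sum_(i <- r | P i) F i) w = \sum_(i <- r | P i) ip (F i) w.
Proof. by apply: (big_morph (fun u => ip u w)) => [u v|]; rewrite ?ip0l ?ipDl. Qed.

Lemma ip_sumr I (r : seq I) (P : pred I) (F : I -> V) w :
  ip w (\sum_(i <- r | P i) F i) = \sum_(i <- r | P i) ip w (F i).
Proof. by rewrite ipC ip_suml; apply: eq_bigr => i _; rewrite ipC. Qed.

Lemma ip_cauchy_schwarz u v : ip u v ^+ 2 <= ip u u * ip v v.
Proof.
have quad t : 0 <= ip u u + 2 * t * ip u v + t ^+ 2 * ip v v.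
  suff -> : ip u u + 2 * t * ip u v + t ^+ 2 * ip v v = ip (u + t *: v) (u + t *: v).
    exact: ip_ge0.
  by rewrite !(ipDl, ipDr, ipZl, ipZr) (ipC v u); ring.
have u0 := ip_ge0 u; have v0 := ip_ge0 v.
have [vv|vv] := eqVneq (ip v v) 0.
  have [->|uv] := eqVneq (ip u v) 0; first by rewrite expr0n /= mulr_ge0.
  (* With [ip v v = 0] the quadratic is affine in t, and this t gives it the value -1. *)
  have := quad (- (ip u u + 1) / (2 * ip u v)); rewrite vv mulr0 addr0.
  have -> : 2 * (- (ip u u + 1) / (2 * ip u v)) * ip u v = - (ip u u + 1).
    by field.
  lra.
have v_gt0 : 0 < ip v v by rewrite lt_def vv v0.
have := quad (- ip u v / ip v v).
have -> : ip u u + 2 * (- ip u v / ip v v) * ip u v +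
    (- ip u v / ip v v) ^+ 2 * ip v v = ip u u - ip u v ^+ 2 / ip v v by field.
by rewrite subr_ge0 ler_pdivrMr.
Qed.

Lemma ip_add_le u v : ip (u + v) (u + v) <= 2 * ip u u + 2 * ip v v.
Proof.
have := ip_ge0 (u - v); rewrite !(ipDl, ipDr, ipNl, ipNr) (ipC v u); lra.
Qed.

End semi_inner_theory.

Section discrete_fourier.
Context (R : realType).

(** The argument of the j-th power of the m-th of the N-th roots of unity. *)
Definition phase (N m j : nat) : R := m%:R * j%:R * (2 * pi / N%:R).

(** With x = 2 pi k / N, multiplication by 2 sin (x / 2) makes the sum telescope to sin (N x - x /
    2) + sin (x / 2), which is 0 since N x is a multiple of 2 pi. The bounds on [k] keep sin (x / 2)
    away from 0. *)
Lemma sum_cos_phase (N k : nat) : (0 < k < N)%N ->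
  \sum_(m < N) cos (phase N m k) = 0.
Proof.
case/andP => k0 kN.
have N0 : 0 < N%:R :> R by rewrite ltr0n (leq_trans _ kN).
pose x : R := k%:R * (2 * pi / N%:R).
have sx : sin (x / 2) != 0.
  apply/lt0r_neq0/sin_gt0_pi; rewrite /x.
  have -> : k%:R * (2 * pi / N%:R) / 2 = pi * (k%:R / N%:R) :> R by field; lra.
  have pi0 := pi_gt0 R.
  apply/andP; split; first by rewrite mulr_gt0 // divr_gt0 // ltr0n.
  by rewrite gtr_pMr // ltr_pdivrMr // mul1r ltr_nat.
have tel n : 2 * sin (x / 2) * \sum_(m < n) cos (phase N m k) =
    sin (n%:R * x - x / 2) + sin (x / 2).
  elim: n => [|n IH]; first by rewrite big_ord0 mulr0 mul0r sub0r sinN addNr.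
  rewrite big_ord_recr /= mulrDr IH.
  have -> : phase N n k = n%:R * x by rewrite /phase -mulrA.
  have -> : n.+1%:R * x - x / 2 = n%:R * x + x / 2 by rewrite -natr1; field.
  rewrite sinB sinD; ring.
have h : sin (N%:R * x - x / 2) = - sin (x / 2).
  have -> : N%:R * x - x / 2 = - (x / 2) + (pi *+ 2) *+ k.
    by rewrite /x -(mulr_natr (pi *+ 2)) -(mulr_natr pi); field; lra.
  by rewrite (periodicn (@sinD2pi R)) sinN.
have := tel N; rewrite h addNr => /eqP.
by rewrite !mulf_eq0 pnatr_eq0 (negPf sx) /= => /eqP.
Qed.

Context (V : lmodType R) (ip : V -> V -> R).
Hypothesis ipP : semi_inner ip.

(** The two summands are the squared real and imaginary parts of the transform. The coefficient of
    <v_j, v_i> is the cosine of a phase difference, whose sum over m is N for i = j and 0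
    otherwise. *)
Lemma plancherel (N : nat) (v : nat -> V) :
  \sum_(m < N)
    (ip (\sum_(j < N) cos (phase N m j) *: v j) (\sum_(j < N) cos (phase N m j) *: v j) +
     ip (\sum_(j < N) sin (phase N m j) *: v j) (\sum_(j < N) sin (phase N m j) *: v j))
  = N%:R * \sum_(j < N) ip (v j) (v j).
Proof.
transitivity (\sum_(m < N) \sum_(j < N) \sum_(i < N)
    (cos (phase N m j) * cos (phase N m i) + sin (phase N m j) * sin (phase N m i))
      * ip (v j) (v i)).
  apply: eq_bigr => m _; rewrite !(ip_suml ipP) -big_split; apply: eq_bigr => j _.
  rewrite !(ip_sumr ipP) -big_split; apply: eq_bigr => i _ /=.
  rewrite !(ipZl ipP) !(ipZr ipP); ring.
rewrite exchange_big mulr_sumr; apply: eq_bigr => j _ /=.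
rewrite exchange_big (bigD1 j) //= [X in _ + X]big1 ?addr0.
  under eq_bigr => m _ do rewrite -!expr2 cos2Dsin2 mul1r.
  by rewrite sumr_const card_ord mulr_natl.
move=> i ij; rewrite -mulr_suml; apply/eqP; rewrite mulf_eq0; apply/orP; left; apply/eqP.
have dist (a b : nat) : (a < b < N)%N -> \sum_(m < N)
    (cos (phase N m a) * cos (phase N m b) + sin (phase N m a) * sin (phase N m b)) = 0.
  case/andP => ab bN.
  transitivity (\sum_(m < N) cos (phase N m (b - a))); last first.
    by apply: sum_cos_phase; rewrite subn_gt0 ab (leq_ltn_trans (leq_subr _ _) bN).
  apply: eq_bigr => m _; rewrite -cosB -cosN /phase natrB ?(ltnW ab) //.
  by congr cos; ring.
case: (ltngtP i j) => [h|h|h].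
- by rewrite -[RHS](dist i j) ?h ?ltn_ord //; apply: eq_bigr => m _; ring.
- by rewrite dist // h ltn_ord.
- by move: ij; rewrite -val_eqE /= h eqxx.
Qed.

End discrete_fourier.

(** * Orbits with averaged decay of correlations *)

(* The average of e^{-2t} over [0, 1] minus e^{-1}. *)
Definition exp_gap (R : realType) : R := (1 - expR (- 2)) / 2 - expR (- 1).

(** With q = 1 / e the gap is (1 - 2 q - q^2) / 2, positive for q < sqrt 2 - 1, about 0.4142. The
    bound q <= 0.41 follows from e >= (1 + 1/4)^4 > 2.44. *)
Lemma exp_gap_gt0 (R : realType) : 0 < exp_gap R.
Proof.
rewrite /exp_gap.
have e4 : expR 1 = expR (1 / 4) ^+ 4 :> R.
  by rewrite -expRM_natl; congr expR; field.
have e1 : (1 + 1 / 4) ^+ 4 <= expR 1 :> R.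
  by rewrite e4 lerXn2r ?nnegrE ?expR_ge0 ?expR_ge1Dx //; lra.
have -> : expR (- 2) = expR (- 1) ^+ 2 :> R.
  by rewrite -expRM_natl; congr expR; ring.
have q0 := expR_gt0 (- 1 : R).
have q1 : expR (- 1) <= 41 / 100 :> R.
  rewrite expRN -[leRHS]invrK lef_pV2 ?posrE ?expR_gt0 //; lra.
have : expR (- 1) ^+ 2 <= (41 / 100) ^+ 2 :> R by rewrite lerXn2r ?nnegrE ?(ltW q0) //; lra.
lra.
Qed.

(** A left Riemann sum of a decreasing function dominates the integral. Here the sum is geometric
    with ratio y = e^{-2/k}, and 1 - y <= 2 / k. *)
Lemma sum_expR_ge (R : realType) (k : nat) : (0 < k)%N ->
  k%:R * ((1 - expR (- 2)) / 2) <= \sum_(l < k) expR (- 2 * (l%:R / k%:R)) :> R.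
Proof.
move=> k0; have K0 : 0 < k%:R :> R by rewrite ltr0n.
pose y : R := expR (- 2 / k%:R).
have -> : \sum_(l < k) expR (- 2 * (l%:R / k%:R)) = \sum_(l < k) y ^+ l.
  by apply: eq_bigr => l _; rewrite -expRM_natl; congr expR; field; lra.
have yk : y ^+ k = expR (- 2) by rewrite -expRM_natl; congr expR; field; lra.
have y1 : 1 - y <= 2 / k%:R.
  by have := expR_ge1Dx (- 2 / k%:R : R); rewrite -/y mulNr; lra.
have S0 : 0 <= \sum_(l < k) y ^+ l.
  by apply: sumr_ge0 => l _; rewrite exprn_ge0 // expR_ge0.
have := subrX1 y k; rewrite yk => h.
have : 1 - expR (- 2) <= 2 / k%:R * \sum_(l < k) y ^+ l.
  have -> : 1 - expR (- 2) = (1 - y) * \sum_(l < k) y ^+ l by rewrite -opprB h; ring.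
  by rewrite ler_wpM2r.
by rewrite mulrAC ler_pdivlMr // => ?; rewrite mulrA ler_pdivrMr // mulrC [leRHS]mulrC.
Qed.

(** [G] lives on the first [J] indices, so the [m] spare places of the window have room for a delay
    by i <= m, and nothing is cut off. *)
Lemma sum_delay (V : zmodType) (J m i : nat) (G : nat -> V) : (i <= m)%N ->
  (forall j, (J <= j)%N -> G j = 0) ->
  \sum_(j < J + m) G j = \sum_(j < J + m) (if (i <= j)%N then G (j - i)%N else 0).
Proof.
move=> im GJ.
rewrite -(big_mkord xpredT G).
rewrite -(big_mkord xpredT (fun j => if (i <= j)%N then G (j - i)%N else 0)).
rewrite (@big_cat_nat _ _ _ J 0) ?leq_addr //= [X in _ + X]big_nat_cond.
rewrite [X in _ + X]big1 ?addr0; last by move=> j /andP[/andP[? _] _]; exact: GJ.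
rewrite [RHS](@big_cat_nat _ _ _ i 0) ?(leq_trans im) ?leq_addl //=.
rewrite [X in _ = X + _]big_nat_cond [X in _ = X + _]big1 ?add0r; last first.
  by move=> j /andP[/andP[_ h] _]; rewrite leqNgt h.
rewrite [RHS](@big_cat_nat _ _ _ (J + i) i) ?leq_addl ?leq_add2l //=.
rewrite [X in _ = _ + X]big_nat_cond [X in _ = _ + X]big1 ?addr0; last first.
  move=> j /andP[/andP[h _] _]; rewrite (leq_trans _ h) ?leq_addl // GJ //.
  by rewrite leq_subRL ?(leq_trans _ h) ?leq_addl // addnC.
have := @big_addn V 0 +%R 0%N (J + i) i xpredT (fun j => if (i <= j)%N then G (j - i)%N else 0).
rewrite add0n addnK => ->; apply: eq_bigr => j _.
by rewrite leq_addl addnK.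
Qed.

Section orbits.
Context (R : realType) (V : lmodType R) (ip : V -> V -> R).
Hypothesis ipP : semi_inner ip.

(* |<U + i W, U0 + i W0>|^2 *)
Definition corr (U W U0 W0 : V) : R :=
  (ip U U0 + ip W W0) ^+ 2 + (ip W U0 - ip U W0) ^+ 2.

(** Write F = U + i W and F0 = U0 + i W0; the hypotheses say that e^{i phi} F is rho F0 plus the
    error E + i G. The rotation does not change |<F, F0>|; of its square only that of the real part
    rho |F0|^2 + X is kept, and the cross term is controlled by 2 |X| <= kap |F0|^2 + |error|^2 /
    kap. Dividing by |F0|^2 leaves a left-hand side quadratic in F0 and the error, as summation by
    Plancherel demands. If |F0| = 0, the quotient is 0 and the left-hand side is at most 0. *)
Lemma corr_ge (U W U0 W0 E G : V) (phi rho kap : R) :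
  0 <= rho <= 1 -> 0 < kap ->
  cos phi *: U - sin phi *: W = rho *: U0 + E ->
  sin phi *: U + cos phi *: W = rho *: W0 + G ->
  (rho ^+ 2 - kap) * (ip U0 U0 + ip W0 W0) - (ip E E + ip G G) / kap <=
  corr U W U0 W0 / (ip U0 U0 + ip W0 W0).
Proof.
case/andP => r0 r1 k0 hU hW.
set n2 := ip U0 U0 + ip W0 W0; set e2 := ip E E + ip G G.
have n20 : 0 <= n2 by rewrite addr_ge0 // (ip_ge0 ipP).
have e20 : 0 <= e2 by rewrite addr_ge0 // (ip_ge0 ipP).
have ek0 : 0 <= e2 / kap by rewrite divr_ge0 // ltW.
have [->|nn] := eqVneq n2 0; first by rewrite invr0 !mulr0 sub0r oppr_le0.
have n2p : 0 < n2 by rewrite lt_def nn n20.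
rewrite ler_pdivlMr //.
pose X := ip E U0 + ip G W0.
have amgm u v : - (kap * ip v v + ip u u / kap) <= 2 * ip u v.
  have := ip_ge0 ipP (kap^-1 *: u + v).
  rewrite !(ipDl ipP, ipDr ipP, ipZl ipP, ipZr ipP) (ipC ipP v u) => h.
  have : 0 <= kap * (kap^-1 * (kap^-1 * ip u u) + ip v v + 2 * (kap^-1 * ip u v)).
    by rewrite mulr_ge0 ?(ltW k0) //; lra.
  have -> : kap * (kap^-1 * (kap^-1 * ip u u) + ip v v + 2 * (kap^-1 * ip u v)) =
    ip u u / kap + kap * ip v v + 2 * ip u v by field; lra.
  lra.
have hX : - (kap * n2 + e2 / kap) <= 2 * X.
  have := amgm E U0; have := amgm G W0; rewrite /n2 /e2 /X mulrDl; lra.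
have -> : corr U W U0 W0 = (ip (cos phi *: U - sin phi *: W) U0 +
      ip (sin phi *: U + cos phi *: W) W0) ^+ 2 +
    (ip (sin phi *: U + cos phi *: W) U0 - ip (cos phi *: U - sin phi *: W) W0) ^+ 2.
  have cs : cos phi ^+ 2 = 1 - sin phi ^+ 2 by rewrite -(cos2Dsin2 phi) addrK.
  rewrite /corr !(ipDl ipP, ipNl ipP, ipZl ipP); ring: cs.
apply: (@le_trans _ _ ((rho * n2 + X) ^+ 2)); last first.
  rewrite hU hW !(ipDl ipP, ipZl ipP).
  have -> : rho * ip U0 U0 + ip E U0 + (rho * ip W0 W0 + ip G W0) = rho * n2 + X.
    by rewrite /n2 /X; ring.
  by rewrite lerDl sqr_ge0.
have h1 : - (n2 * (kap * n2 + e2 / kap)) <= rho * (n2 * (2 * X)).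
  apply: (@le_trans _ _ (rho * (n2 * - (kap * n2 + e2 / kap)))); last first.
    by rewrite ler_wpM2l // ler_wpM2l.
  by rewrite mulrN mulrN lerN2 ler_piMl // mulr_ge0 // addr_ge0 // mulr_ge0 // (ltW k0).
have h2 := sqr_ge0 X.
have -> : ((rho ^+ 2 - kap) * n2 - e2 / kap) * n2 =
  (rho * n2) ^+ 2 - n2 * (kap * n2 + e2 / kap) by ring.
have -> : (rho * n2 + X) ^+ 2 = (rho * n2) ^+ 2 + rho * (n2 * (2 * X)) + X ^+ 2 by ring.
lra.
Qed.

(** For the orbit [f] of a semigroup, this is P_t applied to the combination at time 0. *)
Definition combine (f : R -> V) n (r c : 'I_n -> R) (t : R) : V :=
  \sum_i c i *: f (r i + t).

(* Along the orbit f of a semigroup P, for F a complex combination of the f (r i):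
   the average of |<P_t F, F>|^2 over 0 <= t <= s is at most |F|^4 / e. *)
Definition mixing_orbit (s : R) (f : R -> V) : Prop :=
  forall n (r c d : 'I_n -> R), (forall i, 0 <= r i) -> forall eta, 0 < eta ->
  \forall k \near \oo,
    \sum_(l < k) corr (combine f r c (l%:R / k%:R * s)) (combine f r d (l%:R / k%:R * s))
                      (combine f r c 0) (combine f r d 0)
    <= k%:R * (expR (- 1) + eta) *
       (ip (combine f r c 0) (combine f r c 0) + ip (combine f r d 0) (combine f r d 0)) ^+ 2.

(** The continuity is uniform in [r], as it is along semigroup orbits: |P_{r+t} f - P_r f| <= |P_t f
    - f|. *)
Definition contracting_orbit (f : R -> V) : Prop :=
  (forall r t, 0 <= r -> 0 <= t -> ip (f (r + t)) (f (r + t)) <= ip (f r) (f r)) /\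
  forall eta, 0 < eta -> exists2 e, 0 < e & forall r t, 0 <= r -> 0 <= t <= e ->
    ip (f (r + t) - f r) (f (r + t) - f r) <= eta.

End orbits.

(** * Approximate eigenvectors on a time grid *)

Section orbit_sum.
Context (R : realType) (V : lmodType R) (ip : V -> V -> R).
Hypothesis ipP : semi_inner ip.
Variables (s : R) (f : R -> V).
Hypotheses (s0 : 0 < s) (fm : mixing_orbit ip s f) (fc : contracting_orbit ip f).

Lemma orbit_norm_le r t : 0 <= r -> r <= t -> ip (f t) (f t) <= ip (f r) (f r).
Proof.
case: fc => c _ r0 rt; have := c r (t - r) r0.
by rewrite subr_ge0 rt addrC subrK => /(_ isT).
Qed.

Let nf r := ip (f r) (f r).

Section grid.
Variables (b : R) (T m : nat).
Hypotheses (b01 : 0 <= b <= 1) (m0 : (0 < m)%N).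
(** [J] grid points of spacing s / m cover [T] horizons of length s. The [m] further indices in [N]
    make room for a delay by up to s, so that nothing wraps around in the cyclic Fourier sum. *)
Let J := (T * m)%N.
Let N := (J + m)%N.
Let dt : R := s / m%:R.
Let zeta : R := expR (b / m%:R).
Let w j : R := if (j < J)%N then zeta ^+ j else 0.
Let r (j : 'I_N) : R := j%:R * dt.
(* combine f r (c z) and combine f r (d z) are the real and imaginary parts of
   F_z = \sum_j w j * z^j * f (j dt), z ranging over the N-th roots of unity. The weights
   make P_t F_z close to e^{- b t / s} F_z up to a rotation and to terms at both ends. *)
Let c (z : nat) (j : 'I_N) : R := cos (phase R N z j) * w j.
Let d (z : nat) (j : 'I_N) : R := sin (phase R N z j) * w j.
Let W := \sum_(j < J) zeta ^+ (2 * j) * nf (j%:R * dt).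

Let mR0 : 0 < m%:R :> R. Proof. by rewrite ltr0n. Qed.
Let dt0 : 0 < dt. Proof. by rewrite divr_gt0. Qed.
Let zeta1 : 1 <= zeta.
Proof. by rewrite /zeta -expR0 ler_expR divr_ge0 ?ler0n //; case/andP: b01. Qed.

(** Multiplication by z^i delays the coefficient sequence by i places. Afterwards the phases agree
    with those of F_z at time 0, and the vector at place j is f ((j - i) dt + t), which is near f (j
    dt) when t is near i dt. *)
Lemma grid_delay (z i : nat) (t : R) : (i <= m)%N ->
  cos (phase R N z i) *: combine f r (c z) t - sin (phase R N z i) *: combine f r (d z) t
  = \sum_(j < N) cos (phase R N z j) *:
      (if (i <= j)%N then w (j - i)%N *: f ((j - i)%:R * dt + t) else 0) /\
  sin (phase R N z i) *: combine f r (c z) t + cos (phase R N z i) *: combine f r (d z) t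
  = \sum_(j < N) sin (phase R N z j) *:
      (if (i <= j)%N then w (j - i)%N *: f ((j - i)%:R * dt + t) else 0).
Proof.
move=> im.
have w0 j : (J <= j)%N -> w j = 0 by rewrite /w ltnNge => ->.
have phD j : phase R N z (j + i) = phase R N z j + phase R N z i.
  by rewrite /phase natrD; ring.
have key (F : R -> R) :
    \sum_(j < N) F (phase R N z (j + i)) *: (w j *: f (j%:R * dt + t)) =
    \sum_(j < N) F (phase R N z j) *:
      (if (i <= j)%N then w (j - i)%N *: f ((j - i)%:R * dt + t) else 0).
  pose G j := F (phase R N z (j + i)) *: (w j *: f (j%:R * dt + t)).
  rewrite -[LHS]/(\sum_(j < J + m) G j) (sum_delay im); last first.
    by move=> j /w0 h; rewrite /G h scale0r scaler0.
  apply: eq_bigr => j _; case: ifP => ij; last by rewrite scaler0.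
  by rewrite /G subnK.
rewrite -!key /combine !scaler_sumr; split.
  rewrite -sumrB; apply: eq_bigr => j _.
  by rewrite !scalerA -scalerBl /c /d phD cosD; congr (_ *: _); ring.
rewrite -big_split; apply: eq_bigr => j _ /=.
by rewrite !scalerA -scalerDl /c /d phD sinD; congr (_ *: _); ring.
Qed.

Lemma grid_sum0 (z : nat) :
  combine f r (c z) 0 = \sum_(j < N) cos (phase R N z j) *: (w j *: f (j%:R * dt)) /\
  combine f r (d z) 0 = \sum_(j < N) sin (phase R N z j) *: (w j *: f (j%:R * dt)).
Proof.
by split; apply: eq_bigr => j _; rewrite scalerA addr0.
Qed.

Lemma grid_norm :
  \sum_(z < N) (ip (combine f r (c z) 0) (combine f r (c z) 0) +
                ip (combine f r (d z) 0) (combine f r (d z) 0)) = N%:R * W.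
Proof.
under eq_bigr => z _ do rewrite (grid_sum0 z).1 (grid_sum0 z).2.
rewrite (plancherel ipP N (fun j => w j *: f (j%:R * dt))); congr (_ * _).
rewrite /N big_split_ord /= [X in _ + X]big1 ?addr0; last first.
  by move=> j _; rewrite /w ltnNge leq_addr /= scale0r (ip0l ipP).
apply: eq_bigr => j _; rewrite /w ltn_ord (ipZl ipP) (ipZr ipP) mulrA -expr2.
by rewrite -exprM mulnC.
Qed.

Variable eta : R.
Hypothesis small : forall q t, 0 <= q -> 0 <= t <= dt ->
  ip (f (q + t) - f q) (f (q + t) - f q) <= eta.

(** The error budget: [m] terms at the start, [m] at the end, and [T * m] interior ones. In the
    interior, 2 eta comes from the continuity of the orbit and 2 / m^2 from the decay of the weight
    within one grid cell. *)
Let X := m%:R * (expR (2 * b) * nf 0 + expR (2 * b) ^+ T * nf (T%:R * s) +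
   T%:R * (expR (2 * b) ^+ T * (2 * eta + 2 * m%:R ^- 2 * nf 0))).

Let rho (t : R) := expR (- (b * (t / s))).

Let E (i : nat) (t : R) (j : nat) : V :=
  (if (i <= j)%N then w (j - i)%N *: f ((j - i)%:R * dt + t) else 0)
  - rho t *: (w j *: f (j%:R * dt)).

(** Three ranges of j. For j < i the delayed sum has no term, and rho w_j f (j dt) is left, with j <
    m. For i <= j < J the two weights differ by the factor e^{-b tau / s}, which is within 1 / m of
    1, and f (j dt + tau) is close to f (j dt). For j >= J the weight w_j is 0, and only a delayed
    term survives, at a time not before T s. *)
Lemma grid_error (i : nat) (tau : R) : (i < m)%N -> 0 <= tau <= dt ->
  \sum_(j < N) ip (E i (i%:R * dt + tau) j) (E i (i%:R * dt + tau) j) <= X.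
Proof.
move=> im /andP[tau0 taud].
have /andP[b0 b1] := b01.
have mp := mR0; have sp := s0.
have zetaM : zeta ^+ m = expR b by rewrite -expRM_natl; congr expR; field; lra.
have eb2 : expR (2 * b) = zeta ^+ (2 * m) by rewrite mulnC exprM zetaM -expRM_natl.
have ebT : expR (2 * b) ^+ T = zeta ^+ (2 * J) by rewrite eb2 -exprM /J mulnAC mulnA.
have z0 n : 0 <= zeta ^+ n by rewrite exprn_ge0 // expR_ge0.
have nf0 t : 0 <= nf t by apply: ip_ge0.
have eta0 : 0 <= eta.
  by apply: le_trans (small (lexx 0) (_ : 0 <= 0 <= dt)); rewrite ?lexx ?(ltW dt0) //; apply: (ip_ge0 ipP).
set t := i%:R * dt + tau.
have rho1 : 0 <= rho t <= 1.
  rewrite expR_ge0 -expR0 ler_expR oppr_le0 mulr_ge0 // divr_ge0 ?(ltW s0) //.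
  by rewrite addr_ge0 // mulr_ge0 // (ltW dt0).
have nZ a v : ip (a *: v) (a *: v) = a ^+ 2 * ip v v.
  by rewrite (ipZl ipP) (ipZr ipP) mulrA -expr2.
pose err := 2 * eta + 2 * m%:R ^- 2 * nf 0.
have err0 : 0 <= err.
  by rewrite addr_ge0 ?mulr_ge0 ?invr_ge0 ?exprn_ge0 ?ler0n //; apply: (ip_ge0 ipP).
have bnd (j : 'I_N) : ip (E i t j) (E i t j) <= (if (j < m)%N then expR (2 * b) * nf 0 else 0) +
   (if (j < J)%N then expR (2 * b) ^+ T * err
    else expR (2 * b) ^+ T * nf (T%:R * s)).
  have ge0l : 0 <= (if (j < m)%N then expR (2 * b) * nf 0 else 0).
    by case: ifP => // _; rewrite mulr_ge0 ?expR_ge0.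
  have ge0r : 0 <= (if (j < J)%N then expR (2 * b) ^+ T * err
      else expR (2 * b) ^+ T * nf (T%:R * s)).
    by case: ifP => _; rewrite mulr_ge0 // ebT.
  have [ij|ij] := leqP i j; last first.
    rewrite (ltn_trans ij im) -[leLHS]addr0 lerD // /E leqNgt ij /= sub0r.
    rewrite (ipNl ipP) (ipNr ipP) opprK !nZ /w; case: ifP => _; last first.
      by rewrite expr0n /= mul0r mulr0 mulr_ge0 ?expR_ge0.
    have rho2 : rho t ^+ 2 <= 1 by rewrite expr_le1; case/andP: rho1.
    apply: (@le_trans _ _ ((zeta ^+ j) ^+ 2 * ip (f (j%:R * dt)) (f (j%:R * dt)))).
      by rewrite ler_piMl // mulr_ge0 // ?sqr_ge0 // (ip_ge0 ipP).
    apply: ler_pM; rewrite ?sqr_ge0 //; first exact: nf0.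
      rewrite eb2 -exprM mulnC ler_weXn2l // leq_pmul2l // ltnW //.
      exact: ltn_trans im.
    by apply: orbit_norm_le => //; rewrite mulr_ge0 // (ltW dt0).
  have tj : (j - i)%:R * dt + t = j%:R * dt + tau.
    by rewrite /t addrA -mulrDl -natrD subnK.
  rewrite -[leLHS]add0r lerD // /E ij tj.
  case: (ltnP j J) => jJ.
    have wj : w (j - i)%N = zeta ^+ (j - i).
      by rewrite /w (leq_ltn_trans (leq_subr _ _) jJ).
    have wj' : rho t * w j = zeta ^+ (j - i) * expR (- (b * (tau / s))).
      rewrite /w jJ /rho /t /zeta -!expRM_natl -!expRD natrB //; congr expR.
      by rewrite /dt; field; lra.
    rewrite wj scalerA wj' -scalerA -scalerBr nZ ebT.
    apply: ler_pM; rewrite ?sqr_ge0 //; first exact: (ip_ge0 ipP).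
      rewrite -exprM mulnC ler_weXn2l // leq_pmul2l //.
      exact: leq_trans (leq_subr _ _) (ltnW jJ).
    set q := expR _.
    have q1 : 0 <= 1 - q <= m%:R^-1.
      rewrite subr_ge0 /q -{1}expR0 ler_expR oppr_le0 mulr_ge0 ?divr_ge0 ?(ltW s0) //=.
      have : b * (tau / s) <= m%:R^-1.
        rewrite -[leRHS]mul1r ler_pM // ?divr_ge0 ?(ltW s0) //.
        by rewrite ler_pdivrMr // mulrC.
      have := expR_ge1Dx (- (b * (tau / s))); lra.
    have -> : f (j%:R * dt + tau) - q *: f (j%:R * dt) =
       (f (j%:R * dt + tau) - f (j%:R * dt)) + (1 - q) *: f (j%:R * dt).
      by rewrite scalerBl scale1r addrA subrK.
    apply: (le_trans (ip_add_le ipP _ _)); rewrite /err lerD //.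
      by rewrite ler_pM2l // small ?tau0 // mulr_ge0 // (ltW dt0).
    rewrite nZ -mulrA ler_pM2l //; apply: ler_pM => //; rewrite ?sqr_ge0 ?(ip_ge0 ipP) //.
      by case/andP: q1 => ? ?; rewrite -exprVn lerXn2r ?nnegrE ?invr_ge0 ?ler0n.
    by apply: orbit_norm_le => //; rewrite mulr_ge0 // (ltW dt0).
  have -> : w j = 0 by rewrite /w ltnNge jJ.
  rewrite scale0r scaler0 subr0 nZ ebT /w; case: ifP => jiJ; last first.
    by rewrite expr0n /= mul0r mulr_ge0.
  apply: ler_pM; rewrite ?sqr_ge0 ?(ip_ge0 ipP) //.
    by rewrite -exprM mulnC ler_weXn2l // leq_pmul2l // ltnW.
  have -> : T%:R * s = J%:R * dt by rewrite /J natrM /dt; field; lra.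
  apply: orbit_norm_le; first by rewrite mulr_ge0 // (ltW dt0).
  by rewrite -[leLHS]addr0 lerD // ler_wpM2r ?(ltW dt0) // ler_nat.
apply: (le_trans (ler_sum _ (fun j _ => bnd j))).
rewrite big_split /=.
have -> : \sum_(j < N) (if (j < m)%N then expR (2 * b) * nf 0 else 0) =
    m%:R * (expR (2 * b) * nf 0).
  rewrite -(big_mkord xpredT (fun j => if (j < m)%N then expR (2 * b) * nf 0 else 0)).
  rewrite (@big_cat_nat _ _ _ m 0) ?leq_addl //=.
  rewrite [X in _ + X]big_nat_cond [X in _ + X]big1 ?addr0; last first.
    by move=> j /andP[/andP[h _] _]; rewrite ltnNge h.
  rewrite big_nat_cond (eq_bigr (fun=> expR (2 * b) * nf 0)); last first.
    by move=> j /andP[/andP[_ ->] _].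
  by rewrite -big_nat_cond sumr_const_nat subn0 [RHS]mulr_natl.
have -> : \sum_(j < N) (if (j < J)%N then expR (2 * b) ^+ T * err
    else expR (2 * b) ^+ T * nf (T%:R * s)) =
    J%:R * (expR (2 * b) ^+ T * err) + m%:R * (expR (2 * b) ^+ T * nf (T%:R * s)).
  rewrite /N big_split_ord /=; congr (_ + _).
    rewrite (eq_bigr (fun=> expR (2 * b) ^+ T * err)); last by move=> j _; rewrite ltn_ord.
    by rewrite sumr_const card_ord [RHS]mulr_natl.
  rewrite (eq_bigr (fun=> expR (2 * b) ^+ T * nf (T%:R * s))); last first.
    by move=> j _; rewrite ltnNge leq_addr.
  by rewrite sumr_const card_ord [RHS]mulr_natl.
by rewrite le_eqVlt /X /J natrM -/err; apply/orP; left; apply/eqP; ring.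
Qed.


(** Upper and lower bounds are compared for the sum over z and over the times l s / k of |<P_t F_z,
    F_z>|^2 / |F_z|^2. With g the gap, mixing gives at most k (1/e + g/4) N W, while [corr_ge] with
    kap = g/4 and [plancherel] give at least k ((1 - e^{-2})/2 - g/4) N W - k N X / (g/4). What
    remains is (g/2) W <= 4 X / g. *)
Lemma grid_weighted_sum_le : W <= 8 / exp_gap R ^+ 2 * X.
Proof.
have g0 := exp_gap_gt0 R; set g := exp_gap R in g0 *.
have mp := mR0; have sp := s0; have dp := dt0.
have N0 : 0 < N%:R :> R by rewrite ltr0n addn_gt0 m0 orbT.
have W0 : 0 <= W.
  apply: sumr_ge0 => j _; rewrite mulr_ge0 ?(ip_ge0 ipP) //.
  by rewrite exprn_ge0 // expR_ge0.
pose n2 (z : nat) := ip (combine f r (c z) 0) (combine f r (c z) 0) +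
                ip (combine f r (d z) 0) (combine f r (d z) 0).
have n20 z : 0 <= n2 z by rewrite addr_ge0 // (ip_ge0 ipP).
have r0 j : 0 <= r j by rewrite mulr_ge0 // ltW.
(* There are finitely many z, so one mesh [k] serves them all. *)
have [k [k0 hk]] : exists k : nat, (0 < k)%N /\ forall z : 'I_N,
    \sum_(l < k) corr ip (combine f r (c z) (l%:R / k%:R * s))
       (combine f r (d z) (l%:R / k%:R * s)) (combine f r (c z) 0) (combine f r (d z) 0)
    <= k%:R * (expR (- 1) + g / 4) * n2 z ^+ 2.
  have g4 : 0 < g / 4 by rewrite divr_gt0.
  have h : \forall k \near \oo, (0 < k)%N /\ forall z : 'I_N,
    \sum_(l < k) corr ip (combine f r (c z) (l%:R / k%:R * s))
       (combine f r (d z) (l%:R / k%:R * s)) (combine f r (c z) 0) (combine f r (d z) 0)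
    <= k%:R * (expR (- 1) + g / 4) * n2 z ^+ 2.
    apply: filterI; first exact: nbhs_infty_gt.
    exact: (filter_forall _ (fun z : 'I_N => fm (c z) (d z) r0 g4)).
  by case: h => k0 _ /(_ k0 (leqnn k0)) ?; exists k0.
have K0 : 0 < k%:R :> R by rewrite ltr0n.
pose psi (z l : nat) := corr ip (combine f r (c z) (l%:R / k%:R * s))
       (combine f r (d z) (l%:R / k%:R * s)) (combine f r (c z) 0) (combine f r (d z) 0) / n2 z.
have up : \sum_(l < k) \sum_(z < N) psi z l <= k%:R * (expR (- 1) + g / 4) * (N%:R * W).
  rewrite -grid_norm mulr_sumr exchange_big /=; apply: ler_sum => z _.
  rewrite -mulr_suml -/(n2 z).
  have [->|nz] := eqVneq (n2 z) 0; first by rewrite invr0 !mulr0.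
  rewrite ler_pdivrMr ?lt_def ?nz ?n20 // -(mulrA _ (n2 z)) -expr2; exact: hk.
have low (l : 'I_k) : (expR (- 2 * (l%:R / k%:R)) - g / 4) * (N%:R * W) - N%:R * X / (g / 4)
    <= \sum_(z < N) psi z l.
  pose t := l%:R / k%:R * s.
  (* The time t = l s / k is split as i dt + tau, with i whole grid cells and a remainder tau <=
     dt. *)
  pose i := (l * m %/ k)%N.
  have im : (i < m)%N by rewrite ltn_divLR // mulnC ltn_pmul2l.
  pose tau := (l * m %% k)%:R / (k%:R * m%:R) * s.
  have tauE : i%:R * dt + tau = t.
    rewrite /tau /t /dt.
    have : l%:R * m%:R = i%:R * k%:R + (l * m %% k)%:R :> R.
      by rewrite -!natrM -natrD -divn_eq.
    move=> h; have -> : (l * m %% k)%:R = l%:R * m%:R - i%:R * k%:R :> R by rewrite h addrC addKr.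
    by field; lra.
  have tau0 : 0 <= tau <= dt.
    rewrite /tau /dt; apply/andP; split.
      by rewrite mulr_ge0 ?(ltW sp) // divr_ge0 // mulr_ge0.
    rewrite mulrC ler_pM2l // invfM mulrA ler_piMl ?invr_ge0 ?ler0n //.
    by rewrite ler_pdivrMr // mul1r ler_nat ltnW // ltn_mod.
  have ht : t / s = l%:R / k%:R by rewrite /t mulfK // gt_eqF.
  have lk0 : 0 <= l%:R / k%:R :> R by rewrite divr_ge0.
  have rho1 : 0 <= rho t <= 1.
    rewrite expR_ge0 -expR0 ler_expR oppr_le0 ht mulr_ge0 //; by case/andP: b01.
  pose Ec (z : nat) := \sum_(j < N) cos (phase R N z j) *: E i t j.
  pose Es (z : nat) := \sum_(j < N) sin (phase R N z j) *: E i t j.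
  have sumE (F : R -> R) (z : nat) :
      \sum_(j < N) F (phase R N z j) *: (if (i <= j)%N then w (j - i)%N *: f ((j - i)%:R * dt + t) else 0) =
      rho t *: (\sum_(j < N) F (phase R N z j) *: (w j *: f (j%:R * dt))) +
      \sum_(j < N) F (phase R N z j) *: E i t j.
    rewrite scaler_sumr -big_split; apply: eq_bigr => j _ /=.
    by rewrite scalerBr addrC !scalerA [rho t * F _]mulrC -!scalerA scalerA subrK.
  have one (z : 'I_N) : (rho t ^+ 2 - g / 4) * n2 z -
      (ip (Ec z) (Ec z) + ip (Es z) (Es z)) / (g / 4) <= psi z l.
    have [hc hs] := @grid_delay z i t (ltnW im).
    apply: (corr_ge ipP (phi := phase R N z i)) => //; first by rewrite divr_gt0.
      by rewrite hc sumE (grid_sum0 z).1.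
    by rewrite hs sumE (grid_sum0 z).2.
  apply: le_trans (ler_sum _ (fun z _ => one z)).
  rewrite sumrB -mulr_suml -mulr_sumr grid_norm (plancherel ipP N (E i t)).
  apply: lerB; last first.
    rewrite ler_wpM2r ?invr_ge0 ?divr_ge0 ?(ltW g0) // ler_wpM2l ?ler0n //.
    by rewrite -tauE; exact: grid_error.
  (* This is where b <= 1 enters: rho^2 = e^{-2 b t / s} is at least e^{-2 t / s}. *)
  rewrite ler_wpM2r ?mulr_ge0 ?ler0n // lerD2r /rho ht -expRM_natl ler_expR.
  have : b * (l%:R / k%:R) <= 1 * (l%:R / k%:R) by rewrite ler_wpM2r //; case/andP: b01.
  lra.
have := le_trans (ler_sum _ (fun l _ => low l)) up.
rewrite sumrB -mulr_suml sumrB !sumr_const card_ord.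
rewrite -(mulr_natl (g / 4) k) -(mulr_natl (N%:R * X / (g / 4)) k).
have hE := sum_expR_ge R k0; set S := \sum_(l < k) _ in hE *.
move=> h.
have h1 : (k%:R * ((1 - expR (- 2)) / 2) - k%:R * (g / 4)) * (N%:R * W) <=
    (S - k%:R * (g / 4)) * (N%:R * W).
  by rewrite ler_wpM2r ?mulr_ge0 ?ler0n // lerD2r.
have h2 : (k%:R * N%:R) * (g / 2 * W) <= (k%:R * N%:R) * (X / (g / 4)).
  have := le_trans (lerB h1 (lexx (k%:R * (N%:R * X / (g / 4))))) h.
  have -> : g / 2 = (1 - expR (- 2)) / 2 - expR (- 1) - g / 4 - g / 4.
    by rewrite -/(exp_gap R) -/g; field.
  lra.
move: h2; rewrite ler_pM2l ?mulr_gt0 // => h2.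
have -> : W = 2 / g * (g / 2 * W) by field; lra.
have -> : 8 / g ^+ 2 * X = 2 / g * (X / (g / 4)) by field; lra.
by rewrite ler_pM2l // divr_gt0.
Qed.

(** Each of the [m] grid points in the k-th horizon carries a weight of at least e^{2 b k}, and by
    contraction its norm is at least the norm at the end (k + 1) s of that horizon. *)
Lemma grid_weighted_sum_ge :
  m%:R * \sum_(k < T) expR (2 * b) ^+ k * nf (k.+1%:R * s) <= W.
Proof.
have mp := mR0; have sp := s0; have dp := dt0.
rewrite /W /J; elim: T => [|n IH]; first by rewrite big_ord0 mulr0 mul0n big_ord0.
rewrite big_ord_recr /= mulrDr mulSnr big_split_ord /= lerD //.
rewrite mulr_natl -[X in _ *+ X]card_ord -sumr_const; apply: ler_sum => j _.
apply: ler_pM; rewrite ?exprn_ge0 ?expR_ge0 ?(ip_ge0 ipP) //.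
  have -> : expR (2 * b) = zeta ^+ (2 * m).
    by rewrite /zeta -expRM_natl natrM; congr expR; field; lra.
  by rewrite -exprM ler_weXn2l // mulnDr [(n * m)%N]mulnC mulnA leq_addr.
apply: orbit_norm_le; first by rewrite mulr_ge0 // ltW.
have -> : n.+1%:R * s = (n.+1 * m)%:R * dt by rewrite /dt natrM; field; lra.
by rewrite ler_wpM2r ?(ltW dp) // ler_nat mulSnr leq_add2l ltnW.
Qed.

End grid.
End orbit_sum.

(** 8 / gap^2 comes from [grid_weighted_sum_le]. One factor e^2 pays for the index shift from
    x_{k+1} to x_k, the other for the weight e^{2b} of the starting terms. *)
Definition decay_const (R : realType) : R := 1 + expR 2 ^+ 2 * (8 / exp_gap R ^+ 2).

Lemma decay_const_gt1 (R : realType) : 1 < decay_const R.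
Proof.
by rewrite ltrDl mulr_gt0 ?exprn_gt0 ?expR_gt0 ?divr_gt0 ?exprn_gt0 ?exp_gap_gt0.
Qed.

Section orbit_decay.
Context (R : realType) (V : lmodType R) (ip : V -> V -> R).
Hypothesis ipP : semi_inner ip.
Variable s : R.
Hypothesis s0 : 0 < s.

(** Both grid estimates are divided by [m]; as the grid is refined with T and b fixed, the interior
    error disappears and only the terms at both ends are left. *)
Lemma orbit_sum_le (f : R -> V) (b : R) (T : nat) :
  mixing_orbit ip s f -> contracting_orbit ip f -> 0 <= b <= 1 ->
  \sum_(k < T) expR (2 * b) ^+ k * ip (f (k%:R * s)) (f (k%:R * s)) <=
  decay_const R * (ip (f 0) (f 0) + expR (2 * b) ^+ T * ip (f (T%:R * s)) (f (T%:R * s))).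
Proof.
move=> fm fc b01; pose x k := ip (f (k%:R * s)) (f (k%:R * s)).
have -> : ip (f 0) (f 0) = x 0%N by rewrite /x mul0r.
rewrite -/(x T); set B := expR (2 * b).
have x0 k : 0 <= x k by apply: ip_ge0.
have B1 : 1 <= B by rewrite /B -expR0 ler_expR mulr_ge0 //; case/andP: b01.
have B0 : 0 <= B by apply: le_trans B1.
have B2 : B <= expR 2 by rewrite ler_expR ler_piMr //; case/andP: b01.
set M0 := 8 / exp_gap R ^+ 2.
have M00 : 0 <= M0 by rewrite divr_ge0 // exprn_ge0 // ltW // exp_gap_gt0.
have lim : \sum_(k < T) B ^+ k * x k.+1 <= M0 * (B * x 0%N + B ^+ T * x T).
  apply/ler_addgt0Pr => e e0.
  pose A := M0 * (T%:R * B ^+ T).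
  have A0 : 0 <= A by rewrite mulr_ge0 // mulr_ge0 ?ler0n // exprn_ge0.
  (* This eta, together with m >= y below, makes each of the two interior errors 2 A eta and 2 A x_0
     / m^2 at most e / 2. *)
  pose eta := e / (4 * (A + 1)).
  have eta0 : 0 < eta by rewrite divr_gt0 // mulr_gt0 // ltr_wpDl.
  have [_ /(_ eta eta0) [dl dl0 hdl]] := fc.
  pose y := s / dl + 4 * A * x 0%N / e.
  have z0 : 0 <= 4 * A * x 0%N / e.
    by rewrite divr_ge0 ?(ltW e0) // mulr_ge0 // mulr_ge0.
  have y0 : 0 <= y by rewrite addr_ge0 // divr_ge0 // ltW.
  pose m := (Num.bound y).+1.
  have mp : 0 < m%:R :> R by rewrite ltr0n.
  have m1 : 1 <= m%:R :> R by rewrite ler1n.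
  have ym : y <= m%:R.
    by apply: le_trans (ltW (archi_boundP y0)) _; rewrite ler_nat leqnSn.
  have dtd : s / m%:R <= dl.
    rewrite ler_pdivrMr // mulrC -ler_pdivrMr //; apply: le_trans ym.
    by rewrite lerDl.
  have small q t : 0 <= q -> 0 <= t <= s / m%:R ->
      ip (f (q + t) - f q) (f (q + t) - f q) <= eta.
    by move=> q0 /andP[t0 tm]; apply: hdl; rewrite ?t0 ?(le_trans tm).
  have ge := grid_weighted_sum_ge ipP s0 fc T b01 (isT : (0 < m)%N).
  have le := grid_weighted_sum_le ipP s0 fm fc T b01 (isT : (0 < m)%N) small.
  have := le_trans ge le.
  rewrite -/B -/(x T) -/M0 (mulrCA M0) ler_pM2l // => h.
  apply: (le_trans h); rewrite mulrDr.
  have -> : ip (f 0) (f 0) = x 0%N by rewrite /x mul0r.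
  rewrite lerD2l.
  have -> : M0 * (T%:R * (B ^+ T * (2 * eta + 2 * m%:R ^- 2 * x 0%N))) =
     2 * A * eta + 2 * A * x 0%N / m%:R ^+ 2 by rewrite /A; ring.
  have h1 : 2 * A * eta <= e / 2.
    rewrite /eta mulrA ler_pdivrMr ?mulr_gt0 ?ltr_wpDl //.
    have : 0 <= A * e by rewrite mulr_ge0 // ltW.
    lra.
  have h2 : 2 * A * x 0%N / m%:R ^+ 2 <= e / 2.
    have h3 : 4 * A * x 0%N / e <= m%:R.
      by apply: le_trans ym; rewrite lerDr divr_ge0 ?(ltW s0) ?(ltW dl0).
    rewrite ler_pdivrMr ?exprn_gt0 //.
    rewrite ler_pdivrMr // in h3.
    have h4 : m%:R * e <= m%:R ^+ 2 * e by rewrite ler_pM2r // expr2 ler_peMl // ltW.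
    lra.
  lra.
case: T lim => [|n] lim.
  rewrite big_ord0 mulr_ge0 //; last by rewrite addr_ge0 // mulr_ge0 // exprn_ge0.
  exact/ltW/(lt_trans ltr01)/decay_const_gt1.
rewrite big_ord_recl expr0 mul1r.
have h1 : \sum_(i < n) B ^+ (bump 0 i) * x (bump 0 i) <= B * \sum_(k < n.+1) B ^+ k * x k.+1.
  rewrite big_ord_recr /= mulrDr mulr_sumr -[leLHS]addr0 lerD //.
    by apply: ler_sum => i _; rewrite /bump /= add1n exprS mulrA.
  by rewrite !mulr_ge0 // exprn_ge0.
apply: (@le_trans _ _ (x 0%N + B * (M0 * (B * x 0%N + B ^+ n.+1 * x n.+1)))).
  by rewrite lerD // (le_trans h1) // ler_wpM2l.
rewrite /decay_const -/M0 mulrDl mul1r; set Y := B ^+ n.+1 * x n.+1.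
have Y0 : 0 <= Y by rewrite mulr_ge0 // exprn_ge0.
apply: lerD; first by rewrite lerDl.
apply: (@le_trans _ _ (expR 2 * (M0 * (expR 2 * (x 0%N + Y))))).
  have BY : B * x 0%N + Y <= expR 2 * (x 0%N + Y).
    rewrite mulrDr lerD //; first by rewrite ler_wpM2r.
    by rewrite ler_peMl // (le_trans B1).
  apply: ler_pM => //; first by rewrite mulr_ge0 // addr_ge0 // mulr_ge0.
  by rewrite ler_wpM2l.
by rewrite le_eqVlt; apply/orP; left; apply/eqP; ring.
Qed.

Lemma mixing_orbit_shift (f : R -> V) (a : R) : 0 <= a ->
  mixing_orbit ip s f -> mixing_orbit ip s (fun t => f (a + t)).
Proof.
move=> a0 fm n r c d r0 eta eta0.
have E c' t : combine (fun t => f (a + t)) r c' t = combine f (fun i => a + r i) c' t.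
  by apply: eq_bigr => i _; rewrite addrA.
have := fm n (fun i => a + r i) c d (fun i => addr_ge0 a0 (r0 i)) eta eta0.
apply: filterS => k; rewrite !E.
by under [X in _ -> X <= _]eq_bigr => l _ do rewrite !E.
Qed.

Lemma contracting_orbit_shift (f : R -> V) (a : R) : 0 <= a ->
  contracting_orbit ip f -> contracting_orbit ip (fun t => f (a + t)).
Proof.
move=> a0 [c fcont]; split=> [r t r0 t0|eta eta0].
  by rewrite addrA; apply: c => //; rewrite addr_ge0.
have [e e0 h] := fcont eta eta0; exists e => // r t r0 te.
by rewrite addrA; apply: h => //; rewrite addr_ge0.
Qed.

(** Both orbit conditions survive a shift of time, so the weighted sum bound holds from every k
    onwards and the bootstrap applies with B = e^2. It controls whole multiples of s; for odd n the
    last half step is given away, at the cost of the factor e. *)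
Lemma orbit_decay (f : R -> V) (n : nat) :
  mixing_orbit ip s f -> contracting_orbit ip f ->
  ip (f (n%:R / 2 * s)) (f (n%:R / 2 * s)) <=
  decay_const R * expR 1 * expR (- n%:R) * ip (f 0) (f 0).
Proof.
move=> fm fc; pose x k := ip (f (k%:R * s)) (f (k%:R * s)).
have xE k : ip (f (k%:R * s)) (f (k%:R * s)) = x k by [].
have x0E : ip (f 0) (f 0) = x 0%N by rewrite /x mul0r.
have x0 k : 0 <= x k by apply: ip_ge0.
have D1 := decay_const_gt1 R.
have sum b k T : 1 <= b <= expR 2 -> \sum_(j < T) b ^+ j * x (k + j)%N <=
    decay_const R * (x k + b ^+ T * x (k + T)%N).
  case/andP=> b1 b2.
  have bE : b = expR (2 * (ln b / 2)).
    by rewrite mulrC divfK // lnK // posrE (lt_le_trans ltr01).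
  have ln01 : 0 <= ln b / 2 <= 1.
    rewrite divr_ge0 ?ln_ge0 //= ler_pdivrMr // mul1r -ler_expR lnK //.
    by rewrite posrE (lt_le_trans ltr01).
  have ks0 : 0 <= k%:R * s by rewrite mulr_ge0 // ltW.
  have := @orbit_sum_le _ _ T (mixing_orbit_shift ks0 fm) (contracting_orbit_shift ks0 fc) ln01.
  rewrite -bE addr0 -mulrDl -natrD.
  by under eq_bigr => j _ do rewrite -mulrDl -natrD.
have xb k : 0 <= x k <= x 0%N.
  by rewrite x0 /= /x (orbit_norm_le fc) ?mul0r // mulr_ge0 // ltW.
have e2 : 1 <= expR 2 :> R by rewrite -expR0 ler_expR.
have := geometric_sum_bootstrap D1 e2 xb sum.
move=> /(_ n./2) h.
rewrite x0E; apply: (@le_trans _ _ (x n./2)).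
  apply: (orbit_norm_le fc); first by rewrite mulr_ge0 // ltW.
  rewrite ler_wpM2r ?(ltW s0) // ler_pdivlMr // -natrM ler_nat muln2.
  by rewrite -[leqRHS]odd_double_half leq_addl.
have : expR n%:R <= expR 1 * expR 2 ^+ n./2 :> R.
  rewrite -expRM_natr -expRD ler_expR -natrM nat1r ler_nat.
  by rewrite -[leqLHS]odd_double_half mul2n -add1n leq_add2r leq_b1.
move=> h1.
rewrite expRN -mulrA -mulrA [_^-1 * _]mulrC mulrA mulrA ler_pdivlMr ?expR_gt0 //.
apply: (@le_trans _ _ (x n./2 * (expR 1 * expR 2 ^+ n./2))).
  by rewrite ler_wpM2l.
rewrite mulrCA [x _ * _]mulrC [X in _ <= X](_ : _ = expR 1 * (decay_const R * x 0%N)); last by ring.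
by rewrite ler_wpM2l // expR_ge0.
Qed.

End orbit_decay.

(** * Completeness of L2 *)

Lemma le1_2e (R : realType) : (1 <= 2%:E :> \bar R)%E.
Proof. by rewrite lee_fin ler1n. Qed.

Notation L2T mu := (LfunType mu (le1_2e _)).

Section L2_space.
Context d (T : measurableType d) (R : realType).
Variable mu : {measure set T -> \bar R}.
Implicit Types f g h : T -> R.

Lemma L2_measurable f : L2 mu f -> measurable_fun setT f.
Proof. by rewrite /L2 /= inE => /andP[/[!inE]]. Qed.

Lemma integrable_mulL2 f g : L2 mu f -> L2 mu g ->
  mu.-integrable setT (EFin \o (fun x => f x * g x)).
Proof. by move=> lf lg; apply/Lfun1_integrable; exact: Lfun2_mul_Lfun1. Qed.

Lemma L2norm_integral f :
  L2norm mu f = ((\int[mu]_x (f x ^+ 2)%:E) `^ 2^-1)%E.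
Proof.
rewrite /L2norm unlock; congr (_ `^ _)%E; apply: eq_integral => x _ /=.
by rewrite powR_mulrn ?normr_ge0 // real_normK ?num_real.
Qed.

Lemma L2P f : L2 mu f <->
  measurable_fun setT f /\ (\int[mu]_x (f x ^+ 2)%:E < +oo)%E.
Proof.
split=> [lf|[mf ff]].
  split; first exact: L2_measurable.
  have /integrableP[_] := integrable_mulL2 lf lf.
  by under eq_integral => x _ do rewrite /= ger0_norm -?expr2 ?sqr_ge0 //.
rewrite /L2 /= inE; apply/andP; split; first by rewrite inE.
rewrite inE /= /finite_norm -/(L2norm mu f) L2norm_integral.
exact: poweR_lty.
Qed.

Lemma EFin_inner f g : L2 mu f -> L2 mu g ->
  (inner mu f g)%:E = (\int[mu]_x (f x * g x)%:E)%E.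
Proof.
move=> lf lg; rewrite /inner /Rintegral fineK //.
by apply: integrable_fin_num => //; exact: integrable_mulL2.
Qed.

Lemma L2norm_sqrt f : L2 mu f -> L2norm mu f = (Num.sqrt (inner mu f f))%:E.
Proof.
move=> lf; rewrite L2norm_integral -EFin_inner // poweR_EFin.
by rewrite powR12_sqrt // Rintegral_ge0 // => x _; rewrite -expr2 sqr_ge0.
Qed.

Lemma inner_ae f f' g : L2 mu f -> L2 mu f' -> L2 mu g ->
  f = f' %[ae mu] -> inner mu f g = inner mu f' g.
Proof.
move=> lf lf' lg ff'; apply: EFin_inj; rewrite !EFin_inner //.
apply: ae_eq_integral => //.
- by have /integrableP[] := integrable_mulL2 lf lg.
- by have /integrableP[] := integrable_mulL2 lf' lg.
- by apply: filterS ff' => x /= h xT; rewrite (h xT).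
Qed.

Lemma L2_lin (a : R) f g : L2 mu f -> L2 mu g -> L2 mu (fun x => a * f x + g x).
Proof.
move=> lf lg; rewrite /L2 /=.
have := (@Lfun_submod_closed _ T R mu _ (le1_2e R)).2 a f g lf lg.
by apply: etrans.
Qed.

Implicit Types u v w : L2T mu.

Definition toL2 f (lf : L2 mu f) : L2T mu := Lfun_Sub (le1_2e R) lf.

Lemma toL2E f (lf : L2 mu f) : toL2 lf = f :> (T -> R).
Proof. exact: Lfun_valP. Qed.

Lemma L2T_L2 u : L2 mu u. Proof. exact: LfunP. Qed.

Definition ipL u v := inner mu u v.

Lemma L2T_linE a u v : (a *: u + v : L2T mu) = (fun x => a * u x + v x) :> (T -> R).
Proof. by []. Qed.

Lemma L2T_BE u v : (u - v : L2T mu) = (fun x => u x - v x) :> (T -> R).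
Proof. by []. Qed.

Lemma L2T_sumE I (r : seq I) (P : pred I) (F : I -> L2T mu) x :
  (\sum_(i <- r | P i) F i) x = \sum_(i <- r | P i) F i x.
Proof. by elim/big_rec2 : _ => // i y u _ <-. Qed.

Lemma semi_ipL : semi_inner ipL.
Proof.
split=> [u v|a u v w|u].
- by apply: eq_Rintegral => x _; rewrite mulrC.
- rewrite /ipL /inner -RintegralZl //; last exact/integrable_mulL2/L2T_L2/L2T_L2.
  rewrite -RintegralD //; last first.
  - exact/integrable_mulL2/L2T_L2/L2T_L2.
  - exact: (integrableZl measurableT a (integrable_mulL2 (L2T_L2 u) (L2T_L2 w))).
  by apply: eq_Rintegral => x _; rewrite L2T_linE mulrDl mulrA.
- by rewrite Rintegral_ge0 // => x _; rewrite -expr2 sqr_ge0.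
Qed.

Lemma ipL_eq0 u v : u = v %[ae mu] -> ipL (u - v) (u - v) = 0.
Proof.
move=> uv; have -> : ipL (u - v) (u - v) = ipL 0 (u - v).
  apply: inner_ae => //; try exact: L2T_L2.
  by rewrite L2T_BE; apply: filterS uv => x /= h xT; rewrite (h xT) subrr.
exact: (ip0l semi_ipL).
Qed.

End L2_space.

Definition complete_ip (R : realType) (V : lmodType R) (ip : V -> V -> R) : Prop :=
  forall u : nat -> V,
  (forall e, 0 < e -> exists N, forall m n, (N <= m)%N -> (N <= n)%N ->
     ip (u m - u n) (u m - u n) <= e) ->
  exists l, forall e, 0 < e -> exists N, forall n, (N <= n)%N ->
     ip (u n - l) (u n - l) <= e.

Lemma nneseries_lty_cvgn (R : realType) (x : nat -> R) :
  (forall k, 0 <= x k) -> (\sum_(k <oo) (x k)%:E < +oo)%E -> cvgn (series x).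
Proof.
move=> x0 fin; apply: nondecreasing_is_cvgn.
  by apply/nondecreasing_seqP => n; rewrite /series /= big_nat_recr //= lerDl.
exists (fine (\sum_(k <oo) (x k)%:E)) => _ [n _ <-].
have S0 : (0 <= \sum_(k <oo) (x k)%:E)%E by apply: nneseries_ge0 => k _ _; rewrite lee_fin.
rewrite -lee_fin fineK ?ge0_fin_numE // /series /= -sumEFin.
by apply: nneseries_lim_ge => k _ _; rewrite lee_fin.
Qed.

Lemma limn_esup_le (R : realType) (u : nat -> \bar R) (c : \bar R) :
  (forall n, (u n <= c)%E) -> (limn_esup u <= c)%E.
Proof.
move=> uc; apply: (@le_trans _ _ (ereal_sup (u @` setT))).
  by apply: ereal_inf_lbound; exists setT => //; exact: filterT.
by apply: ge_ereal_sup => _ [n _ <-].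
Qed.

Lemma limn_einf_le (R : realType) (u : nat -> \bar R) (c : \bar R) :
  (forall n, (u n <= c)%E) -> (limn_einf u <= c)%E.
Proof. by move=> uc; apply: le_trans (limn_esup_le uc); exact: limn_einf_sup. Qed.

Lemma measurable_EFin_comp d (T : measurableType d) (R : realType) (D : set T) (f : T -> R) :
  measurable_fun D f -> measurable_fun D (EFin \o f : T -> \bar R).
Proof. by move=> mf; apply/measurable_EFinP. Qed.

Section completeness.
Context d (T : measurableType d) (R : realType).
Variable mu : {measure set T -> \bar R}.
Hypothesis mu_fin : (mu setT < +oo)%E.

(** The pointwise inequality |D| <= q D^2 / 2 + 1 / (2 q) with q = 2^k turns the L2 bound 4^-k into
    an L1 bound c / 2^{k+1}, where c = 1 + mu(T). Hence the sum of the |D_k| is integrable, and so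
    finite almost everywhere. *)
Lemma L2_fast_cauchy_cvg (v : nat -> L2T mu) :
  (forall k, ipL (v k.+1 - v k) (v k.+1 - v k) <= 4^-1 ^+ k) ->
  \forall x \ae mu, cvgn (fun k => v k x).
Proof.
move=> vk.
pose D k x := v k.+1 x - v k x.
have L2D k : L2 mu (D k) by exact: (L2T_L2 (v k.+1 - v k)).
have mD k : measurable_fun setT (D k) by apply: L2_measurable.
pose c := 1 + fine (mu setT).
have m0 : 0 <= fine (mu setT) by rewrite fine_ge0.
have c0 : 0 <= c by rewrite addr_ge0.
have intD k : (\int[mu]_x `|D k x|%:E <= (c / (2 ^ k.+1)%:R)%:E)%E.
  pose q : R := 2 ^+ k.
  have q0 : 0 < q by rewrite exprn_gt0.
  apply: (@le_trans _ _ (\int[mu]_x (q / 2 * D k x ^+ 2 + (2 * q)^-1)%:E)%E).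
    apply: ge0_le_integral => //.
    - by apply: (measurable_EFin_comp (f := fun x => `|D k x|)); exact: measurableT_comp.
    - apply: measurable_EFin_comp; apply: measurable_funD => //.
      by apply: measurable_funM => //; exact: measurable_funX.
    - move=> x _; rewrite lee_fin.
      have h : 0 <= (q * `|D k x| - 1) ^+ 2 / (2 * q).
        by rewrite divr_ge0 ?sqr_ge0 // mulr_ge0 // ltW.
      have : (q * `|D k x| - 1) ^+ 2 / (2 * q) =
          q / 2 * D k x ^+ 2 + (2 * q)^-1 - `|D k x|.
        rewrite -(real_normK (num_real (D k x))).
        by field; rewrite gt_eqF.
      lra.
  rewrite (eq_integral (fun x => ((q / 2)%:E * (D k x * D k x)%:E + (2 * q)^-1%:E)%E)); last first.
    by move=> x _; rewrite -EFinM -EFinD expr2.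
  rewrite ge0_integralD //.
  - rewrite ge0_integralZl_EFin //; last by rewrite divr_ge0 // ltW.
    + rewrite -EFin_inner // integral_cst // -(@fineK _ (mu setT)) ?ge0_fin_numE //.
      rewrite -!EFinM -EFinD lee_fin.
      have ipk : inner mu (D k) (D k) <= q ^- 2.
        apply: le_trans (vk k) _; rewrite /q -exprM mulnC exprM -exprVn.
        by rewrite (_ : 2 ^+ 2 = 4) //; ring.
      apply: (@le_trans _ _ (q / 2 * q ^- 2 + (2 * q)^-1 * fine (mu setT))).
        by rewrite lerD2r ler_wpM2l // divr_ge0 // ltW.
      have -> : (2 ^ k.+1)%:R = 2 * q :> R by rewrite natrX exprS.
      rewrite /c le_eqVlt; apply/orP; left; apply/eqP; field.
      by rewrite gt_eqF.
    + by move=> x _; rewrite lee_fin -expr2 sqr_ge0.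
    + by apply: measurable_EFin_comp; exact: measurable_funM.
  - move=> x _; apply: mule_ge0; rewrite lee_fin -?expr2 ?sqr_ge0 // divr_ge0 // ltW //.
  - by apply: emeasurable_funM => //; apply: measurable_EFin_comp; exact: measurable_funM.
  - by move=> x _; rewrite lee_fin invr_ge0 mulr_ge0 // ltW.
have sumD : (\int[mu]_x \sum_(k <oo) `|D k x|%:E < +oo)%E.
  rewrite integral_nneseries //.
  - apply: (@le_lt_trans _ _ (\sum_(k <oo) (c / (2 ^ k.+1)%:R)%:E)%E).
      by apply: lee_nneseries => // k _ _; exact: integral_ge0.
    apply: (@le_lt_trans _ _ c%:E); last exact: ltry.
    exact: (@epsilon_trick0 R c xpredT).
  - by move=> k; apply: measurable_EFin_comp; exact: measurableT_comp.
have sum0 x : (0 <= \sum_(k <oo) `|D k x|%:E)%E.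
  by apply: nneseries_ge0 => k _ _; rewrite lee_fin.
have intS : mu.-integrable setT (fun x => \sum_(k <oo) `|D k x|%:E)%E.
  apply/integrableP; split.
    apply: ge0_emeasurable_sum; first by move=> k x _ _; rewrite lee_fin.
    by move=> k _; apply: measurable_EFin_comp; exact: measurableT_comp.
  by under eq_integral => x _ do rewrite gee0_abs //.
apply: filterS (integrable_ae measurableT intS) => x /(_ I) finx.
have : cvgn (series (fun k => D k x)).
  apply: normed_cvg; apply: nneseries_lty_cvgn => [k|]; first exact: normr_ge0.
  by move: finx; rewrite ge0_fin_numE ?sum0.
move=> cs; have -> : (fun k => v k x) = (fun k => v 0%N x + series (fun k => D k x) k).
  apply/funext => k; elim: k => [|k IH]; first by rewrite /series /= big_geq // addr0.
  by rewrite /series /= big_nat_recr //= addrA -[X in _ = X + _]IH /D addrC subrK.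
by apply: is_cvgD => //; exact: is_cvg_cst.
Qed.

Lemma L2_complete : complete_ip (@ipL d T R mu).
Proof.
move=> u uC.
have /choice[N HN] : forall k : nat, exists N, forall m n, (N <= m)%N -> (N <= n)%N ->
    ipL (u m - u n) (u m - u n) <= 4^-1 ^+ k.
  by move=> k; apply: uC; rewrite exprn_gt0 // invr_gt0.
(* Summing the thresholds makes the indices increase, with n_k at least N_k and at least k. *)
pose n k := (\sum_(i < k.+1) (N i).+1)%N.
have nS k : (n k <= n k.+1)%N by rewrite /n [leqRHS]big_ord_recr leq_addr.
have Nn k : (N k <= n k)%N by rewrite /n big_ord_recr /= (leq_trans (leqnSn _)) // leq_addl.
have kn k : (k <= n k)%N.
  by elim: k => // k IH; rewrite /n big_ord_recr /= -/(n k) addnS ltnS (leq_trans IH) // leq_addr.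
have fast k : ipL (u (n k.+1) - u (n k)) (u (n k.+1) - u (n k)) <= 4^-1 ^+ k.
  by apply: HN; [exact: leq_trans (Nn k) (nS k)|exact: Nn].
have aecv := L2_fast_cauchy_cvg (v := fun k => u (n k)) fast.
(* The upper limit is measurable on the whole space and agrees with the limit wherever that
   exists. *)
pose l x := fine (limn_esup (fun k => (u (n k) x)%:E)).
have mu_ k : measurable_fun setT (u k : T -> R) by apply: L2_measurable (L2T_L2 _).
have ml : measurable_fun setT l.
  apply: (measurableT_comp (fine_measurable measurableT)).
  by apply: measurable_fun_limn_esup => k; exact: measurable_EFin_comp.
have msq k : measurable_fun setT (fun x => ((u k x - l x) ^+ 2)%:E).
  apply: (measurable_EFin_comp (f := fun x => (u k x - l x) ^+ 2)).
  by apply: measurable_funX; exact: measurable_funB.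
(* Fatou along the subsequence, started at K so that every index used is at least K. *)
have bound m e K : (forall k, (K <= k)%N -> ipL (u m - u k) (u m - u k) <= e) ->
    (\int[mu]_x ((u m x - l x) ^+ 2)%:E <= e%:E)%E.
  move=> HK.
  pose F k x : \bar R := ((u m x - u (n (K + k)%N) x) ^+ 2)%:E.
  have mF k : measurable_fun setT (F k).
    apply: (measurable_EFin_comp (f := fun x => (u m x - u (n (K + k)%N) x) ^+ 2)).
    by apply: measurable_funX; exact: measurable_funB.
  have F0 k x : setT x -> (0 <= F k x)%E by rewrite lee_fin sqr_ge0.
  have := fatou mu measurableT mF F0.
  have -> : (\int[mu]_x limn_einf (F^~ x) = \int[mu]_x ((u m x - l x) ^+ 2)%:E)%E.
    apply: ae_eq_integral => //.
      rewrite /limn_einf; apply: measurableT_comp => //.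
      by apply: measurable_fun_limn_esup => k; exact: measurableT_comp.
    apply: filterS aecv => x cvx _.
    have lx : (fun k => u (n k) x) @ \oo --> l x.
      have h : (fun k => (u (n k) x)%:E) @ \oo --> (limn (fun k => u (n k) x))%:E.
        by apply/cvg_EFin => //; exact: nearW.
      by rewrite /l (cvg_limn_einf_sup h).2.
    have -> // : limn_einf (F^~ x) = ((u m x - l x) ^+ 2)%:E.
    apply: (cvg_limn_einf_sup _).1.
    apply/cvg_EFin; first exact: nearW.
    have -> : fine \o F^~ x = fun k => (u m x - u (n (K + k)%N) x) ^+ 2 by [].
    have lK : (fun k => u (n (K + k)%N) x) @ \oo --> l x.
      have := lx; rewrite -(cvg_shiftn K); apply: cvg_trans.
      by under [X in _ --> X @ _]eq_fun => k do rewrite addnC.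
    have h : (fun k => u m x - u (n (K + k)%N) x) @ \oo --> u m x - l x.
      by apply: cvgB => //; exact: cvg_cst.
    by under eq_fun => k do rewrite expr2; rewrite expr2; exact: cvgM.
  move=> h; apply: (le_trans h); apply: limn_einf_le => k.
  apply: (@le_trans _ _ (ipL (u m - u (n (K + k)%N)) (u m - u (n (K + k)%N)))%:E).
    rewrite EFin_inner; try exact: L2T_L2.
    by rewrite le_eqVlt; apply/orP; left; apply/eqP/eq_integral => x _; rewrite /F expr2.
  by rewrite lee_fin; apply: HK; rewrite (leq_trans _ (kn _)) // leq_addr.
have L2d m e K : (forall k, (K <= k)%N -> ipL (u m - u k) (u m - u k) <= e) ->
    L2 mu (fun x => u m x - l x).
  move=> h; apply/L2P; split; first exact: measurable_funB.
  exact: le_lt_trans (bound m e K h) (ltry _).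
have [K0 HK0] := uC 1 ltr01.
have L2l : L2 mu l.
  have := L2_lin (-1) (L2d K0 1 K0 (fun k => HK0 K0 k (leqnn K0))) (L2T_L2 (u K0)).
  by congr L2; apply/funext => x; ring.
exists (toL2 L2l) => e e0; have [K HK] := uC e e0; exists K => k Kk.
rewrite -lee_fin EFin_inner; try exact: L2T_L2.
apply: le_trans (bound k e K (fun j => HK k j Kk)).
by rewrite le_eqVlt; apply/orP; left; apply/eqP/eq_integral => x _; rewrite expr2.
Qed.

End completeness.

(** * Time averages of contraction semigroups *)

Section norm.
Context (R : realType) (V : lmodType R) (ip : V -> V -> R).
Hypothesis ipP : semi_inner ip.

Definition nm (u : V) : R := Num.sqrt (ip u u).

Lemma nm_ge0 u : 0 <= nm u. Proof. exact: sqrtr_ge0. Qed.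

Lemma nm_sqr u : nm u ^+ 2 = ip u u.
Proof. by rewrite sqr_sqrtr // (ip_ge0 ipP). Qed.

Lemma nm_le u c : 0 <= c -> (nm u <= c) = (ip u u <= c ^+ 2).
Proof. by move=> c0; rewrite -nm_sqr ler_sqr ?nnegrE ?nm_ge0. Qed.

Lemma nmZ a u : nm (a *: u) = `|a| * nm u.
Proof.
by rewrite /nm (ipZl ipP) (ipZr ipP) mulrA -expr2 sqrtrM ?sqr_ge0 // sqrtr_sqr.
Qed.

Lemma nm0 : nm 0 = 0. Proof. by rewrite /nm (ip0l ipP) sqrtr0. Qed.

Lemma nmN u : nm (- u) = nm u.
Proof. by rewrite -scaleN1r nmZ normrN1 mul1r. Qed.

Lemma nm_distC u v : nm (u - v) = nm (v - u).
Proof. by rewrite -nmN opprB. Qed.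

Lemma normr_ip_le u v : `|ip u v| <= nm u * nm v.
Proof.
rewrite -sqrtr_sqr /nm -sqrtrM ?(ip_ge0 ipP) //; apply: ler_wsqrtr.
exact: (ip_cauchy_schwarz ipP).
Qed.

Lemma ip_le_nm u v : ip u v <= nm u * nm v.
Proof. exact: le_trans (ler_norm _) (normr_ip_le u v). Qed.

Lemma nmD u v : nm (u + v) <= nm u + nm v.
Proof.
rewrite nm_le ?addr_ge0 ?nm_ge0 // !(ipDl ipP, ipDr ipP) sqrrD !nm_sqr (ipC ipP v u).
by have := ip_le_nm u v; lra.
Qed.

Lemma nm_dist_tri w u v : nm (u - v) <= nm (u - w) + nm (w - v).
Proof. by rewrite -[u - v](subrKA w) nmD. Qed.

Lemma nm_sum I (r : seq I) (P : pred I) (F : I -> V) :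
  nm (\sum_(i <- r | P i) F i) <= \sum_(i <- r | P i) nm (F i).
Proof.
elim/big_rec2 : _ => [|i y1 y2 _ h]; first by rewrite nm0.
by apply: le_trans (nmD _ _) _; rewrite lerD2l.
Qed.

Lemma ip_null_l u v : nm u = 0 -> ip u v = 0.
Proof.
move=> u0; have := normr_ip_le u v.
by rewrite u0 mul0r normr_le0 => /eqP.
Qed.

Lemma ip_eq_null u v w : nm (u - v) = 0 -> ip u w = ip v w.
Proof. by move=> /ip_null_l => /(_ w); rewrite (ipBl ipP); lra. Qed.

Lemma nm_weak_le u c : 0 <= c -> (forall w, ip u w <= c * nm w) -> nm u <= c.
Proof.
move=> c0 /(_ u); rewrite -nm_sqr expr2 => h.
have [->//|u0] := eqVneq (nm u) 0.
by move: h; rewrite ler_pM2r // lt_def u0 nm_ge0.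
Qed.

(** Vectors that agree almost everywhere cannot be rewritten into each other; within a distance this
    lemma takes the place of rewriting. *)
Lemma nm_null_dist u v w : nm (u - v) = 0 -> nm (u - w) = nm (v - w).
Proof.
move=> h; apply/le_anti; apply/andP; split.
  by have := nm_dist_tri v u w; rewrite h add0r.
by have := nm_dist_tri u v w; rewrite [nm (v - u)]nm_distC h add0r.
Qed.

End norm.

(** * Riemann sums of uniformly continuous real functions *)

Section scalar_riemann.
Context (R : realType).
Notation leb := (@lebesgue_measure R).
Implicit Types (f : R -> R) (a t : R).

Definition ucont f : Prop := forall eta, 0 < eta -> exists2 e, 0 < e &
  forall r t, 0 <= r -> 0 <= t <= e -> `|f (r + t) - f r| <= eta.

Lemma ucont_integrable f a b : ucont f -> 0 <= a ->
  leb.-integrable `[a, b] (EFin \o f).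
Proof.
move=> uf a0; apply: continuous_compact_integrable; first exact: segment_compact.
apply/subspace_continuousP => x; rewrite /= in_itv /= => /andP[ax xb].
apply/cvgrPdist_le => eta eta0; have [e e0 he] := uf eta eta0.
rewrite near_withinE; apply: filterS (nbhsx_ballx x e e0) => y.
rewrite /ball /= in_itv /= => xye /andP[ay yb].
have [xy|yx] := leP x y.
  rewrite distrC -[y](subrKC x); apply: he; first exact: le_trans ax.
  by rewrite subr_ge0 xy ltW // (le_lt_trans _ xye) // distrC ler_norm.
rewrite -[x](subrKC y); apply: he; first exact: le_trans ay.
by rewrite subr_ge0 (ltW yx) ltW // (le_lt_trans _ xye) // ler_norm.
Qed.

Lemma integral_step_dist f b t eps : 0 <= t ->
  leb.-integrable `]b, b + t] (EFin \o f) ->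
  (forall r, b < r <= b + t -> `|f r - f b| <= eps) ->
  `|\int[leb]_(r in `]b, b + t]) f r - t * f b| <= t * eps.
Proof.
move=> t0 intf feps; have mI : measurable (`]b, b + t]%classic : set R) by [].
have legt : fine (leb `]b, b + t]) = t.
  rewrite lebesgue_measure_itv /= lte_fin ltrDl.
  move: t0; rewrite le_eqVlt => /predU1P[<-|t0]; first by rewrite ltxx.
  by rewrite t0 /= addrC addKr.
have legty : (leb `]b, (b + t)%R] < +oo)%E.
  by rewrite lebesgue_measure_itv /=; case: ifP => // _; rewrite -EFinB ltry.
have icst c : leb.-integrable `]b, b + t] (EFin \o cst c).
  apply/integrableP; split; first by apply: measurable_EFin_comp; exact: measurable_cst.
  rewrite (eq_integral (cst `|c|%:E)) // integral_cst // lte_mul_pinfty ?lee_fin //.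
have -> : t * f b = \int[leb]_(r in `]b, b + t]) f b by rewrite Rintegral_cst // legt mulrC.
rewrite -RintegralB //; last exact: (icst (f b)).
have intd : leb.-integrable `]b, b + t] (EFin \o (fun r => f r - f b)).
  have H : leb.-integrable `]b, b + t] ((EFin \o f) \- (EFin \o cst (f b)))%E.
    by apply: integrableB => //; exact: icst.
  by [].
apply: (le_trans (le_normr_Rintegral _ intd)) => //.
rewrite (_ : t * eps = \int[leb]_(r in `]b, b + t]) eps); last first.
  by rewrite Rintegral_cst // legt mulrC.
apply: le_Rintegral => //; first exact: (integrable_norm intd).
exact: (icst eps).
Qed.

Lemma riemann_sum_dist f a t eps k : ucont f -> 0 <= a -> 0 <= t -> (0 < k)%N ->
  (forall b r, a <= b -> 0 <= r <= t / k%:R -> `|f (b + r) - f b| <= eps) ->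
  `|\int[leb]_(r in `[a, a + t]) f r - t / k%:R * \sum_(l < k) f (a + l%:R / k%:R * t)|
  <= t * eps.
Proof.
move=> uf a0 t0 k0 feps.
have K0 : 0 < k%:R :> R by rewrite ltr0n.
pose q := t / k%:R.
have q0 : 0 <= q by rewrite divr_ge0.
have step l : `|\int[leb]_(r in `[a, a + l%:R * q]) f r -
    q * \sum_(j < l) f (a + j%:R * q)| <= l%:R * (q * eps).
  elim: l => [|l IH].
    rewrite big_ord0 !mul0r addr0 mulr0 subr0 set_itv1 Rintegral_set1.
    by rewrite normr0.
  have lq : l.+1%:R * q = l%:R * q + q by rewrite -natr1 mulrDl mul1r.
  have aq : a <= a + l%:R * q by rewrite lerDl mulr_ge0.
  have itf : leb.-integrable `[a, a + l.+1%:R * q] (EFin \o f) by exact: ucont_integrable.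
  have := @Rintegral_itvB R f (BLeft a) (BRight (a + l.+1%:R * q)) (a + l%:R * q) itf.
  rewrite !bnd_simp aq lq addrA lerDl q0 => /(_ isT isT) /eqP.
  rewrite subr_eq => /eqP ->.
  rewrite big_ord_recr /= mulrDr -natr1 mulrDl mul1r.
  set Ib := (X in `|X + _ - _|); set Ia := (X in `|_ + X - _|); set S := q * \sum_(i < l) _.
  have -> : Ib + Ia - (S + q * f (a + l%:R * q)) = (Ia - S) + (Ib - q * f (a + l%:R * q)).
    by ring.
  apply: (le_trans (ler_normD _ _)); rewrite lerD // /Ib.
  apply: integral_step_dist => //.
    by apply: integrableS (ucont_integrable (a + l%:R * q + q) uf (le_trans a0 aq)) => //;
      exact: subset_itv_oc_cc.
  move=> r /andP[r1 r2]; rewrite -[r](subrKC (a + l%:R * q)); apply: feps => //.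
  by rewrite subr_ge0 (ltW r1) lerBlDl.
have := step k; rewrite /q.
have -> : k%:R * (t / k%:R) = t by field; lra.
have -> : k%:R * (t / k%:R * eps) = t * eps by field; lra.
congr (_ <= _); congr (`|_ - _ * _|); apply: eq_bigr => l _; congr f.
by field; lra.
Qed.

End scalar_riemann.

(** * Time averages of vector-valued paths *)

Section weak_average.
Context (R : realType) (V : lmodType R) (ip : V -> V -> R).
Hypothesis ipP : semi_inner ip.
Notation leb := (@lebesgue_measure R).
Notation nm := (nm ip).

Definition ucont_path (phi : R -> V) : Prop := forall eta, 0 < eta -> exists2 e, 0 < e &
  forall r t, 0 <= r -> 0 <= t <= e -> nm (phi (r + t) - phi r) <= eta.

Lemma ucont_ip phi w : ucont_path phi -> ucont (fun r => ip (phi r) w).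
Proof.
move=> uphi eta eta0.
have w0 : 0 < nm w + 1 by rewrite ltr_wpDl ?nm_ge0.
have [e e0 he] := uphi (eta / (nm w + 1)) (divr_gt0 eta0 w0).
exists e => // r t r0 te; rewrite -(ipBl ipP).
apply: (le_trans (normr_ip_le ipP _ _)).
apply: (@le_trans _ _ (eta / (nm w + 1) * (nm w + 1))); last by rewrite divfK // gt_eqF.
by rewrite ler_pM ?nm_ge0 ?he // lerDl.
Qed.

Definition riemann (phi : R -> V) (a t : R) (k : nat) : V :=
  k%:R^-1 *: \sum_(l < k) phi (a + l%:R / k%:R * t).

(** The estimate is uniform over w in the unit ball: this is norm convergence of the Riemann sums,
    phrased before a limit vector is available. *)
Lemma riemann_weak phi a t : ucont_path phi -> 0 <= a -> 0 < t ->
  forall eta, 0 < eta -> \forall k \near \oo, forall w,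
  `|t^-1 * \int[leb]_(s in `[a, a + t]) ip (phi s) w - ip (riemann phi a t k) w| <= eta * nm w.
Proof.
move=> uphi a0 t0 eta eta0; have [e e0 he] := uphi eta eta0.
exists (Num.bound (t / e)).+1 => // k /= kb w.
have te0 : 0 <= t / e by rewrite divr_ge0 ?ltW.
have k0 : (0 < k)%N by apply: leq_trans kb.
have K0 : 0 < k%:R :> R by rewrite ltr0n.
have tk : t / k%:R <= e.
  rewrite ler_pdivrMr // mulrC -ler_pdivrMr // (le_trans (ltW (archi_boundP te0))) //.
  by rewrite ler_nat (leq_trans _ kb).
have step b r : a <= b -> 0 <= r <= t / k%:R -> `|ip (phi (b + r)) w - ip (phi b) w| <= eta * nm w.
  move=> ab /andP[r0 rt]; rewrite -(ipBl ipP); apply: (le_trans (normr_ip_le ipP _ _)).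
  rewrite ler_wpM2r ?nm_ge0 //; apply: he; first exact: le_trans ab.
  by rewrite r0 (le_trans rt).
have := riemann_sum_dist (ucont_ip w uphi) a0 (ltW t0) k0 step.
rewrite (ipZl ipP) (ip_suml ipP) => h.
rewrite -(ler_pM2l t0); apply: le_trans h.
rewrite -[X in X * `|_|](gtr0_norm t0) -normrM mulrBr mulrA mulfV ?gt_eqF // mul1r.
by rewrite !mulrA.
Qed.

(** The starting time [a] is free because P_h carries the average over [0, t] to the one over
    [h, h + t]. *)
Definition weak_avg (phi : R -> V) (a t : R) (g : V) : Prop := forall w,
  ip g w = t^-1 * \int[leb]_(s in `[a, a + t]) ip (phi s) w.

Lemma riemann_cvg phi a t g : ucont_path phi -> 0 <= a -> 0 < t -> weak_avg phi a t g ->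
  forall eta, 0 < eta -> \forall k \near \oo, nm (g - riemann phi a t k) <= eta.
Proof.
move=> uphi a0 t0 hg eta eta0; apply: filterS (riemann_weak uphi a0 t0 eta0) => k hk.
apply: (nm_weak_le ipP (ltW eta0)) => w; rewrite (ipBl ipP) hg.
exact: le_trans (ler_norm _) (hk w).
Qed.

Lemma riemann_cvg_weak phi a t g : ucont_path phi -> 0 <= a -> 0 < t ->
  (forall eta, 0 < eta -> \forall k \near \oo, nm (g - riemann phi a t k) <= eta) ->
  weak_avg phi a t g.
Proof.
move=> uphi a0 t0 hg w; apply/eqP; rewrite -subr_eq0 -normr_le0.
apply/ler_addgt0Pr => eta eta0; rewrite add0r.
have w0 : 0 < nm w + 1 by rewrite ltr_wpDl ?nm_ge0.
have e0 : 0 < eta / 2 / (nm w + 1) by rewrite !divr_gt0.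
have [k _ hk] := filterI (hg _ e0) (riemann_weak uphi a0 t0 e0).
have {hk} [h1 /(_ w) h2] := hk k (leqnn k).
have h3 : `|ip g w - ip (riemann phi a t k) w| <= eta / 2 / (nm w + 1) * nm w.
  rewrite -(ipBl ipP); apply: (le_trans (normr_ip_le ipP _ _)).
  by rewrite ler_wpM2r ?nm_ge0.
have hw : eta / 2 / (nm w + 1) * nm w <= eta / 2.
  by rewrite -[leRHS](divfK (lt0r_neq0 w0)) ler_wpM2l ?(ltW e0) // lerDl.
rewrite -[X in `|X|](subrKA (ip (riemann phi a t k) w)).
apply: (le_trans (ler_normD _ _)); rewrite [X in _ + X]distrC.
have -> : eta = eta / 2 + eta / 2 by field.
by rewrite lerD // (le_trans _ hw).
Qed.

(** All fine Riemann sums are close to the same functional of w, uniformly on the unit ball, and are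
    therefore Cauchy. *)
Lemma weak_avg_exists phi a t : complete_ip ip -> ucont_path phi -> 0 <= a -> 0 < t ->
  exists g, weak_avg phi a t g.
Proof.
move=> cip uphi a0 t0.
have [|g hg] := cip (riemann phi a t).
  move=> e e0; have s0 : 0 < Num.sqrt e / 2 by rewrite divr_gt0 // sqrtr_gt0.
  have [N _ hN] := riemann_weak uphi a0 t0 s0; exists N => m n Nm Nn.
  rewrite -[e](sqr_sqrtr (ltW e0)) -nm_le ?sqrtr_ge0 //.
  apply: (nm_weak_le ipP (sqrtr_ge0 e)) => w; rewrite (ipBl ipP).
  apply: le_trans (ler_norm _) _.
  rewrite -(subrKA (t^-1 * \int[leb]_(s in `[a, a + t]) ip (phi s) w)).
  apply: (le_trans (ler_normD _ _)); rewrite [X in X + _]distrC.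
  have -> : Num.sqrt e * nm w = Num.sqrt e / 2 * nm w + Num.sqrt e / 2 * nm w by field.
  by rewrite lerD // hN.
exists g; apply: riemann_cvg_weak => // eta eta0.
have [N hN] := hg (eta ^+ 2) (exprn_gt0 _ eta0).
by exists N => // k Nk; rewrite (nm_distC ipP) (nm_le ipP) ?(ltW eta0) // hN.
Qed.

End weak_average.

Lemma Rintegral_itv_split (R : realType) (f : R -> R) (a b c : R) :
  ucont f -> 0 <= a -> a <= b -> b <= c ->
  \int[lebesgue_measure]_(r in `[a, c]) f r =
  \int[lebesgue_measure]_(r in `[a, b]) f r + \int[lebesgue_measure]_(r in `[b, c]) f r.
Proof.
move=> uf a0 ab bc.
have := @Rintegral_itvB R f (BLeft a) (BRight c) b (ucont_integrable _ uf a0).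
rewrite !bnd_simp ab bc => /(_ isT isT) /eqP; rewrite subr_eq addrC => /eqP ->; congr (_ + _).
apply: Rintegral_itv_obnd_cbnd.
apply: integrableS (ucont_integrable c uf (le_trans a0 ab)) => //.
exact: subset_itv_oc_cc.
Qed.

(** * Averages along a contraction semigroup and its generator *)

Section contraction_semigroup.
Context (R : realType) (V : lmodType R) (ip : V -> V -> R).
Hypothesis ipP : semi_inner ip.
Notation nm := (nm ip).

(** The left-hand side is k times the pairing of a Riemann sum with phi 0. The Riemann sum is within
    eta |phi 0| of the average [g], and Cauchy-Schwarz finishes. *)
Lemma riemann_pairing (phi : R -> V) (s q eta : R) (g : V) :
  ucont_path ip phi -> 0 < s -> 0 < eta -> weak_avg ip phi 0 s g ->
  nm g <= q * nm (phi 0) ->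
  \forall k \near \oo, \sum_(l < k) ip (phi (l%:R / k%:R * s)) (phi 0) <=
    k%:R * (q + eta) * ip (phi 0) (phi 0).
Proof.
move=> uphi s0 eta0 hg gq; have [z|nz] := eqVneq (nm (phi 0)) 0.
  apply: nearW => k; rewrite (ip_null_l ipP _ z) mulr0 big1 // => l _.
  by rewrite (ipC ipP) (ip_null_l ipP _ z).
have pz : 0 < nm (phi 0) by rewrite lt_def nz nm_ge0.
apply: filterS (filterI (nbhs_infty_gt 0%N)
  (riemann_cvg ipP uphi (lexx 0) s0 hg (mulr_gt0 eta0 pz))) => k [k0 hk].
have K0 : 0 < k%:R :> R by rewrite ltr0n.
have -> : \sum_(l < k) ip (phi (l%:R / k%:R * s)) (phi 0) =
    k%:R * ip (riemann phi 0 s k) (phi 0).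
  rewrite (ipZl ipP) mulrA mulfV ?gt_eqF // mul1r (ip_suml ipP).
  by apply: eq_bigr => l _; rewrite add0r.
rewrite -mulrA ler_pM2l // -(nm_sqr ipP) expr2 mulrA.
apply: (le_trans (ip_le_nm ipP _ _)); rewrite ler_pM2r // mulrDl.
have -> : riemann phi 0 s k = g - (g - riemann phi 0 s k) by rewrite subKr.
by apply: (le_trans (nmD ipP _ _)); rewrite (nmN ipP) lerD.
Qed.

Lemma null_linear_sum (A : V -> V) (n : nat) (c : 'I_n -> R) (u : 'I_n -> V) :
  (forall a v w, nm (A (a *: v + w) - (a *: A v + A w)) = 0) ->
  nm (A (\sum_(i < n) c i *: u i) - \sum_(i < n) c i *: A (u i)) = 0.
Proof.
move=> lin.
have A0 : nm (A 0) = 0.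
  by have := lin 1 0 0; rewrite !scale1r addr0 opprD addrA subrr sub0r (nmN ipP).
elim: n c u => [|n IH] c u; first by rewrite !big_ord0 subr0.
rewrite !big_ord_recr /= addrC [X in _ - X]addrC.
set S := \sum_(i < n) _; set S' := \sum_(i < n) _.
have IHS : nm (A S - S') = 0 := IH (fun i => c (widen_ord (leqnSn n) i))
  (fun i => u (widen_ord (leqnSn n) i)).
apply/le_anti; rewrite nm_ge0 andbT.
apply: (le_trans (nm_dist_tri ipP (c ord_max *: A (u ord_max) + A S) _ _)).
by rewrite lin add0r opprD addrACA subrr add0r IHS.
Qed.

Variable P : R -> V -> V.

Definition contraction_semigroup : Prop :=
  [/\ forall t a u v, 0 <= t -> nm (P t (a *: u + v) - (a *: P t u + P t v)) = 0,
      forall t u, 0 <= t -> nm (P t u) <= nm u,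
      forall s t u, 0 <= s -> 0 <= t -> nm (P (s + t) u - P s (P t u)) = 0,
      forall u, nm (P 0 u - u) = 0 &
      forall u eta, 0 < eta -> exists2 e, 0 < e &
        forall t, 0 <= t <= e -> nm (P t u - u) <= eta].

Hypothesis semiP : contraction_semigroup.

Lemma semigroup_dist t u v : 0 <= t -> nm (P t u - P t v) <= nm (u - v).
Proof.
case: semiP => lin contr _ _ _ t0.
apply: le_trans (contr t (u - v) t0).
have -> : u - v = (-1) *: v + u by rewrite scaleN1r addrC.
have := nm_null_dist ipP 0 (lin t (-1) v u t0); rewrite !subr0 => ->.
by rewrite scaleN1r addrC.
Qed.

Lemma semigroup_sum t (k : nat) (a : R) (u : nat -> V) : 0 <= t ->
  nm (P t (a *: \sum_(l < k) u l) - a *: \sum_(l < k) P t (u l)) = 0.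
Proof.
move=> t0; case: (semiP) => lin _ _ _ _.
rewrite !scaler_sumr.
by apply: (null_linear_sum (fun=> a) (fun i : 'I_k => u i)) => b v w; exact: lin.
Qed.

Lemma semigroup_orbit_dist u r t : 0 <= r -> 0 <= t ->
  nm (P (r + t) u - P r u) <= nm (P t u - u).
Proof.
move=> r0 t0; case: (semiP) => _ _ sg _ _.
by rewrite (nm_null_dist ipP _ (sg r t u r0 t0)) semigroup_dist.
Qed.

Lemma semigroup_ucont u : ucont_path ip (fun t => P t u).
Proof.
case: (semiP) => _ _ _ _ cont eta eta0; have [e e0 he] := cont u eta eta0.
exists e => // r t r0 te.
by apply: le_trans (he t te); apply: semigroup_orbit_dist => //; case/andP: te.
Qed.

(** P_h maps Riemann sums on [0, s] to Riemann sums on [h, h + s], and being a contraction it passes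
    to the limit. *)
Lemma semigroup_weak_avg u s h g : 0 < s -> 0 <= h ->
  weak_avg ip (fun r => P r u) 0 s g -> weak_avg ip (fun r => P r u) h s (P h g).
Proof.
move=> s0 h0 hg; case: (semiP) => _ _ sg _ _.
apply: (riemann_cvg_weak ipP (semigroup_ucont u)) => // eta eta0.
apply: filterS (riemann_cvg ipP (semigroup_ucont u) (lexx 0) s0 hg eta0) => k hk.
apply: (le_trans (nm_dist_tri ipP (P h (riemann (fun r => P r u) 0 s k)) _ _)).
rewrite -[leRHS]addr0 lerD ?(le_trans (semigroup_dist _ _ h0)) //.
rewrite (nm_null_dist ipP _ (semigroup_sum k _ (fun l => P (0 + l%:R / k%:R * s) u) h0)).
rewrite -scalerBr -sumrB (nmZ ipP).
apply: (@le_trans _ _ (`|k%:R^-1| * \sum_(l < k) 0)); last by rewrite big1 ?mulr0.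
apply: ler_wpM2l => //; apply: (le_trans (nm_sum ipP _ _ _)).
apply: ler_sum => l _; rewrite (nm_distC ipP) add0r sg //.
by rewrite mulr_ge0 ?(ltW s0) // divr_ge0.
Qed.

(** s (P_h g - g) is the integral of the orbit over [s, s + h] minus the one over [0, h]. By uniform
    continuity these are close to h P_s u and h u; all of this is tested against w. *)
Lemma weak_avg_generator u s g : 0 < s -> weak_avg ip (fun r => P r u) 0 s g ->
  forall eta, 0 < eta -> exists2 e, 0 < e & forall h, 0 < h <= e ->
  nm (h^-1 *: (P h g - g) - s^-1 *: (P s u - u)) <= eta.
Proof.
move=> s0 hg eta eta0; case: (semiP) => _ _ _ zero _.
have es0 : 0 < eta * s / 2 by rewrite divr_gt0 // mulr_gt0.
have [e e0 he] := semigroup_ucont u es0; exists e => // h /andP[h0 hle].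
apply: (nm_weak_le ipP (ltW eta0)) => w.
have hPg := semigroup_weak_avg s0 (ltW h0) hg.
pose psi r := ip (P r u) w.
have upsi : ucont psi := ucont_ip ipP w (semigroup_ucont u).
(* Riemann sums with a single node, hence h / 1: the integral over [b, b + h] is compared with h
   psi(b). *)
have E b r : 0 <= b -> 0 <= r <= h / 1%:R -> `|psi (b + r) - psi b| <= eta * s / 2 * nm w.
  move=> b0 /andP[r0 rh]; rewrite -(ipBl ipP); apply: (le_trans (normr_ip_le ipP _ _)).
  rewrite ler_wpM2r ?nm_ge0 // he // r0 /=.
  by rewrite (le_trans rh) // divr1.
have near_s := riemann_sum_dist upsi (ltW s0) (ltW h0) (isT : (0 < 1)%N)
  (fun b r sb => E b r (le_trans (ltW s0) sb)).
have near_0 := riemann_sum_dist upsi (lexx 0) (ltW h0) (isT : (0 < 1)%N) E.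
rewrite (ipBl ipP) !(ipZl ipP) !(ipBl ipP) hPg hg.
have -> : ip u w = psi 0 by rewrite /psi (ip_eq_null ipP w (zero u)).
rewrite -/(psi s).
have hs : h <= h + s by rewrite lerDl ltW.
have sh : s <= s + h by rewrite lerDl ltW.
(* Cutting [0, h + s] both at h and at s avoids comparing h with s. *)
have split1 := Rintegral_itv_split upsi (lexx 0) (ltW h0) hs.
have split2 := Rintegral_itv_split upsi (lexx 0) (ltW s0) sh.
have key I1 I2 I3 I4 I5 : `|I1 - h * psi s| <= h * (eta * s / 2 * nm w) ->
    `|I2 - h * psi 0| <= h * (eta * s / 2 * nm w) -> I3 = I2 + I4 -> I3 = I5 + I1 ->
    h^-1 * (s^-1 * I4 - s^-1 * I5) - s^-1 * (psi s - psi 0) <= eta * nm w.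
  move=> n1 n2 e1 e2.
  have -> : h^-1 * (s^-1 * I4 - s^-1 * I5) - s^-1 * (psi s - psi 0) =
      (h * s)^-1 * ((I1 - h * psi s) - (I2 - h * psi 0)).
    have -> : I4 = I5 + I1 - I2 by rewrite -e2 e1 addrC addKr.
    by field; rewrite !gt_eqF.
  apply: (le_trans (ler_norm _)); rewrite normrM gtr0_norm ?invr_gt0 ?mulr_gt0 //.
  rewrite mulrC ler_pdivrMr ?mulr_gt0 //; apply: (le_trans (ler_normB _ _)).
  apply: (le_trans (lerD n1 n2)).
  by rewrite le_eqVlt; apply/orP; left; apply/eqP; field.
move: near_s near_0 split1 split2; rewrite !big_ord1 !mul0r !addr0 !add0r !divr1.
by rewrite [s + h]addrC; exact: key.
Qed.

Lemma weak_avg_generator_norm u s : 0 < s ->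
  nm (s^-1 *: (P s u - u)) <= 2 * nm u / s.
Proof.
move=> s0; case: (semiP) => _ contr _ _ _.
rewrite (nmZ ipP) gtr0_norm ?invr_gt0 // mulrC ler_pM2r ?invr_gt0 //.
apply: (le_trans (nmD ipP _ _)); rewrite (nmN ipP).
by have := contr s u (ltW s0); lra.
Qed.

End contraction_semigroup.

(** * The transition semigroup on L2 *)

Section mixture.
Context d d' (X : measurableType d) (Z : measurableType d') (R : realType).
Variables (m : {measure set X -> \bar R}) (k : X -> {measure set Z -> \bar R}).
Variable nu : {measure set Z -> \bar R}.
Hypothesis mk : forall U, measurable U -> measurable_fun setT (k ^~ U).
Hypothesis nuE : forall A, measurable A -> nu A = (\int[m]_x k x A)%E.

Import HBNNSimple.

Lemma sintegral_mixture (h : {nnsfun Z >-> R}) :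
  sintegral nu h = (\int[m]_x sintegral (k x) h)%E.
Proof.
under eq_integral do rewrite sintegralE.
rewrite ge0_integral_fsum//; last 2 first.
- by move=> r; apply: measurable_funeM; exact: mk.
- by move=> n x _; exact: nnsfun_mulemu_ge0.
rewrite sintegralE /=; apply: eq_fsbigr => // r; rewrite inE => -[z _ hz].
have r0 : 0 <= r by rewrite -hz fun_ge0.
rewrite ge0_integralZl_EFin //; last exact: mk.
by rewrite nuE.
Qed.

(** Simple functions are covered by the definition of the mixture; monotone convergence, once in
    each integral, extends this to non-negative functions. *)
Lemma ge0_integral_mixture (f : Z -> \bar R) :
  measurable_fun setT f -> (forall z, 0 <= f z)%E ->
  (\int[nu]_z f z = \int[m]_x \int[k x]_z f z)%E.
Proof.
move=> mf f0; pose g := nnsfun_approx measurableT mf.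
pose gE := fun n => EFin \o g n.
have mgE n : measurable_fun setT (gE n) by exact: measurable_EFin_comp.
have gE_ge0 n x : (0 <= gE n x)%E by rewrite lee_fin.
have nd_gE x : {homo gE ^~ x : n m / (n <= m)%O >-> (n <= m)%E}.
  by move=> *; exact/lefP/nd_nnsfun_approx.
transitivity (limn (fun n => \int[nu]_x gE n x)%E).
  rewrite -monotone_convergence//; apply: eq_integral => t _.
  by apply/esym/cvg_lim => //; exact: cvg_nnsfun_approx.
transitivity (limn (fun n => \int[m]_x \int[k x]_z gE n z)%E).
  apply: congr_lim; apply/funext => n.
  rewrite integralT_nnsfun sintegral_mixture; apply: eq_integral => x _.
  by rewrite integralT_nnsfun.
rewrite -[LHS]monotone_convergence//; last 3 first.
- by move=> n; exact: measurable_fun_integral_kernel.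
- by move=> n x _; exact: integral_ge0.
- by move=> x _ i j ij; apply: ge0_le_integral => // t _; exact: nd_gE.
apply: eq_integral => x _; rewrite -monotone_convergence//.
by apply: eq_integral => t _; apply/cvg_lim => //; exact: cvg_nnsfun_approx.
Qed.

Lemma measurable_kernel_Rintegral (f : Z -> R) : measurable_fun setT f ->
  measurable_fun setT (fun x => \int[k x]_z f z).
Proof.
move=> mf; have mF : measurable_fun setT (EFin \o f) by exact: measurable_EFin_comp.
apply: (measurableT_comp (fine_measurable measurableT)).
rewrite (_ : (fun x => _) = (fun x => \int[k x]_z (EFin \o f)^\+ z - \int[k x]_z (EFin \o f)^\- z)%E); last first.
  by apply/funext => x; rewrite -integralE.
apply: emeasurable_funB; apply: measurable_fun_integral_kernel => //.
- exact: measurable_funepos.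
- exact: measurable_funeneg.
Qed.

(** Positive and negative parts have finite inner integrals for almost every x, so the inner real
    integral is their difference there. It is applied with nu = mu, which is invariance, and with nu
    = p (s + t) x, which is the Chapman-Kolmogorov equation. *)
Lemma Rintegral_mixture (f : Z -> R) : nu.-integrable setT (EFin \o f) ->
  \int[m]_x \int[k x]_z f z = \int[nu]_z f z.
Proof.
move=> intf; have mF : measurable_fun setT (EFin \o f) by have /integrableP[] := intf.
have mf : measurable_fun setT f by apply/measurable_EFinP.
pose a x := (\int[k x]_z (EFin \o f)^\+ z)%E.
pose b x := (\int[k x]_z (EFin \o f)^\- z)%E.
have ma : measurable_fun setT a by apply: measurable_fun_integral_kernel => //; exact: measurable_funepos.
have mb : measurable_fun setT b by apply: measurable_fun_integral_kernel => //; exact: measurable_funeneg.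
have a0 x : (0 <= a x)%E by apply: integral_ge0.
have b0 x : (0 <= b x)%E by apply: integral_ge0.
have aE : (\int[m]_x a x = \int[nu]_z (EFin \o f)^\+ z)%E.
  by rewrite ge0_integral_mixture //; exact: measurable_funepos.
have bE : (\int[m]_x b x = \int[nu]_z (EFin \o f)^\- z)%E.
  by rewrite ge0_integral_mixture //; exact: measurable_funeneg.
have ia : m.-integrable setT a.
  apply/integrableP; split => //; under eq_integral do rewrite gee0_abs //.
  rewrite aE; have /integrableP[_] := integrable_funepos measurableT intf.
  by under eq_integral do rewrite gee0_abs //.
have ib : m.-integrable setT b.
  apply/integrableP; split => //; under eq_integral do rewrite gee0_abs //.
  rewrite bE; have /integrableP[_] := integrable_funeneg measurableT intf.
  by under eq_integral do rewrite gee0_abs //.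
rewrite /Rintegral; congr fine.
transitivity (\int[m]_x (a x - b x))%E.
  apply: ae_eq_integral => //.
  - by apply: measurable_EFin_comp; exact: measurable_kernel_Rintegral.
  - exact: emeasurable_funB.
  - apply: filterS2 (integrable_ae measurableT ia) (integrable_ae measurableT ib).
    move=> x /(_ I) fa /(_ I) fb _.
    by rewrite /= integralE -/(a x) -/(b x) fineK // fin_numB fa fb.
by rewrite integralB // aE bE -integralE.
Qed.

End mixture.

Section transition.
Context d (T : measurableType d) (R : realType).
Variables (p : R -> R.-pker T ~> T) (mu : probability T R).
Hypotheses (pT : transition_function p) (pmu : invariant_measure p mu).
Notation P := (transition_semigroup p).

Lemma probability_fin (m : probability T R) : (m setT < +oo)%E.
Proof. by rewrite probability_setT ltry. Qed.

Lemma pker_setT t x : p t x setT = 1%E.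
Proof. exact: prob_kernel. Qed.

Lemma cst_L2 (m : {measure set T -> \bar R}) (c : R) : (m setT < +oo)%E -> L2 m (cst c).
Proof.
move=> mfin; apply/L2P; split; first exact: measurable_cst.
by rewrite (eq_integral (cst (c ^+ 2)%:E)) // integral_cst // lte_mul_pinfty // lee_fin sqr_ge0.
Qed.

(** Jensen's inequality for the square, from Cauchy-Schwarz against the constant 1. If the
    right-hand side is infinite the claim is trivial. *)
Lemma sqr_Rintegral_le (m : {measure set T -> \bar R}) (f : T -> R) :
  m setT = 1%E -> measurable_fun setT f ->
  (((\int[m]_y f y) ^+ 2)%:E <= \int[m]_y (f y ^+ 2)%:E)%E.
Proof.
move=> m1 mf; have [fin|] := boolP (\int[m]_y (f y ^+ 2)%:E < +oo)%E; last first.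
  by rewrite -leNgt leye_eq => /eqP ->; rewrite leey.
have lf : L2 m f by apply/L2P.
have l1 : L2 m (cst 1) by apply: cst_L2; rewrite m1 ltry.
have := ip_cauchy_schwarz (semi_ipL m) (toL2 lf) (toL2 l1).
rewrite /ipL !toL2E.
have -> : inner m f (cst 1) = \int[m]_y f y by apply: eq_Rintegral => y _; rewrite mulr1.
have -> : inner m (cst 1) (cst 1) = 1.
  rewrite /inner (@eq_Rintegral _ _ _ m setT (cst 1)) => [|y _]; last by rewrite /cst mulr1.
  by rewrite /cst Rintegral_cst // m1 /= mulr1.
rewrite mulr1 -lee_fin => h; by apply: (le_trans h); rewrite EFin_inner.
Qed.

Lemma measurable_transition t f : measurable_fun setT f -> measurable_fun setT (P t f).
Proof. by apply: measurable_kernel_Rintegral => U mU; exact: measurable_kernel. Qed.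

Section fixed_time.
Variable t : R.
Hypothesis t0 : 0 <= t.

Lemma ge0_integral_transition (f : T -> \bar R) :
  measurable_fun setT f -> (forall z, 0 <= f z)%E ->
  (\int[mu]_x f x = \int[mu]_x \int[p t x]_y f y)%E.
Proof.
apply: ge0_integral_mixture => [U mU|A mA]; first exact: measurable_kernel.
by rewrite pmu.
Qed.

Lemma transition_sqr_le f : measurable_fun setT f ->
  (\int[mu]_x (P t f x ^+ 2)%:E <= \int[mu]_x (f x ^+ 2)%:E)%E.
Proof.
move=> mf; have mf2 : measurable_fun setT (EFin \o (fun x => f x ^+ 2)).
  by apply: measurable_EFin_comp; exact: measurable_funX.
rewrite [leRHS]ge0_integral_transition //; last by move=> z; rewrite lee_fin sqr_ge0.
apply: ge0_le_integral => //.
- by move=> x _; rewrite lee_fin sqr_ge0.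
- apply: (measurable_EFin_comp (f := fun x => P t f x ^+ 2)).
  by apply: measurable_funX; exact: measurable_transition.
- apply: measurable_fun_integral_kernel => //; last by move=> z; rewrite lee_fin sqr_ge0.
  by move=> U mU; exact: measurable_kernel.
- by move=> x _; apply: sqr_Rintegral_le => //; exact: pker_setT.
Qed.

Lemma transition_L2 f : L2 mu f -> L2 mu (P t f).
Proof.
move=> /L2P[mf ff]; apply/L2P; split; first exact: measurable_transition.
exact: le_lt_trans (transition_sqr_le mf) ff.
Qed.

Lemma transition_inner_le f : L2 mu f -> inner mu (P t f) (P t f) <= inner mu f f.
Proof.
move=> lf; rewrite -lee_fin !EFin_inner //; try exact: transition_L2.
exact: (transition_sqr_le (L2_measurable lf)).
Qed.

(** By invariance the integral of f^2 under p t x has a finite integral over x. Outside a null set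
    the kernel integrals of f thus converge, which makes linearity and the semigroup law hold almost
    everywhere. *)
Lemma ae_L2_kernel f : L2 mu f -> \forall x \ae mu, L2 (p t x) f.
Proof.
move=> /L2P[mf ff]; pose F : T -> \bar R := fun x => (f x ^+ 2)%:E.
have mf2 : measurable_fun setT F.
  by apply: (measurable_EFin_comp (f := fun x => f x ^+ 2)); exact: measurable_funX.
have f20 z : (0 <= F z)%E by rewrite lee_fin sqr_ge0.
have int2 : mu.-integrable setT (fun x => \int[p t x]_y (f y ^+ 2)%:E)%E.
  apply/integrableP; split.
    by apply: (measurable_fun_integral_kernel _ f20 mf2) => U mU; exact: measurable_kernel.
  rewrite (eq_integral (fun x => \int[p t x]_y F y)%E); last first.
    by move=> x _; rewrite gee0_abs //; apply: integral_ge0 => y _; exact: f20.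
  rewrite -(ge0_integral_transition mf2 f20); exact: ff.
apply: filterS (integrable_ae measurableT int2) => x /(_ I) fx.
apply/L2P; split => //; move: fx; rewrite ge0_fin_numE //.
by apply: integral_ge0 => y _; exact: f20.
Qed.

Lemma integrable_L2_kernel x f : L2 (p t x) f -> (p t x).-integrable setT (EFin \o f).
Proof.
move=> lf; have l1 : L2 (p t x) (cst 1) by apply: cst_L2; rewrite pker_setT ltry.
have := integrable_mulL2 lf l1.
by apply: eq_integrable => // y _ /=; rewrite mulr1.
Qed.

Lemma transition_lin (a : R) f g : L2 mu f -> L2 mu g ->
  P t (fun x => a * f x + g x) = (fun x => a * P t f x + P t g x) %[ae mu].
Proof.
move=> lf lg; apply: filterS2 (ae_L2_kernel lf) (ae_L2_kernel lg) => x lfx lgx _.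
have intf := integrable_L2_kernel lfx; have intg := integrable_L2_kernel lgx.
rewrite /transition_semigroup RintegralD //; first by rewrite RintegralZl.
exact: (integrableZl measurableT a intf).
Qed.

Lemma transition_mean f : L2 mu f -> \int[mu]_x P t f x = \int[mu]_x f x.
Proof.
move=> lf; apply: Rintegral_mixture => [U mU|A mA|].
- exact: measurable_kernel.
- by rewrite pmu.
- have l1 : L2 mu (cst 1) by apply: cst_L2; exact: probability_fin.
  have := integrable_mulL2 lf l1.
  by apply: eq_integrable => // y _ /=; rewrite mulr1.
Qed.

End fixed_time.

Lemma transition_semigroupD s t f : 0 <= s -> 0 <= t -> L2 mu f ->
  P (s + t) f = P s (P t f) %[ae mu].
Proof.
move=> s0 t0 lf; apply: filterS (ae_L2_kernel (addr_ge0 s0 t0) lf) => x lfx _.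
rewrite {2}/transition_semigroup; symmetry; apply: Rintegral_mixture => [U mU|A mA|].
- exact: measurable_kernel.
- by have [_ ->] := pT.
- exact: integrable_L2_kernel.
Qed.

Lemma transition_semigroup0 f : measurable_fun setT f -> P 0 f = f.
Proof.
move=> mf; apply/funext => x; rewrite /transition_semigroup /Rintegral.
rewrite (eq_measure_integral (dirac x)); last by move=> A mA _; have [->] := pT.
rewrite integral_dirac //; last exact: measurable_EFin_comp.
by rewrite diracT mul1e.
Qed.

(** At negative times invariance says nothing about the kernels; the identity serves there as a
    default, so that the operator is total. *)
Definition transition_op (t : R) (u : L2T mu) : L2T mu :=
  match pselect (0 <= t) with
  | left t0 => toL2 (transition_L2 t0 (L2T_L2 u))
  | right _ => u
  end.

Lemma transition_opE t (u : L2T mu) : 0 <= t -> transition_op t u = P t u :> (T -> R).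
Proof. by move=> t0; rewrite /transition_op; case: pselect => // h; rewrite toL2E. Qed.

End transition.

Lemma near_right0P (R : realType) (Q : R -> Prop) :
  (\forall h \near 0^'+, Q h) <-> exists2 e, 0 < e & forall h, 0 < h <= e -> Q h.
Proof.
split=> [/nbhs_ballP[e /= e0 H]|[e e0 H]].
  exists (e / 2); first by rewrite divr_gt0.
  move=> h /andP[h0 he]; apply: H => //=.
  rewrite /ball /= sub0r normrN gtr0_norm // (le_lt_trans he) //.
  by rewrite ltr_pdivrMr // ltr_pMr // ltr1n.
apply: filterS2 (nbhs_right_gt 0) (nbhs_right_le e0) => h h0 he.
by apply: H; rewrite h0.
Qed.

Lemma cvg_L2norm0P d (T : measurableType d) (R : realType) (mu : {measure set T -> \bar R})
    (F : R -> T -> R) : (forall h, 0 < h -> L2 mu (F h)) ->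
  ((fun h => L2norm mu (F h)) @ 0^'+ --> 0%E) <->
  (forall eta, 0 < eta -> exists2 e, 0 < e & forall h, 0 < h <= e ->
     Num.sqrt (inner mu (F h) (F h)) <= eta).
Proof.
move=> LF; split=> [/fine_cvgP[_ /cvgrPdist_le H] eta eta0|H].
  have /near_right0P[e e0 he] := H eta eta0; exists e => // h hh.
  have := he h hh; rewrite /= L2norm_sqrt /=; last by apply: LF; case/andP: hh.
  by rewrite sub0r normrN ger0_norm ?sqrtr_ge0.
apply/fine_cvgP; split.
  apply: filterS (nbhs_right_gt 0) => h h0.
  by rewrite L2norm_sqrt //; exact: LF.
apply/cvgrPdist_le => eta eta0; apply/near_right0P.
have [e e0 he] := H eta eta0; exists e => // h hh.
rewrite /= L2norm_sqrt /=; last by apply: LF; case/andP: hh.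
by rewrite sub0r normrN ger0_norm ?sqrtr_ge0 //; exact: he.
Qed.

Section transition_contraction.
Context d (T : measurableType d) (R : realType).
Variables (p : R -> R.-pker T ~> T) (mu : probability T R).
Hypotheses (pT : transition_function p) (pmu : invariant_measure p mu).
Notation P := (transition_semigroup p).
Notation nm := (nm (@ipL d T R mu)).

Lemma nm_ae_eq (u v : L2T mu) : u = v %[ae mu] -> nm (u - v) = 0.
Proof. by move=> uv; rewrite /nm ipL_eq0 // sqrtr0. Qed.

Lemma transition_op_contraction : strongly_continuous mu P ->
  contraction_semigroup (@ipL d T R mu) (transition_op pmu).
Proof.
move=> Pc; split.
- move=> t a u v t0; apply: nm_ae_eq; rewrite L2T_linE !transition_opE //.
  exact: (transition_lin pmu t0 a (L2T_L2 u) (L2T_L2 v)).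
- move=> t u t0; rewrite /nm ler_wsqrtr // /ipL transition_opE //.
  exact: (transition_inner_le pmu t0 (L2T_L2 u)).
- move=> s t u s0 t0; apply: nm_ae_eq; rewrite !transition_opE ?addr_ge0 //.
  exact: (transition_semigroupD pT pmu s0 t0 (L2T_L2 u)).
- move=> u; apply: nm_ae_eq; rewrite transition_opE //.
  by rewrite (transition_semigroup0 pT (L2_measurable (L2T_L2 u))); exact: aeW.
- move=> u eta eta0.
  have LF h : 0 < h -> L2 mu (fun x => P h u x - u x).
    move=> h0; have := L2T_L2 (transition_op pmu h u - u).
    by rewrite L2T_BE transition_opE // ltW.
  have [e e0 he] := (cvg_L2norm0P LF).1 (Pc u (L2T_L2 u)) eta eta0.
  exists e => // t /andP[]; rewrite le_eqVlt => /predU1P[<- _|t0 te].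
    rewrite nm_ae_eq ?ltW // transition_opE //.
    by rewrite (transition_semigroup0 pT (L2_measurable (L2T_L2 u))); exact: aeW.
  have := he t; rewrite t0 te => /(_ isT).
  by rewrite /nm /ipL L2T_BE transition_opE // ltW.
Qed.

End transition_contraction.

(** * The two-point motion *)

Section tensor_L2.
Context d (T : measurableType d) (R : realType).
Variable mu : probability T R.
Notation mu2 := (mu \x mu)%E.
Implicit Types g h : T -> R.

Lemma measurable_tensor g h : measurable_fun setT g -> measurable_fun setT h ->
  measurable_fun setT (tensor g h).
Proof.
move=> mg mh; apply: measurable_funM.
- exact: measurableT_comp mg measurable_fst.
- exact: measurableT_comp mh measurable_snd.
Qed.

Lemma tensor_L2 g h : L2 mu g -> L2 mu h -> L2 mu2 (tensor g h).
Proof.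
move=> lg lh; have [mg mh] := (L2_measurable lg, L2_measurable lh).
apply/L2P; split; first exact: measurable_tensor.
pose F : T * T -> \bar R := fun z => (tensor g h z ^+ 2)%:E.
have mF : measurable_fun setT F.
  apply: (measurable_EFin_comp (f := fun z => tensor g h z ^+ 2)).
  by apply: measurable_funX; exact: measurable_tensor.
have F0 z : (0 <= F z)%E by rewrite lee_fin sqr_ge0.
rewrite -/(integral mu2 setT F) (fubini_tonelli1 F mF F0) /fubini_F.
have -> : (\int[mu]_x \int[mu]_y F (x, y) = (inner mu g g * inner mu h h)%:E)%E.
  rewrite [RHS]EFinM [X in (X * _)%E]EFin_inner // muleC.
  rewrite -ge0_integralZl_EFin //; last first.
  - by apply: Rintegral_ge0 => x _; rewrite -expr2 sqr_ge0.
  - by apply: (measurable_EFin_comp (f := fun x => g x * g x)); exact: measurable_funM.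
  - by move=> x _; rewrite lee_fin -expr2 sqr_ge0.
  apply: eq_integral => x _; rewrite muleC EFin_inner // -ge0_integralZl_EFin //.
  - by apply: eq_integral => y _; rewrite /F /tensor -EFinM; congr EFin; rewrite /=; ring.
  - by move=> y _; rewrite lee_fin -expr2 sqr_ge0.
  - by apply: (measurable_EFin_comp (f := fun x => h x * h x)); exact: measurable_funM.
  - by rewrite -expr2 sqr_ge0.
exact: ltry.
Qed.

Lemma inner_tensor g h g' h' : L2 mu g -> L2 mu h -> L2 mu g' -> L2 mu h' ->
  inner mu2 (tensor g h) (tensor g' h') = inner mu g g' * inner mu h h'.
Proof.
move=> lg lh lg' lh'.
have lt := tensor_L2 lg lh; have lt' := tensor_L2 lg' lh'.
have hi := integrable_mulL2 lh lh'; have gi := integrable_mulL2 lg lg'.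
apply: EFin_inj; rewrite EFin_inner // -(integral12_prod_meas1 (integrable_mulL2 lt lt')).
rewrite /fubini_F EFinM muleC [X in (_ * X)%E]EFin_inner // -integralZl //.
apply: eq_integral => x _; rewrite muleC EFin_inner // -integralZl //.
by apply: eq_integral => y _; rewrite /tensor -EFinM /=; congr EFin; ring.
Qed.

Definition tens (u v : L2T mu) : L2T mu2 := toL2 (tensor_L2 (L2T_L2 u) (L2T_L2 v)).

Lemma tensE u v : tens u v = tensor u v :> (T * T -> R).
Proof. exact: toL2E. Qed.

Lemma ip_tens u v u' v' :
  ipL (tens u v) (tens u' v') = ipL u u' * ipL v v'.
Proof. by rewrite /ipL !tensE inner_tensor //; exact: L2T_L2. Qed.

Lemma tens_linl (a : R) u u' v : tens (a *: u + u') v = a *: tens u v + tens u' v.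
Proof. by apply/LfuneqP => z; rewrite L2T_linE !tensE /tensor L2T_linE mulrDl mulrA. Qed.

Lemma tens_linr (a : R) u v v' : tens u (a *: v + v') = a *: tens u v + tens u v'.
Proof. by apply/LfuneqP => z; rewrite L2T_linE !tensE /tensor L2T_linE; ring. Qed.

Lemma nm_tens u v : nm (@ipL _ _ _ mu2) (tens u v) = nm (@ipL _ _ _ mu) u * nm (@ipL _ _ _ mu) v.
Proof. by rewrite /nm ip_tens sqrtrM // (ip_ge0 (semi_ipL mu)). Qed.

Lemma nm_tens_dist u v u' v' : nm (@ipL _ _ _ mu2) (tens u v - tens u' v') <=
  nm (@ipL _ _ _ mu) (u - u') * nm (@ipL _ _ _ mu) v +
  nm (@ipL _ _ _ mu) u' * nm (@ipL _ _ _ mu) (v - v').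
Proof.
apply: (le_trans (nm_dist_tri (semi_ipL mu2) (tens u' v) _ _)).
have -> : tens u v - tens u' v = tens (u - u') v.
  by rewrite [u - u']addrC -[- u']scaleN1r tens_linl scaleN1r addrC.
have -> : tens u' v - tens u' v' = tens u' (v - v').
  by rewrite [v - v']addrC -[- v']scaleN1r tens_linr scaleN1r addrC.
by rewrite !nm_tens.
Qed.

End tensor_L2.

Lemma L2_dominated_cvg d (T : measurableType d) (R : realType)
    (mu : {measure set T -> \bar R}) (F : L2T mu) (Fn : nat -> L2T mu) (D : T -> R) :
  mu.-integrable setT (EFin \o D) ->
  (forall n x, (F x - Fn n x) ^+ 2 <= D x) ->
  (forall x, (fun n => Fn n x) @ \oo --> F x) ->
  forall eta, 0 < eta -> exists n, nm (@ipL _ _ _ mu) (F - Fn n) <= eta.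
Proof.
move=> iD FD FF eta eta0.
pose f_ n x : \bar R := ((F x - Fn n x) ^+ 2)%:E.
have mf n : measurable_fun setT (f_ n).
  apply: (measurable_EFin_comp (f := fun x => (F x - Fn n x) ^+ 2)).
  by apply: measurable_funX; exact: L2_measurable (L2T_L2 (F - Fn n)).
have [|||_ _] := @dominated_convergence _ _ _ mu setT measurableT f_ (cst 0%E) (EFin \o D) mf _ _ iD.
- exact: measurable_cst.
- apply: aeW => x _; apply/cvg_EFin; first exact: nearW.
  have h : (fun n => F x - Fn n x) @ \oo --> 0.
    have := cvgB (@cvg_cst _ (F x) _ \oo _) (FF x).
    by rewrite subrr => h; exact: h.
  by have hh := cvgM h h; rewrite mulr0 in hh; exact: hh.
- by apply: aeW => x n _; rewrite /f_ gee0_abs ?lee_fin ?sqr_ge0.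
rewrite integral_cst // mul0e => /fine_cvg /cvgrPdist_le /(_ (eta ^+ 2)).
rewrite exprn_gt0 // => /(_ isT)[n _ /(_ n (leqnn n))].
have -> : (fine \o (fun n => \int[mu]_x f_ n x)%E) n = ipL (F - Fn n) (F - Fn n).
  rewrite /= /ipL /inner /Rintegral; congr fine.
rewrite sub0r normrN => h; exists n.
by rewrite (nm_le (semi_ipL mu)) ?(ltW eta0) //; exact: le_trans (ler_norm _) h.
Qed.

(** * Density of finite sums of elementary tensors *)

Section density.
Context d (T : measurableType d) (R : realType).
Variable mu : probability T R.
Notation mu2 := (mu \x mu)%E.
Notation V2 := (L2T mu2).
Notation nm2 := (nm (@ipL _ _ _ mu2)).

Definition tensor_sum (n : nat) (g h : nat -> L2T mu) : V2 :=
  \sum_(i < n) tens (g i) (h i).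

Definition tensor_approx (F : V2) : Prop :=
  forall eta, 0 < eta -> exists n g h, nm2 (F - tensor_sum n g h) <= eta.

Let ip2P := semi_ipL mu2.

Lemma mu2_fin : (mu2 setT < +oo)%E.
Proof. by rewrite probability_setT ltry. Qed.

Lemma tensor_sum_lin (a : R) n g h n' g' h' :
  exists m g'' h'', tensor_sum m g'' h'' = a *: tensor_sum n g h + tensor_sum n' g' h'.
Proof.
exists (n + n')%N, (fun i => if (i < n)%N then a *: g i else g' (i - n)%N),
  (fun i => if (i < n)%N then h i else h' (i - n)%N).
rewrite /tensor_sum big_split_ord /= scaler_sumr; congr (_ + _).
  apply: eq_bigr => i _; rewrite ltn_ord.
  apply/LfuneqP => z; have -> : (a *: tens (g i) (h i)) z = a * tens (g i) (h i) z by [].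
  by rewrite !tensE /tensor mulrA.
by apply: eq_bigr => i _; rewrite ltnNge leq_addr /= addKn.
Qed.

Lemma tensor_approx_lim (F : V2) :
  (forall eta, 0 < eta -> exists2 G, tensor_approx G & nm2 (F - G) <= eta) ->
  tensor_approx F.
Proof.
move=> H eta eta0; have e0 : 0 < eta / 2 by rewrite divr_gt0.
have [G aG FG] := H _ e0; have [n [g [h Gh]]] := aG _ e0.
exists n, g, h; apply: (le_trans (nm_dist_tri ip2P G _ _)).
by have -> : eta = eta / 2 + eta / 2 by [field]; rewrite lerD.
Qed.

Lemma tensor_approx_sum n g h : tensor_approx (tensor_sum n g h).
Proof. by move=> eta eta0; exists n, g, h; rewrite subrr (nm0 ip2P) ltW. Qed.

Lemma tensor_approx_lin (a : R) F G : tensor_approx F -> tensor_approx G ->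
  tensor_approx (a *: F + G).
Proof.
move=> aF aG eta eta0; have e0 : 0 < eta / 2 by rewrite divr_gt0.
have a0 : 0 < `|a| + 1 by rewrite ltr_wpDl.
have [n [g [h Fh]]] := aF _ (divr_gt0 e0 a0); have [n' [g' [h' Gh]]] := aG _ e0.
have [m [g'' [h'' E]]] := tensor_sum_lin a n g h n' g' h'.
exists m, g'', h''; rewrite E opprD addrACA -scalerBr.
apply: (le_trans (nmD ip2P _ _)); rewrite (nmZ ip2P).
have -> : eta = eta / 2 + eta / 2 by field.
rewrite lerD //; apply: (@le_trans _ _ ((`|a| + 1) * nm2 (F - tensor_sum n g h))).
  by rewrite ler_wpM2r ?nm_ge0 // lerDl.
by rewrite mulrC -ler_pdivlMr.
Qed.

Lemma tensor_approx0 : tensor_approx 0.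
Proof.
have := tensor_approx_sum 0 (fun=> 0) (fun=> 0).
by rewrite /tensor_sum big_ord0.
Qed.

Lemma tensor_approx_tens u v : tensor_approx (tens u v).
Proof.
have := tensor_approx_sum 1 (fun=> u) (fun=> v).
by rewrite /tensor_sum big_ord1.
Qed.

Lemma tensor_approx_bigsum n (c : nat -> R) (F : nat -> V2) :
  (forall i, tensor_approx (F i)) -> tensor_approx (\sum_(i < n) c i *: F i).
Proof.
move=> aF; elim: n => [|n IH]; first by rewrite big_ord0; exact: tensor_approx0.
rewrite big_ord_recr [X in tensor_approx X]addrC.
exact: (tensor_approx_lin (c n) (aF n) IH).
Qed.

Lemma indic_L2 d' (X : measurableType d') (m : {measure set X -> \bar R}) (A : set X) :
  (m setT < +oo)%E -> measurable A -> L2 m (\1_A).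
Proof.
move=> mfin mA; apply/L2P; split; first exact: measurable_indic.
apply: (@le_lt_trans _ _ (\int[m]_x (cst 1%E x))%E); last first.
  by rewrite integral_cst // mul1e.
apply: ge0_le_integral => //.
- apply: (measurable_EFin_comp (f := fun x => \1_A x ^+ 2)).
  by apply: measurable_funX; exact: measurable_indic.
- by move=> x _; rewrite lee_fin indicE; case: (_ \in _); rewrite ?expr1n ?expr0n.
Qed.

(** Dynkin's pi-lambda argument: the indicator of a rectangle is an elementary tensor, complements
    follow by subtraction from 1, and countable disjoint unions by dominated convergence of the
    partial sums. *)
Lemma tensor_approx_indic (A : set (T * T)) : measurable A ->
  forall F : V2, F = \1_A :> (T * T -> R) -> tensor_approx F.
Proof.
pose Q (A : set (T * T)) := forall F : V2, F = \1_A :> (T * T -> R) -> tensor_approx F.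
pose I (A : set (T * T)) (mA : measurable A) : V2 := toL2 (indic_L2 mu2_fin mA).
have fin1 : (mu setT < +oo)%E by rewrite probability_setT ltry.
have one : tensor_approx (I _ measurableT).
  have -> : I _ measurableT =
      tens (toL2 (indic_L2 fin1 measurableT)) (toL2 (indic_L2 fin1 measurableT)).
    by apply/LfuneqP => z; rewrite tensE !toL2E /tensor !indicE !in_setT mulr1.
  exact: tensor_approx_tens.
move=> mA; have : <<s [set X `*` Y | X in (measurable : set (set T)) & Y in (measurable : set (set T))] >> A.
  by rewrite -measurable_prod_measurableType.
apply: (dynkin_induction (P := Q) (measurable_prod_measurableType T T)) => {A mA}.
- move=> _ _ [A1 mA1 [B1 mB1 <-]] [A2 mA2 [B2 mB2 <-]].
  have -> : (A1 `*` B1) `&` (A2 `*` B2) = (A1 `&` A2) `*` (B1 `&` B2).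
    by apply/seteqP; split => -[x y] /= [[? ?] [? ?]].
  by exists (A1 `&` A2); [exact: measurableI|exists (B1 `&` B2) => //; exact: measurableI].
- move=> F FE; have -> // : F = I _ measurableT.
  by apply/LfuneqP => z; rewrite FE toL2E.
- move=> _ [A mA [B mB <-]] F FE.
  have -> : F = tens (toL2 (indic_L2 fin1 mA)) (toL2 (indic_L2 fin1 mB)).
    apply/LfuneqP => -[x y]; rewrite FE tensE !toL2E /tensor !indicE /=.
    by rewrite in_setX /= -natrM mulnb.
  exact: tensor_approx_tens.
- move=> A mA QA F FE.
  have -> : F = (-1) *: I A mA + I _ measurableT.
    apply/LfuneqP => z; rewrite L2T_linE FE !toL2E !indicE in_setC in_setT.
    by case: (_ \in _); rewrite /= ?mulr1 ?mulr0 ?addNr ?add0r.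
  exact: (tensor_approx_lin (-1) (QA _ (toL2E (indic_L2 mu2_fin mA))) one).
- move=> A mA tA QA F FE; apply: tensor_approx_lim => eta eta0.
  pose G n : V2 := \sum_(i < n) 1 *: I (A i) (mA i).
  have GE n z : G n z = \sum_(i < n) \1_(A i) z.
    by rewrite L2T_sumE; apply: eq_bigr => i _; rewrite scale1r toL2E.
  have Gone n z k : A k z -> G n z = (k < n)%N%:R.
    move=> Akz; rewrite GE; case: ltnP => kn.
      rewrite (bigD1 (Ordinal kn)) //= big1 ?addr0; first by rewrite indicE mem_set.
      move=> i ik; rewrite indicE memNset // => Aiz; move/eqP: ik; apply.
      by apply/val_inj/(tA i k) => //; exists z.
    rewrite big1 // => i _; rewrite indicE memNset // => Aiz.
    have ik : i = k :> nat by apply: (tA i k) => //; exists z.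
    by move: (ltn_ord i); rewrite ik ltnNge kn.
  have Gnone n z : ~ (\bigcup_k A k) z -> G n z = 0.
    move=> nz; rewrite GE big1 // => i _; rewrite indicE memNset // => Aiz.
    by apply: nz; exists i.
  have [|||n hn] := @L2_dominated_cvg _ _ _ mu2 F G (cst 1) _ _ _ eta eta0.
  + have := integrable_mulL2 (L2T_L2 (I _ measurableT)) (L2T_L2 (I _ measurableT)).
    by apply: eq_integrable => // z _; rewrite /= indicE in_setT mulr1.
  + move=> n z; rewrite FE indicE; have [[k _ Akz]|nz] := pselect ((\bigcup_k A k) z).
      rewrite mem_set; last by exists k.
      by rewrite (Gone n z k Akz); case: ltnP => _; rewrite ?subrr ?subr0 ?expr1n ?expr0n.
    by rewrite memNset // Gnone // subr0 expr0n.
  + move=> z; rewrite FE indicE; have [[k _ Akz]|nz] := pselect ((\bigcup_k A k) z).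
      rewrite mem_set; last by exists k.
      apply: cvg_near_cst; exists k.+1 => // n /= kn.
      by rewrite (Gone n z k Akz) kn.
    rewrite memNset // (_ : (fun n => G n z) = fun=> 0); first exact: cvg_cst.
    by apply/funext => n; rewrite Gnone.
  exists (G n); last exact: hn.
  exact: (tensor_approx_bigsum n (fun=> 1)
    (fun i => QA i _ (toL2E (indic_L2 mu2_fin (mA i))))).
Qed.

Import HBNNSimple.

Lemma tensor_approx_nnsfun (h : {nnsfun T * T >-> R}) :
  forall F : V2, F = h :> (T * T -> R) -> tensor_approx F.
Proof.
move=> F FE.
set s := finmap.enum_fset (fset_set (range h)).
have mA i : measurable (h @^-1` [set s`_i]) by [].
have -> : F = \sum_(i < size s) s`_i *: toL2 (indic_L2 mu2_fin (mA i)).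
  apply/LfuneqP => z; rewrite FE fimfunEord L2T_sumE; apply: eq_bigr => i _.
  by [].
apply: (tensor_approx_bigsum (size s) (fun i => s`_i) (F := fun i => toL2 (indic_L2 mu2_fin (mA i)))).
by move=> i; apply: (tensor_approx_indic (mA i)); rewrite toL2E.
Qed.

(** Simple functions increasing to F differ from it by at most F, so F^2 dominates the squared
    differences. *)
Lemma tensor_approx_ge0 (F : V2) : (forall z, 0 <= F z) -> tensor_approx F.
Proof.
move=> F0; have mF : measurable_fun setT (F : T * T -> R) by apply: L2_measurable (L2T_L2 F).
have mFE := measurable_EFin_comp mF.
pose g := nnsfun_approx measurableT mFE.
have gc z : (fun n => g n z) @ \oo --> F z.
  have := cvg_nnsfun_approx measurableT mFE (fun x _ => (F0 x : (0 <= (F x)%:E)%E)) (I : setT z).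
  by move=> /fine_cvg.
have gF n z : g n z <= F z.
  rewrite -(cvg_lim (@Rhausdorff R) (gc z)); apply: (nondecreasing_cvgn_le (u_ := fun n => g n z)).
    by move=> i j ij; exact/lefP/nd_nnsfun_approx.
  by apply/cvg_ex; exists (F z); exact: gc.
have g0 n z : 0 <= g n z by [].
have gL2 n : L2 mu2 (g n).
  apply/L2P; split => //.
  have /L2P[_] := L2T_L2 F; apply: le_lt_trans; apply: ge0_le_integral => //.
  - by move=> z _; rewrite lee_fin sqr_ge0.
  - by apply: (measurable_EFin_comp (f := fun x => g n x ^+ 2)); exact: measurable_funX.
  - by apply: (measurable_EFin_comp (f := fun x => F x ^+ 2)); exact: measurable_funX.
  - by move=> z _; rewrite lee_fin lerXn2r ?nnegrE.
apply: tensor_approx_lim => eta eta0.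
have [|||n hn] := @L2_dominated_cvg _ _ _ mu2 F (fun n => toL2 (gL2 n)) (fun z => F z * F z) _ _ _ eta eta0.
- exact: integrable_mulL2 (L2T_L2 F) (L2T_L2 F).
- move=> n z; rewrite toL2E -expr2 lerXn2r ?nnegrE ?subr_ge0 ?gF //.
  by rewrite lerBlDr lerDl.
- by move=> z; under eq_fun => n do rewrite toL2E; exact: gc.
by exists (toL2 (gL2 n)) => //; apply: (@tensor_approx_nnsfun (g n)); rewrite toL2E.
Qed.

Lemma normr_L2 (F : V2) : L2 mu2 (fun z => `|F z|).
Proof.
have /L2P[mF fF] := L2T_L2 F; apply/L2P; split; first exact: measurableT_comp.
by under eq_integral => z _ do rewrite real_normK ?num_real //.
Qed.

Lemma tensor_dense (F : V2) : tensor_approx F.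
Proof.
pose A := toL2 (normr_L2 F).
have -> : F = 2^-1 *: (A + F) + (- 2^-1 *: (A - F) + 0).
  apply/LfuneqP => z; rewrite addr0.
  have -> : (2^-1 *: (A + F) + - 2^-1 *: (A - F)) z =
    2^-1 * (`|F z| + F z) + - 2^-1 * (`|F z| - F z) by [].
  by field.
have aP : tensor_approx (A + F).
  apply: tensor_approx_ge0 => z; have -> : (A + F) z = `|F z| + F z by [].
  by have := ler_norm (- F z); rewrite normrN; lra.
have aM : tensor_approx (A - F).
  apply: tensor_approx_ge0 => z; have -> : (A - F) z = `|F z| - F z by [].
  by rewrite subr_ge0 ler_norm.
exact: (tensor_approx_lin 2^-1 aP (tensor_approx_lin (- 2^-1) aM tensor_approx0)).
Qed.

End density.

(** * Tensor squares of contractions *)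

Lemma Rintegral_sum d (T : measurableType d) (R : realType)
    (m : {measure set T -> \bar R}) I (r : seq I) (F : I -> T -> R) :
  (forall i, m.-integrable setT (EFin \o F i)) ->
  \int[m]_x (\sum_(i <- r) F i x) = \sum_(i <- r) \int[m]_x F i x.
Proof.
move=> iF.
have E : (\sum_(i <- r) \int[m]_x (F i x)%:E)%E = (\sum_(i <- r) \int[m]_x F i x)%:E.
  rewrite -sumEFin; apply: eq_bigr => i _; rewrite /Rintegral fineK //.
  exact: (integrable_fin_num measurableT (iF i)).
rewrite [LHS]/Rintegral (eq_integral (fun x => \sum_(i <- r) (F i x)%:E)%E); last first.
  by move=> x _; rewrite sumEFin.
by rewrite (integral_sum measurableT iF) E.
Qed.

Section tensor_semigroup.
Context d (T : measurableType d) (R : realType).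
Variables (mu : probability T R).
Notation mu2 := (mu \x mu)%E.
Notation V1 := (L2T mu).
Notation V2 := (L2T mu2).
Notation ip1 := (@ipL _ _ _ mu).
Notation ip2 := (@ipL _ _ _ mu2).
Notation nm1 := (nm ip1).
Notation nm2 := (nm ip2).
Let ip1P := semi_ipL mu.
Let ip2P := semi_ipL mu2.

(* The entrywise pairing of a positive semidefinite matrix with a Gram matrix is the integral
   of a pointwise nonnegative function. *)
Lemma gram_pairing_ge0 n (C : 'I_n -> 'I_n -> R) (h : 'I_n -> V1) :
  (forall c : 'I_n -> R, 0 <= \sum_i \sum_j C i j * (c i * c j)) ->
  0 <= \sum_i \sum_j C i j * ip1 (h i) (h j).
Proof.
move=> psd.
have int1 i j : mu.-integrable setT (EFin \o (fun x => C i j * (h i x * h j x))).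
  exact: (integrableZl measurableT (C i j) (integrable_mulL2 (L2T_L2 (h i)) (L2T_L2 (h j)))).
rewrite pair_bigA /=.
rewrite (eq_bigr (fun q => \int[mu]_x (C q.1 q.2 * (h q.1 x * h q.2 x)))); last first.
  move=> [i j] _ /=; rewrite RintegralZl //; exact: (integrable_mulL2 (L2T_L2 (h i)) (L2T_L2 (h j))).
rewrite -Rintegral_sum; last by move=> [i j]; exact: int1.
apply: Rintegral_ge0 => x _.
have := psd (fun i => h i x).
by rewrite pair_bigA.
Qed.

Lemma ip_tensor_sum n (g h : nat -> V1) : ip2 (tensor_sum n g h) (tensor_sum n g h) =
  \sum_(i < n) \sum_(j < n) ip1 (g i) (g j) * ip1 (h i) (h j).
Proof.
rewrite (ip_suml ip2P); apply: eq_bigr => i _; rewrite (ip_sumr ip2P).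
by apply: eq_bigr => j _; rewrite ip_tens.
Qed.

(** The squared norm of a sum of g_i (x) h_i is the entrywise pairing of the two Gram matrices. A
    contraction lowers a Gram matrix in the positive semidefinite order, so the two factors can be
    replaced by their images one after the other. *)
Lemma tensor_sum_contraction (Q : V1 -> V1) n (g h : nat -> V1) :
  (forall a u v, nm1 (Q (a *: u + v) - (a *: Q u + Q v)) = 0) ->
  (forall u, nm1 (Q u) <= nm1 u) ->
  nm2 (tensor_sum n (Q \o g) (Q \o h)) <= nm2 (tensor_sum n g h).
Proof.
move=> lin contr.
have psd (u : nat -> V1) (c : 'I_n -> R) : 0 <= \sum_(i < n) \sum_(j < n)
    (ip1 (u i) (u j) - ip1 (Q (u i)) (Q (u j))) * (c i * c j).
  have quad (w : 'I_n -> V1) : \sum_(i < n) \sum_(j < n) ip1 (w i) (w j) * (c i * c j) =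
      nm1 (\sum_(i < n) c i *: w i) ^+ 2.
    rewrite (nm_sqr ip1P) (ip_suml ip1P); apply: eq_bigr => i _.
    rewrite (ip_sumr ip1P); apply: eq_bigr => j _.
    by rewrite (ipZl ip1P) (ipZr ip1P); ring.
  under eq_bigr => i _ do (under eq_bigr => j _ do rewrite mulrBl; rewrite sumrB).
  rewrite sumrB quad quad subr_ge0 ler_sqr ?nnegrE ?nm_ge0 //.
  have := nm_null_dist ip1P 0 (null_linear_sum ip1P c (fun i : 'I_n => u i) lin).
  by rewrite !subr0 => <-.
rewrite /nm ler_wsqrtr // !ip_tensor_sum.
apply: (@le_trans _ _ (\sum_(i < n) \sum_(j < n) ip1 (g i) (g j) * ip1 (Q (h i)) (Q (h j)))).
  rewrite -subr_ge0 -sumrB; under eq_bigr => i _ do (rewrite -sumrB; under eq_bigr => j _ do rewrite -mulrBl).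
  exact: (gram_pairing_ge0 (fun i => Q (h i)) (psd g)).
rewrite -subr_ge0 -sumrB.
under eq_bigr => i _ do (rewrite -sumrB; under eq_bigr => j _ do rewrite -mulrBr mulrC).
exact: (gram_pairing_ge0 (fun i => g i) (psd h)).
Qed.

Section tensor_square_op.
Variables (A : (T -> R) -> T -> R) (A2 : (T * T -> R) -> T * T -> R) (Q : V1 -> V1).
Hypothesis AA2 : tensor_square mu A A2.
Hypothesis QE : forall u, Q u = A u :> (T -> R).
Variable Q2 : V2 -> V2.
Hypothesis Q2E : forall u, Q2 u = A2 u :> (T * T -> R).
Hypothesis lin : forall a u v, nm1 (Q (a *: u + v) - (a *: Q u + Q v)) = 0.
Hypothesis contr : forall u, nm1 (Q u) <= nm1 u.

Lemma nm2_ae_eq (u v : V2) : u = v %[ae mu2] -> nm2 (u - v) = 0.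
Proof. by move=> uv; rewrite /nm ipL_eq0 // sqrtr0. Qed.

Lemma tensor_square_lin a u v : nm2 (Q2 (a *: u + v) - (a *: Q2 u + Q2 v)) = 0.
Proof.
apply: nm2_ae_eq; rewrite L2T_linE !Q2E; case: AA2 => -[_ l _] _.
exact: (l a u v (L2T_L2 u) (L2T_L2 v)).
Qed.

Lemma tensor_square_tens u v : nm2 (Q2 (tens u v) - tens (Q u) (Q v)) = 0.
Proof.
apply: nm2_ae_eq; rewrite !tensE Q2E tensE !QE; case: AA2 => _.
by apply; exact: L2T_L2.
Qed.

Lemma tensor_square_tensor_sum n g h :
  nm2 (Q2 (tensor_sum n g h) - tensor_sum n (Q \o g) (Q \o h)) = 0.
Proof.
have := null_linear_sum ip2P (fun=> 1) (fun i : 'I_n => tens (g i) (h i)) tensor_square_lin.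
rewrite (eq_bigr (fun i : 'I_n => tens (g i) (h i))) => [|i _]; last by rewrite scale1r.
rewrite [X in _ - X](eq_bigr (fun i : 'I_n => Q2 (tens (g i) (h i)))) => [|i _]; last by rewrite scale1r.
move=> e; apply/le_anti; rewrite nm_ge0 andbT.
apply: (le_trans (nm_dist_tri ip2P (\sum_(i < n) Q2 (tens (g i) (h i))) _ _)).
rewrite e add0r -sumrB; apply: (le_trans (nm_sum ip2P _ _ _)).
by rewrite big1 // => i _; exact: tensor_square_tens.
Qed.

Lemma tensor_square_bounded : exists2 M, 0 <= M & forall u, nm2 (Q2 u) <= M * nm2 u.
Proof.
case: AA2 => -[_ _ [M HM]] _; exists `|M| => // u.
have := HM u (L2T_L2 u); rewrite -Q2E !L2norm_sqrt; try exact: L2T_L2.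
rewrite -EFinM lee_fin => /le_trans; apply.
by rewrite ler_wpM2r ?sqrtr_ge0 // ler_norm.
Qed.

Lemma tensor_square_dist_bounded : exists2 M, 0 <= M &
  forall u v, nm2 (Q2 u - Q2 v) <= M * nm2 (u - v).
Proof.
have [M M0 HM] := tensor_square_bounded; exists M => // u v.
have e : nm2 (Q2 (u - v) - (Q2 u - Q2 v)) = 0.
  by have := tensor_square_lin (-1) v u; rewrite !scaleN1r ![- _ + _]addrC.
have e2 : nm2 (Q2 (u - v)) = nm2 (Q2 u - Q2 v).
  by have := nm_null_dist ip2P 0 e; rewrite !subr0.
rewrite -e2; exact: HM.
Qed.

(** A priori only some bound M on the operator is given. It suffices to pass from the dense tensor
    sums to all u, with an error of at most (M + 1) |u - D|. *)
Lemma tensor_square_contraction u : nm2 (Q2 u) <= nm2 u.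
Proof.
have [M M0 HM] := tensor_square_dist_bounded.
apply/ler_addgt0Pr => eta eta0.
have M1 : 0 < M + 1 by rewrite ltr_wpDl.
have [n [g [h Fh]]] := tensor_dense u (divr_gt0 eta0 M1).
set D := tensor_sum n g h in Fh.
have hD : nm2 (Q2 D) <= nm2 D.
  have := nm_null_dist ip2P 0 (tensor_square_tensor_sum n g h); rewrite !subr0 => ->.
  exact: tensor_sum_contraction.
have -> : Q2 u = (Q2 u - Q2 D) + Q2 D by rewrite subrK.
apply: (le_trans (nmD ip2P _ _)).
have h1 : nm2 D <= nm2 u + nm2 (u - D).
  have {1}-> : D = u - (u - D) by rewrite subKr.
  by apply: (le_trans (nmD ip2P _ _)); rewrite (nmN ip2P).
have h2 := HM u D.
have h3 : (M + 1) * nm2 (u - D) <= eta by rewrite mulrC -ler_pdivlMr.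
lra.
Qed.

End tensor_square_op.

End tensor_semigroup.

(** * The two-point motion as a contraction semigroup *)

Lemma le_chain_half (R : realFieldType) (eta x y z v : R) :
  x <= y + z -> z <= v -> y <= eta / 2 -> v <= eta / 2 -> x <= eta.
Proof. lra. Qed.

Lemma le_chain_third (R : realFieldType) (eta x y z v w : R) :
  x <= y + z -> z <= v + w -> y <= eta / 3 -> v <= eta / 3 -> w <= eta / 3 -> x <= eta.
Proof. lra. Qed.

Lemma normrB_le_split (R : realFieldType) (eta a b n m x : R) :
  0 <= n -> `|a| <= x * m -> x <= n -> `|b| <= n * m -> 0 <= m ->
  n <= eta / (2 * (m + 1)) -> `|a - b| <= eta.
Proof.
move=> n0 ha xn hb m0 hn; apply: (le_trans (ler_normB _ _)).
have m1 : 0 < 2 * (m + 1) by lra.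
rewrite ler_pdivlMr // in hn.
have : x * m <= n * m by rewrite ler_wpM2r.
lra.
Qed.

Section two_point.
Context d (T : measurableType d) (R : realType).
Variables (p : R -> R.-pker T ~> T) (mu : probability T R).
Hypotheses (pT : transition_function p) (pmu : invariant_measure p mu).
Notation P := (transition_semigroup p).
Hypothesis Pc : strongly_continuous mu P.
Variable P2 : R -> (T * T -> R) -> T * T -> R.
Hypothesis HP2 : forall t, 0 <= t -> tensor_square mu (P t) (P2 t).
Notation mu2 := (mu \x mu)%E.
Notation V1 := (L2T mu).
Notation V2 := (L2T mu2).
Notation ip1 := (@ipL _ _ _ mu).
Notation ip2 := (@ipL _ _ _ mu2).
Notation nm1 := (nm ip1).
Notation nm2 := (nm ip2).
Let ip1P := semi_ipL mu.
Let ip2P := semi_ipL mu2.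
Notation Q := (transition_op pmu).
Let Qs := transition_op_contraction pT pmu Pc.

Lemma two_point_L2 t (t0 : 0 <= t) (u : V2) : L2 mu2 (P2 t u).
Proof. by case: (HP2 t0) => -[h _ _] _; exact: h (L2T_L2 u). Qed.

Definition two_point_op (t : R) (u : V2) : V2 :=
  match pselect (0 <= t) with
  | left t0 => toL2 (two_point_L2 t0 u)
  | right _ => u
  end.
Notation Q2 := two_point_op.

Lemma two_point_opE t (u : V2) : 0 <= t -> Q2 t u = P2 t u :> (T * T -> R).
Proof. by move=> t0; rewrite /two_point_op; case: pselect => // h; rewrite toL2E. Qed.

Lemma two_point_lin t a u v : 0 <= t ->
  nm2 (Q2 t (a *: u + v) - (a *: Q2 t u + Q2 t v)) = 0.
Proof.
move=> t0; exact: (tensor_square_lin (HP2 t0) (fun u => two_point_opE u t0)).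
Qed.

Lemma two_point_tensor_sum t n g h : 0 <= t ->
  nm2 (Q2 t (tensor_sum n g h) - tensor_sum n (Q t \o g) (Q t \o h)) = 0.
Proof.
move=> t0; exact: (tensor_square_tensor_sum (HP2 t0) (fun u => transition_opE pmu u t0)
  (fun u => two_point_opE u t0)).
Qed.

Lemma two_point_contr t u : 0 <= t -> nm2 (Q2 t u) <= nm2 u.
Proof.
move=> t0; case: Qs => lin contr _ _ _.
exact: (tensor_square_contraction (HP2 t0) (fun u => transition_opE pmu u t0)
  (fun u => two_point_opE u t0) (fun a u v => lin t a u v t0) (fun u => contr t u t0)).
Qed.

Lemma two_point_dist t u v : 0 <= t -> nm2 (Q2 t u - Q2 t v) <= nm2 (u - v).
Proof.
move=> t0.
have e : nm2 (Q2 t (u - v) - (Q2 t u - Q2 t v)) = 0.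
  by have := two_point_lin (-1) v u t0; rewrite !scaleN1r ![- _ + _]addrC.
have e2 : nm2 (Q2 t (u - v)) = nm2 (Q2 t u - Q2 t v).
  by have := nm_null_dist ip2P 0 e; rewrite !subr0.
by rewrite -e2; exact: two_point_contr.
Qed.

Lemma tensor_sum_dist n (g h g' h' : nat -> V1) :
  nm2 (tensor_sum n g h - tensor_sum n g' h') <=
  \sum_(i < n) (nm1 (g i - g' i) * nm1 (h i) + nm1 (g' i) * nm1 (h i - h' i)).
Proof.
rewrite /tensor_sum -sumrB; apply: (le_trans (nm_sum ip2P _ _ _)).
by apply: ler_sum => i _; exact: nm_tens_dist.
Qed.

Lemma tensor_sum_null n (g h g' h' : nat -> V1) :
  (forall i, nm1 (g i - g' i) = 0) -> (forall i, nm1 (h i - h' i) = 0) ->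
  nm2 (tensor_sum n g h - tensor_sum n g' h') = 0.
Proof.
move=> gg hh; apply/le_anti; rewrite nm_ge0 andbT.
apply: (le_trans (tensor_sum_dist _ _ _ _ _)).
by rewrite big1 // => i _; rewrite gg hh mul0r mulr0 addr0.
Qed.

(** Both maps are 1-Lipschitz and tensor sums are dense. The operators [P2 t] are given separately
    for each t; their semigroup law and the value at time 0 are recovered in this way from
    elementary tensors. *)
Lemma null_on_tensors (A B : V2 -> V2) :
  (forall u v, nm2 (A u - A v) <= nm2 (u - v)) ->
  (forall u v, nm2 (B u - B v) <= nm2 (u - v)) ->
  (forall n g h, nm2 (A (tensor_sum n g h) - B (tensor_sum n g h)) = 0) ->
  forall u, nm2 (A u - B u) = 0.
Proof.
move=> cA cB AB u; apply/le_anti; rewrite nm_ge0 andbT.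
apply/ler_addgt0Pr => eta eta0; rewrite add0r.
have [n [g [h Fh]]] := tensor_dense u (divr_gt0 eta0 (ltr0Sn R 1)).
set D := tensor_sum n g h in Fh.
have AD : nm2 (A D - B D) = 0 := AB n g h.
have t2 := nm_dist_tri ip2P (B D) (A D) (B u); rewrite AD add0r in t2.
have cBu := cB D u; rewrite (nm_distC ip2P D u) in cBu.
exact: (le_chain_half (nm_dist_tri ip2P (A D) (A u) (B u)) t2
  (le_trans (cA u D) Fh) (le_trans cBu Fh)).
Qed.

Lemma two_point_semigroup s t u : 0 <= s -> 0 <= t ->
  nm2 (Q2 (s + t) u - Q2 s (Q2 t u)) = 0.
Proof.
move=> s0 t0; move: u; apply: null_on_tensors => [u v|u v|n g h].
- exact: two_point_dist (addr_ge0 s0 t0).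
- exact: le_trans (two_point_dist _ _ s0) (two_point_dist _ _ t0).
case: Qs => _ _ sg _ _.
have e1 := two_point_tensor_sum n g h (addr_ge0 s0 t0).
have e2 := two_point_tensor_sum n g h t0.
have e3 := two_point_tensor_sum n (Q t \o g) (Q t \o h) s0.
have e4 := tensor_sum_null n (fun i => sg s t (g i) s0 t0) (fun i => sg s t (h i) s0 t0).
have e5 := two_point_dist (Q2 t (tensor_sum n g h)) (tensor_sum n (Q t \o g) (Q t \o h)) s0.
apply/le_anti; rewrite nm_ge0 andbT (nm_null_dist ip2P _ e1).
apply: (le_trans (nm_dist_tri ip2P (tensor_sum n (Q s \o (Q t \o g)) (Q s \o (Q t \o h))) _ _)).
rewrite [X in X + _]e4 add0r (nm_distC ip2P).
apply: (le_trans (nm_dist_tri ip2P (Q2 s (tensor_sum n (Q t \o g) (Q t \o h))) _ _)).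
by rewrite e3 addr0 (le_trans e5) // e2.
Qed.

Lemma two_point0 u : nm2 (Q2 0 u - u) = 0.
Proof.
move: u; apply: (null_on_tensors (B := id)) => [u v|u v|n g h].
- exact: two_point_dist (lexx 0).
- exact: lexx.
case: Qs => _ _ _ z _.
rewrite (nm_null_dist ip2P _ (two_point_tensor_sum n g h (lexx 0))).
exact: (tensor_sum_null n (fun i => z (g i)) (fun i => z (h i))).
Qed.

Lemma tensor_sum_cont n (g h : nat -> V1) eta : 0 < eta -> exists2 e, 0 < e &
  forall t, 0 <= t <= e ->
    nm2 (tensor_sum n (Q t \o g) (Q t \o h) - tensor_sum n g h) <= eta.
Proof.
case: Qs => _ contr _ _ cont.
elim: n eta => [|n IH] eta eta0.
  by exists 1 => // t _; rewrite /tensor_sum !big_ord0 subrr (nm0 ip2P) ltW.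
have [e1 e10 h1] := IH (eta / 2) (divr_gt0 eta0 (ltr0Sn R 1)).
pose c := nm1 (g n) + nm1 (h n) + 1.
have c0 : 0 < c by rewrite ltr_wpDl // addr_ge0 ?nm_ge0.
have ec : 0 < eta / 2 / c by rewrite !divr_gt0.
have [e2 e20 h2] := cont (g n) _ ec; have [e3 e30 h3] := cont (h n) _ ec.
exists (Num.min e1 (Num.min e2 e3)); first by rewrite !lt_min e10 e20 e30.
move=> t /andP[t0]; rewrite !le_min => /and3P[t1 t2 t3].
rewrite /tensor_sum !big_ord_recr /= opprD addrACA.
apply: (le_trans (nmD ip2P _ _)).
have -> : eta = eta / 2 + eta / 2 by field.
apply: lerD; first by apply: h1; rewrite t0.
apply: (le_trans (nm_tens_dist _ _ _ _)).
apply: (@le_trans _ _ (eta / 2 / c * nm1 (h n) + nm1 (g n) * (eta / 2 / c))).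
  apply: lerD; apply: ler_pM; rewrite ?nm_ge0 //.
  - by apply: h2; rewrite t0.
  - exact: contr.
  - by apply: h3; rewrite t0.
rewrite [X in _ + X]mulrC -mulrDr -[leRHS](divfK (lt0r_neq0 c0)) ler_pM2l //.
by rewrite addrC /c lerDl.
Qed.

Lemma two_point_contraction_semigroup : contraction_semigroup ip2 Q2.
Proof.
split.
- by move=> t a u v t0; exact: two_point_lin.
- by move=> t u t0; exact: two_point_contr.
- by move=> s t u s0 t0; exact: two_point_semigroup.
- exact: two_point0.
- move=> u eta eta0; have e3 : 0 < eta / 3 by rewrite divr_gt0.
  have [n [g [h Fh]]] := tensor_dense u e3; set D := tensor_sum n g h in Fh.
  have [e e0 he] := tensor_sum_cont n g h e3; exists e => // t te.
  have t0 : 0 <= t by case/andP: te.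
  have hD := he t te.
  rewrite -(nm_null_dist ip2P D (two_point_tensor_sum n g h t0)) in hD.
  have Fh' := Fh; rewrite (nm_distC ip2P u D) in Fh'.
  exact: (le_chain_third (nm_dist_tri ip2P (Q2 t D) (Q2 t u) u)
    (nm_dist_tri ip2P D (Q2 t D) u) (le_trans (two_point_dist u D t0) Fh) hD Fh').
Qed.

Definition one1 : V1 := toL2 (cst_L2 1 (probability_fin mu)).
Definition one2 : V2 := tens one1 one1.

Lemma ip_one1 (u : V1) : ip1 u one1 = \int[mu]_x u x.
Proof. by apply: eq_Rintegral => x _; rewrite toL2E mulr1. Qed.

Lemma ip_one2 (u : V2) : ip2 u one2 = \int[mu2]_x u x.
Proof. by apply: eq_Rintegral => x _; rewrite tensE /tensor !toL2E !mulr1. Qed.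

Lemma transition_ip_one t (u : V1) : 0 <= t -> ip1 (Q t u) one1 = ip1 u one1.
Proof.
move=> t0; rewrite !ip_one1 transition_opE //.
exact: (transition_mean pmu t0 (L2T_L2 u)).
Qed.

(** The mean is the pairing with [one2], an elementary tensor, so on tensor sums it factors into
    one-point means, which are preserved; density gives the rest. *)
Lemma two_point_ip_one t (u : V2) : 0 <= t -> ip2 (Q2 t u) one2 = ip2 u one2.
Proof.
move=> t0; apply/eqP; rewrite -subr_eq0 -normr_le0; apply/ler_addgt0Pr => eta eta0.
rewrite add0r.
have c0 : 0 < 2 * (nm2 one2 + 1) by rewrite mulr_gt0 // ltr_wpDl ?nm_ge0.
have [n [g [h Fh]]] := tensor_dense u (divr_gt0 eta0 c0).
set D := tensor_sum n g h in Fh.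
have hD : ip2 (Q2 t D) one2 = ip2 D one2.
  rewrite (ip_eq_null ip2P _ (two_point_tensor_sum n g h t0)) !(ip_suml ip2P).
  by apply: eq_bigr => i _; rewrite !ip_tens /= !transition_ip_one.
have -> : ip2 (Q2 t u) one2 - ip2 u one2 = ip2 (Q2 t u - Q2 t D) one2 - ip2 (u - D) one2.
  by rewrite !(ipBl ip2P) hD; ring.
exact: (normrB_le_split (nm_ge0 ip2 (u - D)) (normr_ip_le ip2P (Q2 t u - Q2 t D) one2)
  (two_point_dist u D t0) (normr_ip_le ip2P (u - D) one2) (nm_ge0 ip2 one2) Fh).
Qed.

End two_point.

Section time_average.
Context d (T : measurableType d) (R : realType) (mu : {measure set T -> \bar R}).
Notation V := (L2T mu).
Notation ip := (@ipL _ _ _ mu).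
Variables (P : R -> (T -> R) -> T -> R) (Q : R -> V -> V).
Hypothesis QE : forall t u, 0 <= t -> Q t u = P t u :> (T -> R).

Lemma weak_avg_inner (s : R) (u g : V) : weak_avg ip (fun r => Q r u) 0 s g <->
  forall h, L2 mu h ->
    inner mu g h = s^-1 * \int[lebesgue_measure]_(r in `[0, s]) inner mu (P r u) h.
Proof.
have E (w : V) : \int[lebesgue_measure]_(r in `[0, 0 + s]) ip (Q r u) w =
    \int[lebesgue_measure]_(r in `[0, s]) inner mu (P r u) w.
  rewrite add0r; apply: eq_Rintegral => r; rewrite inE /= in_itv /= => /andP[r0 _].
  by rewrite /ipL QE.
split=> [hg h lh|hg w]; last by rewrite E -(hg w (L2T_L2 w)).
have := hg (toL2 lh); rewrite E /ipL toL2E => ->.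
by [].
Qed.

(** [xget] picks some function with the weak property. Completeness shows that there is one, so the
    default value 0 is never returned. *)
Lemma time_avg_weak_avg (s : R) (u : V) :
  contraction_semigroup ip Q -> complete_ip ip -> 0 < s ->
  exists2 g : V, time_avg mu P s u = g & weak_avg ip (fun r => Q r u) 0 s g.
Proof.
move=> semiQ cip s0.
have [g0 hg0] := weak_avg_exists (semi_ipL mu) cip
  (semigroup_ucont (semi_ipL mu) semiQ u) (lexx 0) s0.
have ex : exists g, [set g | L2 mu g /\ forall h, L2 mu h ->
    inner mu g h = s^-1 * \int[lebesgue_measure]_(r in `[0, s]) inner mu (P r u) h] g.
  by exists g0; split; [exact: L2T_L2|exact: (weak_avg_inner s u g0).1].
have [lg hg] := xgetPex (cst 0) ex.
exists (toL2 lg); first by rewrite toL2E.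
by apply: (weak_avg_inner s u (toL2 lg)).2; rewrite toL2E.
Qed.

Lemma L2norm_nm (u : V) : L2norm mu u = (nm ip u)%:E.
Proof. by rewrite L2norm_sqrt //; exact: L2T_L2. Qed.

End time_average.

(** * The two inequalities *)

Section mixing.
Context d (T : measurableType d) (R : realType).
Variables (p : R -> R.-pker T ~> T) (mu : probability T R).
Hypotheses (pT : transition_function p) (pmu : invariant_measure p mu).
Notation P := (transition_semigroup p).
Hypothesis Pc : strongly_continuous mu P.
Variable P2 : R -> (T * T -> R) -> T * T -> R.
Hypothesis HP2 : forall t, 0 <= t -> tensor_square mu (P t) (P2 t).
Notation mu2 := (mu \x mu)%E.
Notation V1 := (L2T mu).
Notation V2 := (L2T mu2).
Notation ip1 := (@ipL _ _ _ mu).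
Notation ip2 := (@ipL _ _ _ mu2).
Notation nm1 := (nm ip1).
Notation nm2 := (nm ip2).
Let ip1P := semi_ipL mu.
Let ip2P := semi_ipL mu2.
Notation Q := (transition_op pmu).
Notation Q2 := (two_point_op HP2).
Let Qs := transition_op_contraction pT pmu Pc.
Let Q2s := two_point_contraction_semigroup pT pmu Pc HP2.

Lemma L20_ip_one2 (u : V2) : ip2 u (one2 mu) = 0 <-> L20 mu2 u.
Proof.
rewrite ip_one2; split=> [h|[_ h]]; last exact: h.
by split; [exact: L2T_L2|exact: h].
Qed.

Section fixed_horizon.
Variable s : R.
Hypotheses (s0 : 0 < s) (avg_le : (opnorm0 mu2 (time_avg mu2 P2 s) <= (expR 1)^-1%:E)%E).

Lemma two_point_unit_pairing (F : V2) eta : ip2 F (one2 mu) = 0 -> nm2 F = 1 -> 0 < eta ->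
  \forall k \near \oo, \sum_(l < k) ip2 (Q2 (l%:R / k%:R * s) F) F <=
    k%:R * (expR (- 1) + eta).
Proof.
move=> F1 nF eta0.
have [g gE hg] := time_avg_weak_avg (fun t u t0 => two_point_opE HP2 u t0) F Q2s
  (L2_complete (mu2_fin mu)) s0.
(* The orbit starts at [Q2 0 F], which equals F only up to a null vector. *)
have z : nm2 (Q2 0 F - F) = 0 by have [_ _ _ zero _] := Q2s; exact: zero.
have nz : nm2 (Q2 0 F) = 1.
  by have := nm_null_dist ip2P 0 z; rewrite !subr0 nF.
have ng : nm2 g <= expR (- 1) * nm2 (Q2 0 F).
  rewrite nz mulr1 expRN -lee_fin -L2norm_nm -gE; apply: le_trans avg_le.
  apply: ereal_sup_ubound; exists F => //; split; first exact/L20_ip_one2.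
  by rewrite L2norm_nm nF.
have := riemann_pairing ip2P (semigroup_ucont ip2P Q2s F) s0 eta0 hg ng.
apply: filterS => k.
rewrite -(nm_sqr ip2P) nz expr1n mulr1 => h; apply: le_trans h.
apply: ler_sum => l _; set w := Q2 (_ * s) F.
by rewrite (ipC ip2P w (Q2 0 F)) (ip_eq_null ip2P w z) (ipC ip2P F w).
Qed.

Lemma two_point_pairing (F : V2) eta : ip2 F (one2 mu) = 0 -> 0 < eta ->
  \forall k \near \oo, \sum_(l < k) ip2 (Q2 (l%:R / k%:R * s) F) F <=
    k%:R * (expR (- 1) + eta) * ip2 F F.
Proof.
move=> F1 eta0; have [z|nz] := eqVneq (nm2 F) 0.
  apply: nearW => k; rewrite (ip_null_l ip2P _ z) mulr0 big1 // => l _.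
  by rewrite (ipC ip2P) (ip_null_l ip2P _ z).
have pz : 0 < nm2 F by rewrite lt_def nz nm_ge0.
pose G := (nm2 F)^-1 *: F.
have G1 : ip2 G (one2 mu) = 0 by rewrite (ipZl ip2P) F1 mulr0.
have nG : nm2 G = 1 by rewrite (nmZ ip2P) gtr0_norm ?invr_gt0 // mulVf.
have := two_point_unit_pairing G1 nG eta0; apply: filterS => k h.
have -> : \sum_(l < k) ip2 (Q2 (l%:R / k%:R * s) F) F =
    nm2 F ^+ 2 * \sum_(l < k) ip2 (Q2 (l%:R / k%:R * s) G) G.
  rewrite mulr_sumr; apply: eq_bigr => l _.
  have t0 : 0 <= l%:R / k%:R * s by rewrite mulr_ge0 ?(ltW s0) // divr_ge0.
  have e : nm2 (Q2 (l%:R / k%:R * s) G - (nm2 F)^-1 *: Q2 (l%:R / k%:R * s) F) = 0.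
    have := null_linear_sum ip2P (fun=> (nm2 F)^-1) (fun i : 'I_1 => F)
      (fun a u v => two_point_lin HP2 a u v t0).
    by rewrite !big_ord1.
  rewrite (ip_eq_null ip2P _ e) (ipZl ip2P) (ipZr ip2P) mulrA mulrA.
  by rewrite -expr2 -exprMn mulfV // expr1n mul1r.
by rewrite -(nm_sqr ip2P) [leRHS]mulrC ler_pM2l ?exprn_gt0.
Qed.

Lemma two_point_pair (a : R) (x y x' y' : V1) (G : V2) t : 0 <= t ->
  ip2 (Q2 t (a *: tens x y + tens x' y')) G =
  a * ip2 (tens (Q t x) (Q t y)) G + ip2 (tens (Q t x') (Q t y')) G.
Proof.
move=> t0; rewrite (ip_eq_null ip2P _ (two_point_lin HP2 a _ _ t0)) (ipDl ip2P) (ipZl ip2P).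
have tE u v : nm2 (Q2 t (tens u v) - tens (Q t u) (Q t v)) = 0.
  exact: (tensor_square_tens (HP2 t0) (fun u => transition_opE pmu u t0)
    (fun u => two_point_opE HP2 u t0)).
by rewrite !(ip_eq_null ip2P _ (tE _ _)).
Qed.

Lemma combine_transition (f : V1) n (r c : 'I_n -> R) t : 0 <= t -> (forall i, 0 <= r i) ->
  nm1 (Q t (combine (fun r => Q r f) r c 0) - combine (fun r => Q r f) r c t) = 0.
Proof.
move=> t0 r0; have [lin _ sg _ _] := Qs.
have e := null_linear_sum ip1P c (fun i => Q (r i + 0) f) (fun a u v => lin t a u v t0).
rewrite (nm_null_dist ip1P _ e) /combine -sumrB.
apply/le_anti; rewrite nm_ge0 andbT; apply: (le_trans (nm_sum ip1P _ _ _)).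
rewrite big1 // => i _; rewrite -scalerBr (nmZ ip1P) addr0 [r i + t]addrC.
by rewrite (nm_distC ip1P) (sg t (r i) f t0 (r0 i)) mulr0.
Qed.

(** For H = F (x) conj F, the real part of <P2_t H, H> is |<P_t F, F>|^2 and |H|^2 = |F|^4; H is
    mean-zero because F is. The space is real, so the pairing bound is applied to the real and
    imaginary parts of H and the two results are added. *)
Lemma transition_mixing_orbit (f : V1) : ip1 f (one1 mu) = 0 ->
  mixing_orbit ip1 s (fun r => Q r f).
Proof.
move=> f1 n r c dd r0 eta eta0.
set U := combine (fun r => Q r f) r c; set W := combine (fun r => Q r f) r dd.
have mean0 c' : ip1 (combine (fun r => Q r f) r c' 0) (one1 mu) = 0.
  rewrite (ip_suml ip1P) big1 // => i _.
  by rewrite (ipZl ip1P) (transition_ip_one pmu) ?addr0 // f1 mulr0.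
(* A and B are the real and imaginary parts of F (x) conj F for F = U 0 + i W 0. *)
pose A : V2 := 1 *: tens (U 0) (U 0) + tens (W 0) (W 0).
pose B : V2 := (-1) *: tens (U 0) (W 0) + tens (W 0) (U 0).
have A1 : ip2 A (one2 mu) = 0.
  by rewrite (ipDl ip2P) (ipZl ip2P) !ip_tens !mean0 !mul0r mulr0 addr0.
have B1 : ip2 B (one2 mu) = 0.
  by rewrite (ipDl ip2P) (ipZl ip2P) !ip_tens !mean0 !mul0r mulr0 addr0.
have pairE t : 0 <= t -> ip2 (Q2 t A) A + ip2 (Q2 t B) B =
    corr ip1 (U t) (W t) (U 0) (W 0).
  move=> t0; rewrite /A /B !two_point_pair // !(ipDr ip2P) !(ipZr ip2P) !ip_tens.
  have eU z : ip1 (Q t (U 0)) z = ip1 (U t) z.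
    exact: (ip_eq_null ip1P z (combine_transition f c t0 r0)).
  have eW z : ip1 (Q t (W 0)) z = ip1 (W t) z.
    exact: (ip_eq_null ip1P z (combine_transition f dd t0 r0)).
  rewrite !eU !eW /corr.
  by move: (ip1 (U t) (U 0)) (ip1 (U t) (W 0)) (ip1 (W t) (U 0)) (ip1 (W t) (W 0)) => *; ring.
have normE : ip2 A A + ip2 B B = (ip1 (U 0) (U 0) + ip1 (W 0) (W 0)) ^+ 2.
  rewrite /A /B !(ipDl ip2P) !(ipDr ip2P) !(ipZl ip2P) !(ipZr ip2P) !ip_tens.
  rewrite (ipC ip1P (W 0) (U 0)).
  by move: (ip1 (U 0) (U 0)) (ip1 (U 0) (W 0)) (ip1 (W 0) (W 0)) => *; ring.
have hA := two_point_pairing A1 eta0; have hB := two_point_pairing B1 eta0.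
apply: filterS2 hA hB => k hA hB.
rewrite -normE mulrDr; apply: le_trans (lerD hA hB).
rewrite -big_split; apply: ler_sum => l _ /=; rewrite pairE //.
by rewrite mulr_ge0 ?(ltW s0) // divr_ge0.
Qed.

Lemma transition_contracting_orbit (f : V1) : contracting_orbit ip1 (fun r => Q r f).
Proof.
split=> [r t r0 t0|eta eta0].
  have [_ contr sg _ _] := Qs; rewrite -!(nm_sqr ip1P) ler_sqr ?nnegrE ?nm_ge0 //.
  have := nm_null_dist ip1P 0 (sg t r f t0 r0); rewrite !subr0 addrC => ->.
  exact: contr.
have e0 : 0 < Num.sqrt eta by rewrite sqrtr_gt0.
have [e e_gt0 he] := semigroup_ucont ip1P Qs f e0; exists e => // r t r0 te.
by rewrite -[eta](sqr_sqrtr (ltW eta0)) -(nm_le ip1P) ?sqrtr_ge0 // he.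
Qed.

Lemma transition_decay (f : V1) (n : nat) : ip1 f (one1 mu) = 0 ->
  ip1 (Q (n%:R / 2 * s) f) (Q (n%:R / 2 * s) f) <=
  decay_const R * expR 1 * expR (- n%:R) * ip1 f f.
Proof.
move=> f1; have := orbit_decay ip1P s0 n (transition_mixing_orbit f1) (transition_contracting_orbit f).
have z : nm1 (Q 0 f - f) = 0 by have [_ _ _ zero _] := Qs; exact: zero.
by rewrite (ip_eq_null ip1P _ z) (ipC ip1P f) (ip_eq_null ip1P _ z).
Qed.

End fixed_horizon.

End mixing.

(** * The quadratic form of the kernel *)

Section kernel_form.
Context d (T : measurableType d) (R : realType).
Variable mu : probability T R.
Notation mu2 := (mu \x mu)%E.
Notation V1 := (L2T mu).
Notation V2 := (L2T mu2).

(** Only the product with c is known to be integrable. If c is non-zero, division gives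
    integrability of h; if c = 0, both sides are 0 whatever h is. *)
Lemma EFin_Rintegral_scale (m : {measure set T -> \bar R}) (c : R) (h : T -> R) :
  m.-integrable setT (EFin \o (fun y => h y * c)) ->
  ((\int[m]_y h y) * c)%:E = (\int[m]_y (h y * c)%:E)%E.
Proof.
move=> hc; have [->|c0] := eqVneq c 0.
  by rewrite mulr0 integral0_eq // => y _; rewrite mulr0.
have ih : m.-integrable setT (EFin \o h).
  have := integrableZl measurableT c^-1 hc; apply: eq_integrable => // y _ /=.
  by rewrite -EFinM mulrCA mulVf // mulr1.
rewrite -(RintegralZr c measurableT ih) /Rintegral fineK //.
exact: integrable_fin_num.
Qed.

(** Symmetry of [Q] turns |Q u|^2 into <Q Q u, u> = <K u, u>, and Fubini for the integrable function
    k (u (x) u) gives the double integral. *)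
Lemma sqrt_kernel_form (k : T * T -> R) (Q : (T -> R) -> T -> R) (u : V1) (lk : L2 mu2 k) :
  nonneg_sqrt mu (integral_operator mu k) Q ->
  inner mu (Q u) (Q u) = @ipL _ _ _ mu2 (toL2 lk) (tens u u).
Proof.
move=> [[QL2 _ _] Qsym _ QQ]; have lu := L2T_L2 u.
have [lQ lQQ] := (QL2 _ lu, QL2 _ (QL2 _ lu)).
rewrite -(Qsym _ _ lQ lu) /ipL toL2E tensE.
apply: EFin_inj; rewrite !EFin_inner //; last exact: tensor_L2.
have ik := integrable_mulL2 lk (tensor_L2 lu lu).
rewrite -(integral12_prod_meas1 ik); apply: ae_eq_integral => //.
- by have /integrableP[] := integrable_mulL2 lQQ lu.
- exact: measurable_fubini_F ik.
apply: filterS2 (QQ u lu) (ae_integrable1 ik) => x QQx ix _.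
rewrite (QQx I) /fubini_F /integral_operator EFin_Rintegral_scale.
  by apply: eq_integral => y _; rewrite /= /tensor /=; congr EFin; ring.
move: ix; apply: eq_integrable => // y _; rewrite /= /tensor /=; congr EFin; ring.
Qed.

Lemma sqrt_kernel_le (k : T * T -> R) (Q : (T -> R) -> T -> R) (u : V1) :
  L2 mu2 k -> nonneg_sqrt mu (integral_operator mu k) Q ->
  inner mu (Q u) (Q u) <= fine (L2norm mu2 k) * @ipL _ _ _ mu u u.
Proof.
move=> lk QK; rewrite (sqrt_kernel_form u lk QK).
apply: (le_trans (ip_le_nm (semi_ipL mu2) _ _)).
by rewrite nm_tens -expr2 (nm_sqr (semi_ipL mu)) L2norm_sqrt.
Qed.

End kernel_form.

(** * Averaged relaxation time and singular value gap *)

Section spectral_gap.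
Context d (T : measurableType d) (R : realType).
Variables (p : R -> R.-pker T ~> T) (mu : probability T R).
Hypotheses (pT : transition_function p) (pmu : invariant_measure p mu).
Notation P := (transition_semigroup p).
Hypothesis Pc : strongly_continuous mu P.
Variable P2 : R -> (T * T -> R) -> T * T -> R.
Hypothesis HP2 : forall t, 0 <= t -> tensor_square mu (P t) (P2 t).
Notation mu2 := (mu \x mu)%E.
Notation V2 := (L2T mu2).
Notation ip2 := (@ipL _ _ _ mu2).
Notation nm2 := (nm ip2).
Let ip2P := semi_ipL mu2.
Notation Q2 := (two_point_op HP2).
Let Q2s := two_point_contraction_semigroup pT pmu Pc HP2.
Notation gap := (sing_gap mu2 P2).

Lemma two_point_avg_L20 s (u g : V2) : 0 < s -> ip2 u (one2 mu) = 0 ->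
  weak_avg ip2 (fun r => Q2 r u) 0 s g -> L20 mu2 g.
Proof.
move=> s0 u1 hg; apply/L20_ip_one2; rewrite hg add0r.
rewrite (_ : Rintegral _ _ _ = 0) ?mulr0 //.
rewrite /Rintegral integral0_eq // => r; rewrite /= in_itv /= => /andP[r0 _].
by rewrite (two_point_ip_one pT pmu Pc HP2 u r0) u1.
Qed.

Lemma two_point_avg_generator s (u g : V2) : 0 < s ->
  weak_avg ip2 (fun r => Q2 r u) 0 s g ->
  generator mu2 P2 g (s^-1 *: (Q2 s u - u) : V2).
Proof.
move=> s0 hg; split; [exact: L2T_L2|exact: L2T_L2|].
set w : V2 := s^-1 *: _.
have E h : 0 < h -> (h^-1 *: (Q2 h g - g) - w : V2) =
    (fun x => h^-1 * (P2 h g x - g x) - w x) :> (T * T -> R).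
  by move=> h0; rewrite L2T_BE -(two_point_opE HP2 g (ltW h0)).
apply/cvg_L2norm0P => [h h0|eta eta0]; first by rewrite -E //; exact: L2T_L2.
have [e e0 he] := weak_avg_generator ip2P Q2s s0 hg eta0.
exists e; first exact: e0.
move=> h hh; have /andP[h0 _] := hh.
by have := he h hh; rewrite /nm /ipL (E h h0); exact: id.
Qed.

Lemma sing_gap_ge0 : (0 <= gap)%E.
Proof.
apply: le_ereal_inf_tmp => _ [f [g [_ _ _ ->]]].
by rewrite mule_ge0 ?inve_ge0 ?Lnorm_ge0.
Qed.

(** The gap may be infinite, so it enters through an arbitrary real lower bound [c]. *)
Lemma two_point_avg_le s c (u g : V2) : 0 < s -> 0 < c -> (c%:E <= gap)%E ->
  ip2 u (one2 mu) = 0 -> nm2 u <= 1 ->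
  weak_avg ip2 (fun r => Q2 r u) 0 s g -> nm2 g <= 2 / (s * c).
Proof.
move=> s0 c0 cgap u1 nu hg.
have b0 : 0 <= 2 / (s * c) by rewrite divr_ge0 // mulr_ge0 // ltW.
have [-> //|ng] := eqVneq (nm2 g) 0.
have pg : 0 < nm2 g by rewrite lt_def ng nm_ge0.
have : (c%:E <= (nm2 (s^-1 *: (Q2 s u - u)) / nm2 g)%:E)%E.
  apply: (le_trans cgap); apply: ereal_inf_lbound.
  exists g, (s^-1 *: (Q2 s u - u) : V2); split.
  - exact: two_point_avg_generator.
  - exact: two_point_avg_L20 s0 u1 hg.
  - by rewrite L2norm_nm eqe.
  - by rewrite !L2norm_nm inver (negbTE ng) EFinM.
rewrite lee_fin ler_pdivlMr // => h.
have := le_trans h (weak_avg_generator_norm ip2P Q2s u s0).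
rewrite ler_pdivlMr // => h2.
rewrite ler_pdivlMr ?mulr_gt0 // mulrA mulrC mulrA (le_trans h2) //.
by rewrite ler_piMr.
Qed.

Lemma two_point_opnorm_le s c : 0 < s -> 0 < c -> (c%:E <= gap)%E ->
  (opnorm0 mu2 (time_avg mu2 P2 s) <= (2 / (s * c))%:E)%E.
Proof.
move=> s0 c0 cgap; apply: ge_ereal_sup => _ [f [[lf f1] nf] <-].
pose u : V2 := toL2 lf; have uE : u = f :> (T * T -> R) := toL2E lf.
have [g gE hg] := time_avg_weak_avg (fun t u t0 => two_point_opE HP2 u t0) u Q2s
  (L2_complete (mu2_fin mu)) s0.
rewrite -uE gE L2norm_nm lee_fin.
apply: (two_point_avg_le s0 c0 cgap _ _ hg).
- by apply/L20_ip_one2; rewrite uE; split.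
- by rewrite -lee_fin -L2norm_nm uE.
Qed.

(** 2 e / c is the time s at which the bound 2 / (s c) reaches 1 / e. *)
Lemma t_rel_avg_le c : 0 < c -> (c%:E <= gap)%E ->
  (t_rel_avg mu2 P2 <= (2 * expR 1 / c)%:E)%E.
Proof.
move=> c0 cgap; have t0 : 0 < 2 * expR 1 / c by rewrite divr_gt0 // mulr_gt0 ?expR_gt0.
apply: ereal_inf_lbound; exists (2 * expR 1 / c) => //; split; first exact: ltW.
move=> s ts; have s0 := lt_le_trans t0 ts.
apply: (le_trans (two_point_opnorm_le s0 c0 cgap)); rewrite lee_fin.
rewrite ler_pdivrMr ?mulr_gt0 // ler_pdivlMl ?expR_gt0 //.
by move: ts; rewrite ler_pdivrMr // mulrC.
Qed.

(** For a zero gap the right-hand side is +oo. For an infinite gap it is 0, and the left-hand side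
    is below every eta > 0, by the choice c = 2 e / eta. *)
Lemma half_t_rel_avg_le :
  ((2^-1)%:E * t_rel_avg mu2 P2 <= (expR 1)%:E / gap)%E.
Proof.
have := sing_gap_ge0; rewrite lee_pdivrMl //.
case E : gap => [r| |] //.
- rewrite lee_fin le_eqVlt => /predU1P[<-|r0].
    by rewrite inve0 gt0_muley ?lte_fin ?expR_gt0 // gt0_muley ?leey // lte_fin.
  rewrite inver (gt_eqF r0) -!EFinM mulrA.
  by apply: t_rel_avg_le; rewrite // E.
- move=> _; rewrite invey mule0 mule0; apply/lee_addgt0Pr => eta eta0; rewrite add0e.
  have c0 : 0 < 2 * expR 1 / eta by rewrite divr_gt0 // mulr_gt0 ?expR_gt0.
  have := t_rel_avg_le c0; rewrite E leey => /(_ isT) /le_trans; apply.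
  rewrite lee_fin le_eqVlt; apply/orP; left; apply/eqP; field.
  by rewrite (gt_eqF eta0) (gt_eqF (expR_gt0 1)).
Qed.

End spectral_gap.

(** * The kernel relaxation time *)

Section kernel_relaxation.
Context d (T : measurableType d) (R : realType).
Variables (p : R -> R.-pker T ~> T) (mu : probability T R).
Hypotheses (pT : transition_function p) (pmu : invariant_measure p mu).
Notation P := (transition_semigroup p).
Hypothesis Pc : strongly_continuous mu P.
Variable P2 : R -> (T * T -> R) -> T * T -> R.
Hypothesis HP2 : forall t, 0 <= t -> tensor_square mu (P t) (P2 t).
Notation mu2 := (mu \x mu)%E.
Notation V1 := (L2T mu).
Notation ip1 := (@ipL _ _ _ mu).
Notation nm1 := (nm ip1).
Let ip1P := semi_ipL mu.
Notation Q := (transition_op pmu).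
Let Qs := transition_op_contraction pT pmu Pc.
Variables (k : T * T -> R) (Khalf : (T -> R) -> T -> R) (eps : R).
Hypotheses (lk : L2 mu2 k) (KhalfP : nonneg_sqrt mu (integral_operator mu k) Khalf).
Hypothesis eps0 : 0 < eps.
Notation nk := (fine (L2norm mu2 k)).

Lemma fine_L2norm_ge0 : 0 <= nk.
Proof. by rewrite fine_ge0 ?Lnorm_ge0. Qed.

Lemma t_rel_K_le t c : 0 <= t -> 0 <= c ->
  (forall u : V1, ip1 u (one1 mu) = 0 -> ip1 (Q t u) (Q t u) <= c * ip1 u u) ->
  nk * c <= eps ^+ 2 -> (t_rel_K mu Khalf P eps <= t%:E)%E.
Proof.
move=> t0 c0 decay nkc; apply: ereal_inf_lbound; exists t => //; split=> //.
apply: ge_ereal_sup => _ [f [[lf f1] nf] <-].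
pose u : V1 := toL2 lf; have uE : u = f :> (T -> R) := toL2E lf.
have u1 : ip1 u (one1 mu) = 0 by rewrite ip_one1 uE.
have nu : nm1 u <= 1 by rewrite -lee_fin -L2norm_nm uE.
rewrite -uE -(transition_opE pmu u t0).
have [[KL2 _ _] _ _ _] := KhalfP.
rewrite L2norm_sqrt; last exact/KL2/L2T_L2.
rewrite lee_fin -[leRHS](gtr0_norm eps0) -sqrtr_sqr ler_wsqrtr //.
apply: (le_trans (sqrt_kernel_le (Q t u) lk KhalfP)).
apply: (le_trans (ler_wpM2l fine_L2norm_ge0 (decay u u1))).
rewrite mulrA; apply: le_trans nkc.
rewrite ler_piMr ?mulr_ge0 ?fine_L2norm_ge0 // -(nm_sqr ip1P).
by rewrite expr_le1 ?nm_ge0.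
Qed.

(** The universal constant C; its factor e is the price of odd numbers of half steps. *)
Definition relaxation_const : R := decay_const R * expR 1.

Lemma relaxation_const_ge1 : 1 <= relaxation_const.
Proof.
have e1 : 1 <= expR (1 : R) by rewrite -expR0 ler_expR.
by rewrite -[1]mulr1 ler_pM // ltW // decay_const_gt1.
Qed.

Lemma t_rel_K_le_steps (n : nat) s : 0 < s ->
  (opnorm0 mu2 (time_avg mu2 P2 s) <= (expR 1)^-1%:E)%E ->
  relaxation_const * nk <= expR n%:R * eps ^+ 2 ->
  (t_rel_K mu Khalf P eps <= (n%:R / 2 * s)%:E)%E.
Proof.
move=> s0 avg_le Ck.
have t0 : 0 <= n%:R / 2 * s by rewrite mulr_ge0 ?divr_ge0 // ltW.
have C0 : 0 <= relaxation_const * expR (- n%:R).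
  by rewrite mulr_ge0 ?expR_ge0 // (le_trans ler01) // relaxation_const_ge1.
apply: (t_rel_K_le t0 C0) => [u u1|].
  exact: (transition_decay pT pmu Pc HP2 s0 avg_le n u1).
by rewrite mulrCA mulrA expRN ler_pdivrMr ?expR_gt0 // [leRHS]mulrC.
Qed.

Lemma t_rel_K_le0 : nk <= eps ^+ 2 -> (t_rel_K mu Khalf P eps <= 0)%E.
Proof.
move=> nke; apply: (t_rel_K_le (lexx 0) ler01) => [u _|]; last by rewrite mulr1.
have [_ contr _ _ _] := Qs; have := contr 0 u (lexx 0).
by rewrite (nm_le ip1P) ?nm_ge0 // (nm_sqr ip1P) mul1r.
Qed.

(** The infimum defining the averaged relaxation time may not be attained, so the bound is proved
    for each admissible t and the infimum is taken afterwards. *)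
Lemma t_rel_K_le_t_rel_avg (n : nat) : relaxation_const * nk <= expR n%:R * eps ^+ 2 ->
  (t_rel_K mu Khalf P eps <= (2^-1)%:E * t_rel_avg mu2 P2 * n%:R%:E)%E.
Proof.
case: n => [|n] Ck.
  (* For n = 0 the right-hand side is 0 even if the averaged relaxation time is infinite;
     contraction alone must suffice at time 0, and it does since C >= 1. *)
  rewrite mule0; apply: t_rel_K_le0.
  move: Ck; rewrite expR0 mul1r; apply: le_trans.
  by rewrite ler_peMl ?fine_L2norm_ge0 // relaxation_const_ge1.
rewrite muleAC -EFinM; set c := 2^-1 * n.+1%:R.
have c0 : 0 < c by rewrite mulr_gt0.
rewrite -lee_pdivrMl //; apply: le_ereal_inf_tmp => _ [t [t0 ht] <-].
rewrite lee_pdivrMl //; apply/lee_addgt0Pr => eta eta0.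
(* An admissible t may be 0, while the averaging horizon has to be positive; t + eta / c is positive
   and also admissible. *)
have e0 : 0 < eta / c by rewrite divr_gt0.
have te : t <= t + eta / c by rewrite lerDl ltW.
apply: (le_trans (t_rel_K_le_steps (ltr_wpDl t0 e0) (ht _ te) Ck)); rewrite -EFinM -EFinD lee_fin.
rewrite [n.+1%:R / 2]mulrC -/c mulrDr.
by rewrite [X in _ + X]mulrC (divfK (lt0r_neq0 c0)).
Qed.

End kernel_relaxation.

(** The maximum with 0 matters when the logarithm is at most -1: relaxation times are never
    negative. Rounding up only increases the exponential, so the inequality for [n] follows from the
    definition of the logarithm. *)
Lemma ln_ceil_le (R : realType) (C a eps : R) : 0 < C -> 0 <= a -> 0 < eps ->
  exists2 n : nat, Num.max 0 (Num.ceil (ln (C * a * eps ^- 2))) = n%:Z &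
    C * a <= expR n%:R * eps ^+ 2.
Proof.
move=> C0 a0 eps0; set x := ln _; set N := Num.max _ _.
have N0 : 0 <= N by rewrite le_max lexx.
exists `|N|%N; first by rewrite gez0_abs.
have e2 : 0 < eps ^+ 2 by rewrite exprn_gt0.
(* For a = 0 the left-hand side is 0, so the value of the logarithm at 0 does not matter. *)
have [->|an] := eqVneq a 0; first by rewrite mulr0 mulr_ge0 ?expR_ge0 // ltW.
have pos : 0 < C * a * eps ^- 2 by rewrite !mulr_gt0 ?invr_gt0 // lt_def an.
rewrite -ler_pdivrMr // -ler_ln ?posrE ?expR_gt0 // expRK -/x.
have xN : x <= N%:~R.
  by rewrite (le_trans (ceil_ge x)) // ler_int le_max lexx orbT.
by rewrite (le_trans xN) // -[in leLHS](gez0_abs N0) pmulrn.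
Qed.

Theorem theorem14 (R : realType) :
  exists2 C : R, 0 < C &
  forall (S : ptopologicalType),
  polish R S ->
  forall (p : R -> R.-pker (borel S) ~> (borel S))
    (mu : probability (borel S) R),
  transition_function p ->
  invariant_measure p mu ->
  let P := transition_semigroup p in
  strongly_continuous mu P ->
  forall P2 : R -> (borel S * borel S -> R) -> (borel S * borel S -> R),
  (forall t, 0 <= t -> tensor_square mu (P t) (P2 t)) ->
  forall k : borel S * borel S -> R,
  L2 (mu \x mu)%E k ->
  symmetric_kernel mu k ->
  nonneg_definite mu k ->
  forall Khalf : (borel S -> R) -> (borel S -> R),
  nonneg_sqrt mu (integral_operator mu k) Khalf ->
  forall eps : R, 0 < eps ->
  let N : int := Num.max 0
    (Num.ceil (ln (C * fine (L2norm (mu \x mu)%E k) * eps ^- 2))) in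
  (t_rel_K mu Khalf P eps
     <= (2^-1)%:E * t_rel_avg (mu \x mu)%E P2 * (N%:~R)%:E)%E /\
  ((2^-1)%:E * t_rel_avg (mu \x mu)%E P2 * (N%:~R)%:E
     <= (expR 1)%:E / sing_gap (mu \x mu)%E P2 * (N%:~R)%:E)%E.
Proof.
have C0 := lt_le_trans ltr01 (relaxation_const_ge1 R).
exists (relaxation_const R) => // S _ p mu pT pmu P Pc P2 HP2 k lk _ _ Khalf KhalfP eps eps0 N.
have [n NE Ck] := ln_ceil_le C0 (fine_L2norm_ge0 mu k) eps0.
rewrite /N NE -pmulrn; split.
  exact: (t_rel_K_le_t_rel_avg pT pmu Pc HP2 lk KhalfP eps0 Ck).
by apply: lee_wpmul2r; [rewrite lee_fin|exact: (half_t_rel_avg_le pT pmu Pc HP2)].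
Qed.
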